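(* Suppose that $Z_1,\ldots,Z_M\mid\mu$ are iid $\mathrm{IBP}(G_A|\mu)$, where $\mu$ is $\mathrm{CRM}(\rho B_0)$, represented as $\mu(d\omega)=\int_0^\infty s\,N(ds,d\omega)$ with $N$ a $\mathrm{PRM}(\rho B_0)$. Let $\omega_1,\ldots,\omega_K$ be the distinct features to which at least one of $Z_1,\ldots,Z_M$ assigns a nonzero value, let $a_{i,\ell}$ be the value (possibly $0$) that $Z_i$ assigns to $\omega_\ell$, and set $\rho_M(s|\omega)=[1-\pi_A(s)]^M\rho(s|\omega)$, $$h_{i,\ell}(s)=\left[\frac{G_A(da_{i,\ell}|s)}{1-\pi_A(s)}\right]^{\mathbb{I}_{\{a_{i,\ell}\neq 0\}}},\qquad \Psi(f_M)=\int_\Omega\int_0^\infty\big(1-[1-\pi_A(s)]^M\big)\rho(s|\omega)\,ds\,B_0(d\omega).$$ Then: (i) The posterior distribution of $N\mid Z_1,\ldots,Z_M$ is equivalent to the distribution of $$N_M+\sum_{\ell=1}^K\delta_{(J_\ell,\omega_\ell)},$$ where $N_M$ is $\mathrm{PRM}(\rho_M B_0)$ and, independently of $N_M$, the $J_1,\ldots,J_K$ are (conditionally on $Z_1,\ldots,Z_M$) independent with $$\mathbb{P}_{\ell,M}(J_\ell\in ds)\propto[1-\pi_A(s)]^M\rho(s|\omega_\ell)\prod_{i=1}^M h_{i,\ell}(s)\,ds .$$ (ii) The posterior distribution of $\mu\mid Z_1,\ldots,Z_M$ is equivalent to the distribution of $$\mu_M+\sum_{\ell=1}^K J_\ell\,\delta_{\omega_\ell},$$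 where $\mu_M$ is $\mathrm{CRM}(\rho_M B_0)$ and $(J_\ell)$ is as in (i), independent of $\mu_M$. (iii) The marginal distribution of $(Z_1,\ldots,Z_M)$ is given by $$\mathbb{P}(Z_1,\ldots,Z_M)=e^{-\Psi(f_M)}\prod_{\ell=1}^K\left[\int_0^\infty[1-\pi_A(s)]^M\rho(s|\omega_\ell)\prod_{i=1}^M h_{i,\ell}(s)\,ds\right]B_0(d\omega_\ell).$$
   Context: **Setting.** $\Omega$ is a Polish space with a probability measure $B_0$. $\rho(s|\omega)\ge 0$ is a Lévy density in $s\in(0,\infty)$, possibly depending on $\omega\in\Omega$, with $\int_0^\infty\min(s,1)\rho(s|\omega)\,ds<\infty$; the total mass $\int_0^\infty\rho(s|\omega)\,ds$ may be infinite or finite. **PRM and CRM.** $N$ is $\mathrm{PRM}(\rho B_0)$ if $N=\sum_k\delta_{(\tau_k,\tilde\omega_k)}$ is a Poisson random measure on $(0,\infty)\times\Omega$ with mean intensity $\rho(s|\omega)\,ds\,B_0(d\omega)$. Then $\mu(d\omega)=\int_0^\infty sN(ds,d\omega)=\sum_k\tau_k\delta_{\tilde\omega_k}$ is said to be $\mathrm{CRM}(\rho B_0)$. The $\tilde\omega_k$ are called features. **$\mathrm{IBP}(G_A|\mu)$.** $G_A(da|s)$ gives, for each $s$, the distribution of a variable $A$ (possibly vector valued, discrete or continuous apart from its mass at zero). Write $\pi_A(s)=\mathbb{P}(A\neq0|s)$; it is assumed that $A$ takes the value zero with positive probability, $1-\pi_A(s)=\mathbb{P}(A=0|s)>0$.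 $Z_1,\ldots,Z_M\mid\mu$ are iid $\mathrm{IBP}(G_A|\mu)$ if $Z_i=\sum_k A_{i,k}\delta_{\tilde\omega_k}$, where conditionally on $(\tau_k)$ the variables $A_{i,k}$ are independent over $(i,k)$ with $A_{i,k}\sim G_A(da|\tau_k)$. **Reading of the formulas.** $[1-\pi_A(s)]^M\prod_{i=1}^M h_{i,\ell}(s)=\prod_{i=1}^M G_A(da_{i,\ell}|s)$, where for $a_{i,\ell}=0$ the factor is the mass $1-\pi_A(s)$. Expressions containing $G_A(da|s)$ are understood as measures in the values $a$, and the law of $J_\ell$ is the corresponding conditional distribution of $s$ given the values $a_{1,\ell},\ldots,a_{M,\ell}$. The formula in (iii) is the joint measure of the selected features $\omega_\ell$ and their values $a_{i,\ell}$.
   Formalization: It is assumed that the selected features are a.s. finitely many and that they and their individual values can be listed as measurable functions of Z_1,…,Z_M (true for diffuse B_0 when Ψ(f_M)<∞); for B_0 with atoms, features may coincide and the claim can fail. *)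

(* Defs.v *)
From HB Require Import structures.
From mathcomp Require Import all_boot all_order all_algebra perm.
From mathcomp Require Import all_classical all_reals all_analysis.
From mathcomp Require Import measurable_realfun.

Set Implicit Arguments.
Unset Strict Implicit.
Unset Printing Implicit Defensive.

Import Order.TTheory GRing.Theory Num.Theory.
Import numFieldNormedType.Exports.

Local Open Scope classical_set_scope.
Local Open Scope ring_scope.
Local Open Scope ereal_scope.

Definition is_metric (R : realType) (T : Type) (dist : T -> T -> R) : Prop :=
  [/\ forall x y, (0 <= dist x y)%R,
      forall x y, dist x y = 0%R <-> x = y,
      forall x y, dist x y = dist y x &
      forall x y z, (dist x z <= dist x y + dist y z)%R].

Definition metric_complete (R : realType) (T : Type) (dist : T -> T -> R) : Prop :=
  forall u : nat -> T,
    (forall e : R, (0 < e)%R -> exists N, forall m n,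
      (N <= m)%N -> (N <= n)%N -> (dist (u m) (u n) < e)%R) ->
    exists l, forall e : R, (0 < e)%R -> exists N, forall n,
      (N <= n)%N -> (dist (u n) l < e)%R.

Definition polish (R : realType) (T : topologicalType) : Prop :=
  (exists2 D : set T, countable D & dense D) /\
  exists dist : T -> T -> R,
    [/\ is_metric dist, metric_complete dist &
        forall U : set T, open U <->
          forall x, U x -> exists2 e : R, (0 < e)%R &
            [set y | (dist x y < e)%R] `<=` U].

Notation borel T := (g_sigma_algebraType (@open T)).

(* The sigma-algebra generated by the evaluations [m |-> m A], [A] measurable.
   Random measures are compared as random elements of the space of set
   functions with this sigma-algebra, i.e. through the joint laws of their
   values on measurable sets. *)
Definition eval_sigma (R : realType) d (X : measurableType d) :
    set (set (set X -> \bar R)) :=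
  <<s [set E | exists2 A, measurable A & exists2 C : set (\bar R), measurable C &
        E = [set m : set X -> \bar R | C (m A)]] >>.

(* [Q] is a regular version of the conditional law of [Y] given [F]. *)
Definition conditional_law (R : realType) d (T : measurableType d)
    (P : probability T R) (F : set (set T)) (V : Type) (sV : set (set V))
    (Y : T -> V) (Q : T -> set V -> \bar R) : Prop :=
  forall E, sV E ->
    (forall C : set (\bar R), measurable C -> F [set t | C (Q t E)]) /\
    (forall S, F S -> P (S `&` Y @^-1` E) = \int[P]_(t in S) Q t E).

Definition is_PRM (R : realType) d (T : measurableType d) (P : probability T R)
    dX (X : measurableType dX) (nu : set X -> \bar R)
    (N : T -> {measure set X -> \bar R}) : Prop :=
  [/\ forall A, measurable A -> measurable_fun setT (fun t => N t A),
      forall A, measurable A -> nu A < +oo -> forall n : nat,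
        P [set t | N t A = n%:R%:E] =
        ((fine (nu A)) ^+ n / n`!%:R * expR (- fine (nu A)))%:E,
      forall A, measurable A -> nu A = +oo -> {ae P, forall t, N t A = +oo} &
      forall n (A : 'I_n -> set X) (C : 'I_n -> set (\bar R)),
        (forall i, measurable (A i)) -> (forall i, measurable (C i)) ->
        trivIset setT A ->
        P [set t | forall i, C i (N t (A i))] =
        \prod_(i < n) P [set t | C i (N t (A i))]].

Section crm.
Context (R : realType) (Omega : ptopologicalType).
Implicit Types (rho : R -> Omega -> R).

(* The measure rho(s|w) ds B0(dw) on (0,oo) x Omega, as a measure on R x Omega. *)
Definition intensity rho (B0 : probability (borel Omega) R)
    (A : set (R * borel Omega)) : \bar R :=
  \int[B0]_w \int[lebesgue_measure]_(s in [set s | (0 < s)%R /\ A (s, w)])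
    (rho s w)%:E.

Definition crm_of (N : {measure set (R * borel Omega) -> \bar R})
    (B : set (borel Omega)) : \bar R :=
  \int[N]_(x in [set x | (0 < x.1)%R /\ B x.2]) (x.1)%:E.

Definition is_CRM d (T : measurableType d) (P : probability T R) rho
    (B0 : probability (borel Omega) R)
    (mu : T -> set (borel Omega) -> \bar R) : Prop :=
  exists2 N : T -> {measure set (R * borel Omega) -> \bar R},
    is_PRM P (intensity rho B0) N &
    forall t B, measurable B -> mu t B = crm_of (N t) B.

Definition levy_density rho : Prop :=
  [/\ measurable_fun setT (fun x : R * borel Omega => rho x.1 x.2),
      forall s w, (0 < s)%R -> (0 <= rho s w)%R &
      forall w, \int[lebesgue_measure]_(s in [set s : R | (0 < s)%R])
                  (Num.min s 1 * rho s w)%:E < +oo].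

End crm.

Section point_process.
Context d (T : measurableType d) (R : realType) dX (X : measurableType dX).

(* A point process with at most countably many atoms: the [k]-th atom sits at
   [pts k t], and exists only when [alive k t]. *)
Definition atoms_measure (alive : nat -> T -> bool) (pts : nat -> T -> X)
    (t : T) : {measure set X -> \bar R} :=
  mseries (fun k => if alive k t then [the {measure set X -> \bar R} of
                                         \d_(pts k t)] else mzero) 0.

Definition sigma_atoms (alive : nat -> T -> bool) (pts : nat -> T -> X) :
    set (set T) :=
  <<s [set E | exists k, exists2 D, measurable D &
        E = [set t | alive k t /\ D (pts k t)]] >>.

End point_process.

Section ibp.
Context (R : realType) (q : nat).
Local Notation V := (q.-tuple R).
Implicit Types G : R -> {measure set V -> \bar R}.

Definition zeroV : V := [tuple 0%R | _ < q].

Lemma measurable_nonzero : measurable (~` [set zeroV]).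
Proof.
apply: measurableC.
rewrite (_ : [set zeroV] =
    \bigcap_(i in [set: 'I_q]) ((@tnth q R)^~ i @^-1` [set 0%R])).
  apply: fin_bigcap_measurable => // i _.
  rewrite -[X in measurable X]setTI.
  exact: measurable_tnth.
apply/seteqP; split => [v -> i _ /=|v vz]; first by rewrite tnth_mktuple.
by apply/eq_from_tnth => i; rewrite tnth_mktuple; exact: vz.
Qed.

Definition pi_A G (s : R) : R := fine (G s (~` [set zeroV])).

Lemma invr_normr_ge0 (x : R) : (0 <= `|x|^-1)%R.
Proof. by rewrite invr_ge0. Qed.

(* [G_A(da|s) / (1 - pi_A(s))] to the power [I_{a <> 0}], as a measure in [a]:
   a unit mass at [0], plus [G_A(da|s) / (1 - pi_A(s))] off [0].
   The absolute value only serves typing, as [0 <= 1 - pi_A(s)]. *)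
Definition h_A G (s : R) : {measure set V -> \bar R} :=
  measure_add \d_zeroV
    (mscale (NngNum (invr_normr_ge0 (1 - pi_A G s)))
            (mrestr (G s) measurable_nonzero)).

Definition rho_post (Omega : Type) (M : nat) G (rho : R -> Omega -> R)
    (s : R) (w : Omega) : R :=
  ((1 - pi_A G s) ^+ M * rho s w)%R.

Definition Psi (Omega : ptopologicalType) (M : nat) G (rho : R -> Omega -> R)
    (B0 : probability (borel Omega) R) : \bar R :=
  \int[B0]_w \int[lebesgue_measure]_(s in [set s : R | (0 < s)%R])
    ((1 - (1 - pi_A G s) ^+ M) * rho s w)%:E.

Fixpoint tuple_integral (n : nat) (m : {measure set V -> \bar R}) :
    (n.-tuple V -> \bar R) -> \bar R :=
  match n with
  | 0%N => fun f => f [tuple]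
  | n'.+1 => fun f =>
      \int[m]_v tuple_integral m (fun u : n'.-tuple V => f (cons_tuple v u))
  end.

(* [kappa (w, a)] is the law of a jump at the feature [w] with values
   [a = (a_1, .., a_M) <> 0]: for almost every [w], it is a regular version of
   the conditional law of [s] given [a] under the measure
   [(1 - pi_A s)^M rho(s|w) \prod_i h_i(da_i|s) ds]. The condition on [D] keeps
   the rectangle [\prod_i D i] away from [a = 0]. *)
Definition jump_kernel (Omega : ptopologicalType) (M : nat) G
    (rho : R -> Omega -> R) (B0 : probability (borel Omega) R)
    (kappa : R.-pker (borel Omega * M.-tuple V) ~> R) : Prop :=
  {ae B0, forall w : borel Omega, forall (S : set R) (D : 'I_M -> set V),
    measurable S -> (forall i, measurable (D i)) ->
    (exists i, ~ D i zeroV) ->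
    \int[lebesgue_measure]_(s in [set s | (0 < s)%R /\ S s])
      ((rho_post M G rho s w)%:E * \prod_(i < M) h_A G s (D i)) =
    \int[lebesgue_measure]_(s in [set s : R | (0 < s)%R])
      ((rho_post M G rho s w)%:E *
       tuple_integral (h_A G s) (fun a : M.-tuple V =>
         kappa (w, a) S * \prod_(i < M) (\1_(D i) (tnth a i))%:E))}.

Section process.
Context d (T : measurableType d) (Omega : ptopologicalType) (M : nat).
Implicit Types (P : probability T R) (alive : nat -> T -> bool)
  (pts : nat -> T -> R * borel Omega) (A : 'I_M -> nat -> T -> V).

(* Given the atoms [(tau_k, w_k) = pts k], the [A i k] are independent with
   laws [G_A(.|tau_k)]; only the existing atoms carry a condition. *)
Definition iid_IBP_marks P alive pts G A : Prop :=
  (forall i k, measurable_fun setT (A i k)) /\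
  forall S, sigma_atoms alive pts S ->
  forall n (D : 'I_M -> nat -> set V), (forall i k, measurable (D i k)) ->
    P (S `&` [set t | forall i k, (k < n)%N -> alive k t -> D i k (A i k t)]) =
    \int[P]_(t in S) \prod_(i < M) \prod_(k < n)
      (if alive k t then G (pts k t).1 (D i k) else 1).

(* [Z_i = \sum_k A_{i,k} \delta_{w_k}] as a vector-valued set function *)
Definition ibp alive pts A (i : 'I_M) (t : T) (B : set (borel Omega)) : V :=
  [tuple limn (fun n => (\sum_(k < n)
     (alive k t)%:R * \1_B (pts k t).2 * tnth (A i k t) j)%R) | j < q].

Definition sigma_ibp alive pts A : set (set T) :=
  <<s [set E | exists i B (C : set V), [/\ measurable B, measurable C &
        E = [set t | C (ibp alive pts A i t B)]]] >>.

Definition selected alive A (k : nat) (t : T) : Prop :=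
  alive k t /\ exists i, A i k t <> zeroV.

(* Functions of [Z_1, .., Z_M] listing, almost surely, the finitely many
   selected features [w l] with their values [tnth (a l) i], [l < K]. The order
   of the list is immaterial. *)
Definition enumerates_selected P alive pts A (K : T -> nat)
    (w : nat -> T -> borel Omega) (a : nat -> T -> M.-tuple V) : Prop :=
  [/\ forall k, sigma_ibp alive pts A (K @^-1` [set k]),
      forall l B, measurable B -> sigma_ibp alive pts A (w l @^-1` B),
      forall l C, measurable C -> sigma_ibp alive pts A (a l @^-1` C) &
      {ae P, forall t, exists e : 'I_(K t) -> nat,
        [/\ injective e,
            forall k, selected alive A k t <-> exists l, e l = k &
            forall l : 'I_(K t), w l t = (pts (e l) t).2 /\
                      forall i, tnth (a l t) i = A i (e l) t]}].

(* The measure of [\prod_l (B l `*` \prod_i D l i)] under the joint measure of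
   the [K = k] selected features and their values. The features are unordered,
   so that a point set is counted once for each of its [k!] orderings: with
   this convention the joint measure has product form, without a factor
   [1 / k!]. *)
Definition selected_measure P (K : T -> nat) (w : nat -> T -> borel Omega)
    (a : nat -> T -> M.-tuple V) (k : nat)
    (B : 'I_k -> set (borel Omega)) (D : 'I_k -> 'I_M -> set V) : \bar R :=
  \int[P]_(t in K @^-1` [set k])
    (\sum_(p : {perm 'I_k}) \prod_(l < k)
       (\1_(B l) (w (p l) t) *
        \prod_(i < M) \1_(D l i) (tnth (a (p l) t) i)))%:E.

End process.

End ibp.

(* [J 0, .., J k.-1] have laws [kappa (x 0), .., kappa (x k.-1)], and
   [Y, J 0, .., J k.-1] are mutually independent. *)
Definition posterior_jumps (R : realType) d (T : measurableType d)
    (P : probability T R) dX (X : measurableType dX) (kappa : R.-pker X ~> R)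
    (k : nat) (x : nat -> X) dW (W : measurableType dW)
    (Y : T -> set W -> \bar R) (J : nat -> T -> R) : Prop :=
  [/\ forall l, (l < k)%N -> measurable_fun setT (J l),
      forall l, (l < k)%N -> forall S, measurable S ->
        P (J l @^-1` S) = kappa (x l) S &
      forall E (S : nat -> set R), @eval_sigma R _ W E ->
        (forall l, measurable (S l)) ->
        P (Y @^-1` E `&` [set t | forall l, (l < k)%N -> S l (J l t)]) =
        P (Y @^-1` E) * \prod_(l < k) P (J l @^-1` S l)].

(* Main.v *)
(* A point process is Poisson exactly when it satisfies Mecke's formula. For the
   atoms of [N] marked by their values, the formula iterates: summed over the
   lists of [k] distinct atoms, the expectation of [\prod_l phi_l (x_l, a_l)] on
   the event that all other atoms have value [0] and form a configuration in [E]
   is [\prod_l \int phi_l dm] times the probability that all the values are [0]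
   and [N] is in [E], where [m] is the intensity of the marked process. With the
   [phi_l] supported on nonzero values, the lists are the [k!] listings of the
   selected atoms. When all the values are [0], which has probability
   [expR (- m (a <> 0)) = expR (- Psi)], the process is Poisson with intensity
   [rho_M B0]. This gives (iii).
   For (i), an event of [sigma (Z_1, .., Z_M)] is, on each listing, an event on
   the listed features and values. Both sides of the posterior identity are then
   measures on triples (features and values, jumps, remaining configuration);
   they agree on rectangles, by the formula above and the disintegration of [m]
   with respect to (feature, values), hence everywhere. In (ii) the remaining
   configuration is replaced by its functional [crm_of]. *)

Require Import Defs.
From HB Require Import structures.
From mathcomp Require Import all_boot all_order all_algebra perm.
From mathcomp Require Import all_classical all_reals all_analysis.
From mathcomp Require Import measurable_realfun ring lra.

Set Implicit Arguments.
Unset Strict Implicit.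
Unset Printing Implicit Defensive.

Import Order.TTheory GRing.Theory Num.Theory.
Import numFieldNormedType.Exports.

Local Open Scope classical_set_scope.
Local Open Scope ring_scope.
Local Open Scope ereal_scope.

(** * Measures and laws *)

Section generated.

(** The intensity may be infinite, so laws are identified through counts on finite partitions of
    sets of finite intensity, where the counts are almost surely integers. There Mecke's formula
    becomes the recursion [(n+1) p(n+1) = x p(n)] of the Poisson weights; conversely the recursion
    forces the weights, and this is how the process on the void event is recognised as Poisson. To
    iterate the formula, the choice of an atom is made into a change of measure: on pairs
    (realization, index), with the picked atom deleted, the process is again Poisson with
    conditionally independent marks, up to its total mass. That all remaining marks are void is an
    event about infinitely many atoms; its conditional probability is one functional of the
    configuration, the same before and after a pick, and so it survives the change of measure. The
    value [expeR (- Psi)] is squeezed between two bounds, obtained from the realizations without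
    atoms in a large set of finite intensity. The finiteness of [Psi], on which the comparison of
    measures relies, is deduced from the almost sure existence of finite listings. *)

Lemma pi_lambda T (G C : set (set T)) : setI_closed G -> G `<=` C ->
  dynkin C -> <<s G >> `<=` C.
Proof.
by move=> GI GC dC; rewrite -setI_closed_g_dynkin_g_sigma_algebra//;
  exact: smallest_sub.
Qed.

Lemma sigma_preimage T V (f : T -> V) (G : set (set V)) (F : set (set T)) :
  sigma_algebra setT F -> (forall E, G E -> F (f @^-1` E)) ->
  forall E, <<s G >> E -> F (f @^-1` E).
Proof.
move=> [F0 FC FU] GF; apply: smallest_sub => //; split => /=.
- by rewrite preimage_set0.
- by move=> A FA; rewrite setTD preimage_setC -setTD; exact: FC.
- by move=> A FA; rewrite preimage_bigcup; exact: FU.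
Qed.

End generated.

Lemma measurable_preimage d (T : measurableType d) d' (Z : measurableType d')
  (f : T -> Z) C : measurable_fun setT f -> measurable C -> measurable (f @^-1` C).
Proof. by move=> mf mC; rewrite -[X in measurable X]setTI; exact: mf. Qed.

Section finite_measures.
Context (R : realType).

Lemma finite_measureC d (T : measurableType d) (P : {measure set T -> \bar R})
  (A : set T) : P setT < +oo -> measurable A -> P (~` A) = P setT - P A.
Proof.
move=> PT mA; rewrite -setTD measureD// ?setTI//.
Qed.

Lemma eq_measure_ae d (T : measurableType d) (P : {measure set T -> \bar R})
  (A B : set T) : measurable A -> measurable B ->
  {ae P, forall t, A t <-> B t} -> P A = P B.
Proof.
move=> mA mB [N [mN PN0 NAB]].
have key (C D : set T) : measurable C -> measurable D ->
    (forall t, ~ N t -> C t -> D t) -> P C <= P D.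
  move=> mC mD CD; rewrite -[leRHS]adde0 -PN0.
  rewrite (le_trans _ (measureU2 P mD mN))//; apply: le_measure; rewrite ?inE//.
    exact: measurableU.
  by move=> t Ct; have [Nt|Nt] := pselect (N t); [right|left; exact: CD].
have h t : ~ N t -> (A t <-> B t).
  by move=> Nt; apply: contrapT => AB; apply: Nt; apply: NAB.
by apply/eqP; rewrite eq_le; apply/andP; split; apply: key => // t /h [].
Qed.

(** [V] carries no sigma-algebra of its own: the measurability of the two preimages goes through the
    Dynkin argument together with the equality of masses. The total mass is only required to be
    finite, since picking an atom changes it. *)
Lemma finite_law_unique d (T : measurableType d) d' (T' : measurableType d')
  (P : {measure set T -> \bar R}) (P' : {measure set T' -> \bar R})
  V (f : T -> V) (f' : T' -> V) (G : set (set V)) :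
  setI_closed G -> P setT < +oo -> P setT = P' setT ->
  (forall E, G E -> [/\ measurable (f @^-1` E), measurable (f' @^-1` E) &
    P (f @^-1` E) = P' (f' @^-1` E)]) ->
  forall E, <<s G >> E -> P (f @^-1` E) = P' (f' @^-1` E).
Proof.
move=> GI PT PP' Gh E sE.
suff [] : [/\ measurable (f @^-1` E), measurable (f' @^-1` E) &
    P (f @^-1` E) = P' (f' @^-1` E)] by [].
move: E sE; apply: pi_lambda => //; split => /=.
- by rewrite !preimage_setT.
- move=> E /= [mf mf' fE].
  change [/\ measurable (~` (f @^-1` E)), measurable (~` (f' @^-1` E)) &
    P (~` (f @^-1` E)) = P' (~` (f' @^-1` E))]; split.
  + exact: measurableC.
  + exact: measurableC.
  + rewrite (finite_measureC PT mf) PP' fE finite_measureC//.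
    by rewrite -PP'.
- move=> F tF FE /=; rewrite (preimage_bigcup setT f) (preimage_bigcup setT f').
  split.
  + by apply: bigcup_measurable => k _; have [] := FE k.
  + by apply: bigcup_measurable => k _; have [] := FE k.
  + rewrite !measure_bigcup//.
    * by apply: eq_eseriesr => k _; have [] := FE k.
    * by move=> k _; have [] := FE k.
    * by move/trivIsetP : tF => tF; apply/trivIsetP => i j _ _ ij;
        rewrite -preimage_setI tF// preimage_set0.
    * by move=> k _; have [] := FE k.
    * by move/trivIsetP : tF => tF; apply/trivIsetP => i j _ _ ij;
        rewrite -preimage_setI tF// preimage_set0.
Qed.

End finite_measures.

Section density_measure.
Context (R : realType) d (T : measurableType d).
Variables (P : {measure set T -> \bar R}) (g : T -> \bar R).
Hypotheses (g0 : forall t, 0 <= g t) (mg : measurable_fun setT g).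

Definition mdens (A : set T) : \bar R := \int[P]_(t in A) g t.

Let mdens0 : mdens set0 = 0. Proof. exact: integral_set0. Qed.
Let mdens_ge0 A : 0 <= mdens A. Proof. by apply: integral_ge0 => t _. Qed.
Let mdens_sigma_additive : semi_sigma_additive mdens.
Proof.
move=> F mF tF mUF; rewrite /mdens ge0_integral_bigcup//; last first.
  exact: measurable_funTS.
by apply: is_cvg_ereal_nneg_natsum => n _; exact: integral_ge0.
Qed.

HB.instance Definition _ := isMeasure.Build _ _ _ mdens
  mdens0 mdens_ge0 mdens_sigma_additive.

Definition density : {measure set T -> \bar R} := mdens.

End density_measure.

Section integral_functional.
Context (R : realType) d (X : measurableType d).
Import HBNNSimple.

(** Simple functions and monotone limits: such an [L] is determined by its values on indicators.
    This serves for densities, for mixtures and for iterated integrals over tuples. *)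
Lemma ge0_integral_functional (mu : {measure set X -> \bar R})
    (L : (X -> \bar R) -> \bar R) :
  (forall A, measurable A -> L (fun x => (\1_A x)%:E) = mu A) ->
  (forall (c : R) f, (0 <= c)%R -> (forall x, 0 <= f x) ->
    measurable_fun setT f -> L (fun x => c%:E * f x) = c%:E * L f) ->
  (forall f g, (forall x, 0 <= f x) -> (forall x, 0 <= g x) ->
    measurable_fun setT f -> measurable_fun setT g ->
    L (fun x => f x + g x) = L f + L g) ->
  (forall u : nat -> X -> \bar R, (forall n x, 0 <= u n x) ->
    (forall n, measurable_fun setT (u n)) ->
    (forall x, nondecreasing_seq (u ^~ x)) ->
    L (fun x => limn (u ^~ x)) = limn (fun n => L (u n))) ->
  forall f, (forall x, 0 <= f x) -> measurable_fun setT f ->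
    L f = \int[mu]_x f x.
Proof.
move=> L1 LZ LD Llim f f0 mf.
have L0 : L (fun=> 0) = 0.
  rewrite [X in L X](_ : _ = (fun x => (\1_(set0 : set X) x)%:E)).
    by rewrite L1// measure0.
  by apply/funext => x; rewrite indic0.
have Lsum (I : eqType) (s : seq I) (c : I -> R) (A : I -> set X) :
    (forall i, i \in s -> (0 <= c i)%R) -> (forall i, measurable (A i)) ->
    L (fun x => \sum_(i <- s) (c i)%:E * (\1_(A i) x)%:E) =
    \sum_(i <- s) (c i)%:E * mu (A i).
  move=> + mA; elim: s => [_|i s IH cs].
    by rewrite big_nil; under eq_fun do rewrite big_nil.
  have ci : (0 <= c i)%R by apply: cs; rewrite inE eqxx.
  have cs' j : j \in s -> (0 <= c j)%R by move=> js; apply: cs; rewrite inE js orbT.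
  have mI : measurable_fun setT (fun x => (\1_(A i) x)%:E : \bar R).
    by apply/measurable_EFinP; exact: measurable_indic.
  under eq_fun do rewrite big_cons.
  rewrite big_cons -IH// LD.
  - by rewrite LZ// ?L1// => x; rewrite lee_fin.
  - by move=> x; rewrite mule_ge0// lee_fin.
  - move=> x; rewrite big_seq sume_ge0// => j js.
    by rewrite mule_ge0// lee_fin// cs'.
  - exact: measurable_funeM.
  - apply: emeasurable_sum => j; apply: measurable_funeM.
    by apply/measurable_EFinP; exact: measurable_indic.
have Lsf (h : {nnsfun X >-> R}) : L (EFin \o h) = \int[mu]_x (h x)%:E.
  rewrite integralT_nnsfun sintegralE fsbig_finite//=.
  rewrite -(Lsum _ _ id (fun r => h @^-1` [set r])).
  - congr L; apply/funext => x /=; rewrite fimfunE fsbig_finite//= -sumEFin.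
    by apply: eq_bigr => r _; rewrite EFinM.
  - by move=> r; rewrite in_fset_set// inE => -[x _ <-].
  - by [].
pose f_ := nnsfun_approx measurableT mf.
have fE : f = (fun x => limn (fun n => (f_ n x)%:E)).
  by apply/funext => x; apply/esym/cvg_lim => //; exact: cvg_nnsfun_approx.
have nd x : nondecreasing_seq (fun n => (f_ n x)%:E : \bar R).
  by move=> a b ab; rewrite lee_fin; exact/lefP/nd_nnsfun_approx.
have mf_ n : measurable_fun setT (fun x => (f_ n x)%:E : \bar R).
  exact/measurable_EFinP.
have f_0 n x : 0 <= (f_ n x)%:E :> \bar R by rewrite lee_fin.
rewrite [in LHS]fE Llim// [in RHS]fE monotone_convergence//.
by under eq_fun do rewrite Lsf.
Qed.

End integral_functional.

Lemma ge0_nondecreasing_limeMl (R : realType) (g : \bar R) (u : nat -> \bar R) :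
  0 <= g -> (forall n, 0 <= u n) -> nondecreasing_seq u ->
  limn (fun n => g * u n) = g * limn u.
Proof.
move=> g0 u0 nu; have cu := ereal_nondecreasing_is_cvgn nu.
have [gfin|] := boolP (g \is a fin_num); first exact: limeMl.
rewrite ge0_fin_numE// -leNgt leye_eq => /eqP ->.
have le_lim n : u n <= limn u.
  by apply: lime_ge => //; exists n => // m /= nm; exact: nu.
have [l0|l0] := eqVneq (limn u) 0.
  rewrite l0 mule0 (_ : (fun _ => _) = fun=> 0); first exact: lim_cst.
  apply/funext => n; rewrite (_ : u n = 0) ?mule0//.
  by apply/eqP; rewrite eq_le u0 -l0 le_lim.
(* With [g] infinite, the products are [+oo] from the first positive term on. *)
have [n un0] : exists n, 0 < u n.
  apply: contrapT => /forallNP un; move/eqP: l0; apply.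
  have -> : u = (fun=> 0).
    by apply/funext => n; apply/eqP; rewrite eq_le u0 leNgt andbT; apply/negP/un.
  by apply: lim_cst.
rewrite gt0_mulye ?(lt_le_trans un0)//; apply/cvg_lim => //.
apply: cvg_near_cst; near=> m.
rewrite gt0_mulye// (lt_le_trans un0)// nu//.
by near: m; exists n.
Unshelve. all: by end_near. Qed.

Section integral_density.
Context (R : realType) d (T : measurableType d).
Variables (P : {measure set T -> \bar R}) (g : T -> \bar R).
Hypotheses (g0 : forall t, 0 <= g t) (mg : measurable_fun setT g).

Lemma integral_density f : (forall x, 0 <= f x) -> measurable_fun setT f ->
  \int[density P g0 mg]_t f t = \int[P]_t (f t * g t).
Proof.
move=> f0 mf; apply/esym.
apply: (ge0_integral_functional (L := fun f => \int[P]_t (f t * g t))) => //.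
- move=> A mA; rewrite /density/= /mdens [RHS]integral_mkcond.
  apply: eq_integral => t _; rewrite patchE indicE.
  by case: (t \in A); rewrite ?mul1e ?mul0e.
- move=> c h c0 h0 mh; under eq_integral do rewrite -muleA.
  rewrite ge0_integralZl//; first exact: emeasurable_funM.
  by move=> t _; exact: mule_ge0.
- move=> h k h0 k0 mh mk; under eq_integral do rewrite ge0_muleDl//.
  by rewrite ge0_integralD//; [move=> t _; exact: mule_ge0|
    exact: emeasurable_funM|move=> t _; exact: mule_ge0|exact: emeasurable_funM].
- move=> u u0 mu nu; rewrite -monotone_convergence//.
  + apply: eq_integral => t _; rewrite muleC -ge0_nondecreasing_limeMl//.
    by congr (limn _); apply/funext => n; rewrite muleC.
  + by move=> n; exact: emeasurable_funM.
  + by move=> n t _; exact: mule_ge0.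
  + by move=> t _ a b ab; rewrite lee_wpmul2r//; exact: nu.
Qed.

End integral_density.

Section bind_measure.
Context (R : realType) d (X : measurableType d) d' (Z : measurableType d').
Variables (nu : {measure set X -> \bar R}) (k : X -> {measure set Z -> \bar R}).
Hypothesis mk : forall U, measurable U -> measurable_fun setT (k ^~ U).

(** Only setwise measurability of [k] is asked, because the sections of a Levy intensity can have
    infinite mass. *)
Definition mbind (U : set Z) : \bar R := \int[nu]_x k x U.

Let mbind0 : mbind set0 = 0.
Proof. by rewrite /mbind integral0_eq. Qed.
Let mbind_ge0 U : 0 <= mbind U. Proof. by apply: integral_ge0. Qed.
Let mbind_sigma_additive : semi_sigma_additive mbind.
Proof.
move=> F mF tF mUF; rewrite [X in _ --> X](_ : _ =
    \sum_(n <oo) mbind (F n)); last first.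
  rewrite /mbind -integral_nneseries//; last by move=> n; exact: mk.
  apply: eq_integral => x _; rewrite measure_bigcup//.
  by apply: eq_eseriesl => i; rewrite in_setT.
by apply: is_cvg_ereal_nneg_natsum => n _; exact: integral_ge0.
Qed.

HB.instance Definition _ := isMeasure.Build _ _ _ mbind
  mbind0 mbind_ge0 mbind_sigma_additive.

Definition bind_measure : {measure set Z -> \bar R} := mbind.

Lemma integral_bind_measure f : (forall x, 0 <= f x) -> measurable_fun setT f ->
  \int[bind_measure]_z f z = \int[nu]_x \int[k x]_z f z.
Proof.
move=> f0 mf; apply/esym.
have mint h : (forall z, 0 <= h z) -> measurable_fun setT h ->
    measurable_fun setT (fun x => \int[k x]_z h z).
  by move=> h0 mh; exact: measurable_fun_integral_kernel.
apply: (ge0_integral_functional (L := fun f => \int[nu]_x \int[k x]_z f z)) => //.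
- move=> A mA; rewrite /bind_measure/= /mbind.
  by apply: eq_integral => x _; rewrite integral_indic// setIT.
- move=> c h c0 h0 mh; under eq_integral do rewrite ge0_integralZl//.
  by rewrite ge0_integralZl//; [exact: mint|move=> x _; exact: integral_ge0].
- move=> h l h0 l0 mh ml; under eq_integral do rewrite ge0_integralD//.
  by rewrite ge0_integralD//; [move=> t _; exact: integral_ge0|exact: mint|
    move=> t _; exact: integral_ge0|exact: mint].
- move=> u u0 mu nu'; rewrite -monotone_convergence//.
  + apply: eq_integral => t _; rewrite -monotone_convergence//.
  + by move=> n; exact: mint.
  + by move=> n t _; exact: integral_ge0.
  + move=> t _ a b ab; apply: ge0_le_integral => //.
    by move=> z _; apply: (nu' z).
Qed.

End bind_measure.

(** * The sigma-algebra of evaluations *)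

Lemma sigma_algebra_setI T (G : set (set T)) A B :
  <<s G >> A -> <<s G >> B -> <<s G >> (A `&` B).
Proof.
move=> GA GB; rewrite -(setCK (A `&` B)) setCI -bigcup2E.
rewrite -setTD; apply: sigma_algebraCD; apply: sigma_algebra_bigcup.
case=> [|[|n]] /=.
- by rewrite -setTD; exact: sigma_algebraCD.
- by rewrite -setTD; exact: sigma_algebraCD.
- exact: sigma_algebra0.
Qed.

Section eval_sigma_lemmas.
Context (R : realType) d (X : measurableType d).
Implicit Types (E : set (set X -> \bar R)).

Lemma eval_sigma_preimage T (F : set (set T)) (Y : T -> set X -> \bar R) :
  sigma_algebra setT F ->
  (forall A C, measurable A -> measurable C -> F [set t | C (Y t A)]) ->
  forall E, eval_sigma E -> F [set t | E (Y t)].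
Proof.
move=> sF FY E; apply: (sigma_preimage (f := Y) sF) => {}E [A mA [C mC ->]].
exact: FY.
Qed.

Lemma measurable_eval_sigma d' (T : measurableType d') (Y : T -> set X -> \bar R) :
  (forall A, measurable A -> measurable_fun setT (Y ^~ A)) ->
  forall E, eval_sigma E -> measurable [set t | E (Y t)].
Proof.
move=> mY E sE; apply: (eval_sigma_preimage _ _ sE).
  exact: sigma_algebra_measurable.
by move=> A C mA mC; have := mY _ mA measurableT _ mC; rewrite setTI.
Qed.

(** The points of the space are set functions on all subsets, but no event of the sigma-algebra sees
    the values at nonmeasurable sets. Hence a random measure may be replaced by a set function that
    agrees with it on measurable sets. *)
Lemma eval_sigma_ext E (m m' : set X -> \bar R) : eval_sigma E ->
  (forall A, measurable A -> m A = m' A) -> E m = E m'.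
Proof.
move=> sE mm'; apply/propext; move: E sE.
apply: smallest_sub.
  split => [//|E /= EE|F FE /=]; first by split => -[_ nE]; split => //; tauto.
  by split => -[k _ /(FE k)]; exists k.
by move=> E [A mA [C mC ->]] /=; rewrite mm'.
Qed.

Lemma eval_sigma_eval A C : measurable A -> measurable C ->
  @eval_sigma R _ X [set m | C (m A)].
Proof. by move=> mA mC; apply: sub_sigma_algebra; exists A => //; exists C. Qed.

Lemma eval_sigma_bigcap (I : finType) (E : I -> set (set X -> \bar R)) :
  (forall i, eval_sigma (E i)) -> eval_sigma (\bigcap_i E i).
Proof.
move=> sE; rewrite /eval_sigma; set G := (X in <<s X >>).
apply: (@fin_bigcap_measurable _ (g_sigma_algebraType G)); first exact: finite_finset.
by move=> i _; exact: sE.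
Qed.

Lemma eval_sigma_counts (I : finType) (C : I -> set X) (v : I -> nat) :
  (forall i, measurable (C i)) ->
  @eval_sigma R _ X [set m | forall i, m (C i) = (v i)%:R%:E].
Proof.
move=> mC; rewrite (_ : [set _ | _] = \bigcap_i [set m | m (C i) = (v i)%:R%:E]).
  apply: eval_sigma_bigcap => i.
  by apply: (eval_sigma_eval (C := [set (v i)%:R%:E]) (mC i)).
by apply/seteqP; split => t /= h i => [_|]; exact: h.
Qed.

(** Finitely many upper bounds by reals form a pi-system, and for measures such an event is the
    decreasing limit of the same bounds for traces on an increasing exhaustion. [law_unique] rests
    on both properties. *)
Definition ray_cylinder (s : seq (set X * R)) : set (set X -> \bar R) :=
  [set m | forall b, b \in s -> m b.1 <= b.2%:E].

Definition ray_cylinders : set (set (set X -> \bar R)) :=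
  [set E | exists2 s, (forall b, b \in s -> measurable b.1) &
                      E = ray_cylinder s].

Lemma ray_cylinders_setI : setI_closed ray_cylinders.
Proof.
move=> _ _ [s ms ->] [s' ms' ->]; exists (s ++ s').
  by move=> b; rewrite mem_cat => /orP[/ms|/ms'].
apply/seteqP; split => m /=.
  by move=> [h h'] b; rewrite mem_cat => /orP[/h|/h'].
by move=> h; split => b bs; apply: h; rewrite mem_cat bs ?orbT.
Qed.

Lemma eval_sigma_ray_cylinders : @eval_sigma R _ X = <<s ray_cylinders >>.
Proof.
apply/seteqP; split.
  apply: smallest_sub; first exact: smallest_sigma_algebra.
  move=> _ [A mA [C mC ->]].
  have sA : sigma_algebra setT <<s ray_cylinders >> by exact: smallest_sigma_algebra.
  move: mC; rewrite [measurable](ErealGenOInfty.measurableE R) => mC.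
  apply: (@sigma_preimage _ _ (fun m : set X -> \bar R => m A) _ _ sA _ C mC).
  move=> _ [r ->].
  rewrite (_ : _ @^-1` _ = ~` ray_cylinder [:: (A, r)]).
    apply: sigma_algebraC; apply: sub_sigma_algebra; exists [:: (A, r)] => //.
    by move=> b; rewrite inE => /eqP ->.
  apply/seteqP; split => m /=; rewrite in_itv/= andbT.
    by move=> rm /(_ (A, r)); rewrite inE eqxx => /(_ isT); rewrite leNgt rm.
  move=> h; rewrite ltNge; apply/negP => mr; apply: h => b.
  by rewrite inE => /eqP ->.
apply: smallest_sub; first exact: smallest_sigma_algebra.
move=> _ [s ms ->]; elim: s ms => [_|b s IH ms].
  rewrite (_ : ray_cylinder [::] = setT); last by apply/seteqP; split.
  by rewrite -setC0; apply: sigma_algebraC; exact: sigma_algebra0.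
have /IH h : forall b, b \in s -> measurable b.1.
  by move=> c cs; apply: ms; rewrite inE cs orbT.
rewrite (_ : ray_cylinder _ = [set m | m b.1 <= b.2%:E] `&` ray_cylinder s).
  apply: sigma_algebra_setI => //.
  apply: sub_sigma_algebra; exists b.1; first by apply: ms; rewrite inE eqxx.
  exists [set x | x <= b.2%:E]; last by [].
  rewrite (_ : [set _ | _] = `]-oo, b.2%:E]%classic); first exact: emeasurable_itv.
  by apply/seteqP; split => x /=; rewrite in_itv.
apply/seteqP; split => m /=.
  by move=> h'; split; [|move=> c cs]; apply: h'; rewrite inE ?eqxx ?cs ?orbT.
by move=> [h1 h2] c; rewrite inE => /orP[/eqP ->|/h2].
Qed.

End eval_sigma_lemmas.

(** * Laws determined by integer counts *)

Section count_vectors.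
Context (R : realType) (I : finType).

Definition integer_valued (x : \bar R) := exists n : nat, x = n%:R%:E.

(** Almost surely the vectors lie in a countable set, so that each event is a countable sum of point
    masses. [U] is an arbitrary set of vectors; only the two events have to be measurable. *)
Lemma count_vector_law d (T : measurableType d) d' (T' : measurableType d')
  (P : {measure set T -> \bar R}) (P' : {measure set T' -> \bar R})
  (f : I -> T -> \bar R) (f' : I -> T' -> \bar R) (U : set (I -> \bar R)) :
  (forall i, measurable_fun setT (f i)) ->
  (forall i, measurable_fun setT (f' i)) ->
  (forall i, {ae P, forall t, integer_valued (f i t)}) ->
  (forall i, {ae P', forall t, integer_valued (f' i t)}) ->
  (forall v : I -> nat, P [set t | forall i, f i t = (v i)%:R%:E] =
                        P' [set t | forall i, f' i t = (v i)%:R%:E]) ->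
  measurable [set t | U (f ^~ t)] -> measurable [set t | U (f' ^~ t)] ->
  P [set t | U (f ^~ t)] = P' [set t | U (f' ^~ t)].
Proof.
move=> mf mf' fi fi' ff' mU mU'.
pose vec (v : {ffun I -> nat}) : I -> \bar R := fun i => (v i)%:R%:E.
have key d0 (T0 : measurableType d0) (P0 : {measure set T0 -> \bar R})
    (f0 : I -> T0 -> \bar R) : (forall i, measurable_fun setT (f0 i)) ->
    (forall i, {ae P0, forall t, integer_valued (f0 i t)}) ->
    measurable [set t | U (f0 ^~ t)] ->
    P0 [set t | U (f0 ^~ t)] = \sum_(n <oo)
      (if pickle_inv n is Some v then
         (if `[< U (vec v) >] then P0 [set t | forall i, f0 i t = vec v i] else 0)
       else 0).
  move=> mf0 fi0 mU0.
  pose S n : set T0 := if pickle_inv n is Some v then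
         (if `[< U (vec v) >] then [set t | forall i, f0 i t = vec v i] else set0)
       else set0.
  have mv (v : {ffun I -> nat}) : measurable [set t | forall i, f0 i t = vec v i].
    rewrite (_ : [set _ | _] = \bigcap_(i in [set: I]) (f0 i @^-1` [set vec v i])).
      apply: fin_bigcap_measurable => // i _.
      by rewrite -[X in measurable X]setTI; exact: mf0.
    by apply/seteqP; split => t /= h i => [_|]; exact: h.
  have mS n : measurable (S n).
    by rewrite /S; case: pickle_inv => // v; case: ifP.
  have -> : P0 [set t | U (f0 ^~ t)] = P0 (\bigcup_n S n).
    apply: eq_measure_ae => //; first exact: bigcup_measurable.
    have : {ae P0, forall t, forall i, integer_valued (f0 i t)}.
      have /ae_foralln : forall n, {ae P0, forall t, forall i, enum_rank i = n :> nat ->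
          integer_valued (f0 i t)}.
        move=> n; have [[i ri]|] := pselect (exists i : I, enum_rank i = n :> nat).
          apply: filterS (fi0 i) => t h j rj; suff -> : j = i by [].
          by apply/enum_rank_inj/val_inj; rewrite /= ri rj.
        by move=> nri; near=> t => i rin; case: nri; exists i.
      by apply: filterS => t h i; exact: h.
    apply: filterS => t ft; split => [Ut|].
      have /choice [v vE] := ft.
      have vE' : f0 ^~ t = vec [ffun i => v i].
        by apply/funext => i; rewrite vE /vec ffunE.
      exists (pickle [ffun i => v i]) => //.
      rewrite /S pickleK_inv asboolT; last by rewrite -vE'.
      by move=> i; rewrite -vE'.
    move=> [n _]; rewrite /S; case: pickle_inv => // v; case: asboolP => // Uv.
    by move=> /= h; rewrite (_ : f0 ^~ t = vec v)//; exact/funext.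
  rewrite measure_bigcup//; last first.
    apply/trivIsetP => m n _ _ mn; rewrite -subset0 => t [].
    rewrite /S; case vm : (pickle_inv m) => [v|//]; case: ifP => // _ /= vt.
    case wn : (pickle_inv n) => [w|//]; case: ifP => // _ /= wt.
    apply/negP: mn; rewrite negbK; apply/eqP.
    have vw : v = w.
      apply/ffunP => i; have := vt i; rewrite wt => -[].
      by move/eqP; rewrite eqr_nat => /eqP.
    have := @pickle_invK {ffun I -> nat} m; rewrite vm /= vw.
    by have := @pickle_invK {ffun I -> nat} n; rewrite wn /= => -> ->.
  rewrite (eq_eseriesl (Q := xpredT)); last by move=> i; rewrite in_setT.
  apply: eq_eseriesr => n _; rewrite /S; case: pickle_inv => [v|//].
  by case: ifP => // _; rewrite measure0.
rewrite (key _ _ P f)// (key _ _ P' f')//.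
apply: eq_eseriesr => n _; case: pickle_inv => [v|//].
by case: ifP => // _; exact: ff'.
Unshelve. all: by end_near. Qed.

End count_vectors.

Section law_unique.
Context (R : realType).

Lemma measure_bigcup_fin d (X : measurableType d) (mu : {measure set X -> \bar R})
    (I : finType) (Q : pred I) (C : I -> set X) :
  (forall i, measurable (C i)) -> trivIset setT C ->
  mu (\bigcup_(i in [set i | Q i]) C i) = \sum_(i | Q i) mu (C i).
Proof.
move=> mC tC; have tC' : trivIset [set i | Q i] C by apply: sub_trivIset tC.
rewrite measure_fin_bigcup//.
rewrite (fsbigE [seq i <- index_enum I | Q i]).
- rewrite big_filter_cond; apply: eq_bigl => i.
  by rewrite mem_setE andbb.
- by rewrite filter_uniq// index_enum_uniq.
- by move=> i; rewrite /= mem_filter => /andP[].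
- by move=> i /= Qi; rewrite mem_filter Qi mem_index_enum.
- exact: finite_finset.
Qed.

Context d (X : measurableType d).

(** On subsets of [F p] the counts are integers. A finite family of sets cuts [F p] into finitely
    many cells, whose counts decide the event of a ray cylinder; then [p] tends to infinity. The set
    [A] joins the family so that each cell is inside [A] or disjoint from it, as is needed when an
    atom is picked in [A]. *)
Lemma law_unique d1 (T1 : measurableType d1) d2 (T2 : measurableType d2)
  (P1 : {measure set T1 -> \bar R}) (P2 : {measure set T2 -> \bar R})
  (N1 : T1 -> {measure set X -> \bar R}) (N2 : T2 -> {measure set X -> \bar R})
  (A : set X) (F : nat -> set X) :
  P2 setT < +oo ->
  (forall B, measurable B -> measurable_fun setT (fun t => N1 t B)) ->
  (forall B, measurable B -> measurable_fun setT (fun t => N2 t B)) ->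
  measurable A -> (forall p, measurable (F p)) -> nondecreasing_seq F ->
  \bigcup_p F p = setT ->
  (forall p B, measurable B -> B `<=` F p ->
    {ae P1, forall t, integer_valued (N1 t B)} /\
    {ae P2, forall t, integer_valued (N2 t B)}) ->
  (forall p (I : finType) (C : I -> set X), (forall i, measurable (C i)) ->
     trivIset setT C -> \bigcup_i C i = F p ->
     (forall i, C i `<=` A \/ C i `&` A = set0) ->
     forall v : I -> nat,
     P1 [set t | forall i, N1 t (C i) = (v i)%:R%:E] =
     P2 [set t | forall i, N2 t (C i) = (v i)%:R%:E]) ->
  forall E, eval_sigma E ->
  P1 [set t | E (N1 t : set X -> \bar R)] =
  P2 [set t | E (N2 t : set X -> \bar R)].
Proof.
move=> P2oo mN1 mN2 mA mF ndF FT iN cells E.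
pose I (s : seq (set X * R)) : finType := {ffun 'I_(size s).+1 -> bool}.
(* Coordinate [0] of a cell index stands for [A] and coordinate [j + 1] for the [j]-th set of [s];
   hence [lift ord0] below. *)
pose S0 (s : seq (set X * R)) (i : 'I_(size s).+1) : set X :=
  nth A (A :: map fst s) i.
pose C p (s : seq (set X * R)) (v : I s) : set X :=
  F p `&` [set x | forall i, `[< S0 s i x >] = v i].
have mS0 s i : (forall b, b \in s -> measurable b.1) -> measurable (S0 s i).
  case: i => -[//|i] /= si ms; rewrite /S0/=.
  rewrite (nth_map (A, 0%R))//; apply: ms; exact: mem_nth.
have mC p s v : (forall b, b \in s -> measurable b.1) -> measurable (C p s v).
  move=> ms; apply: measurableI => //.
  rewrite (_ : [set x | _] = \bigcap_(i in [set: 'I_(size s).+1])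
      (if v i then S0 s i else ~` S0 s i)).
    apply: fin_bigcap_measurable => // i _; case: ifP => _; first exact: mS0.
    by apply: measurableC; exact: mS0.
  apply/seteqP; split => x /= h i => [_|].
    by rewrite -h; case: asboolP.
  by have := h i Logic.I; case: (v i) => ?; [rewrite asboolT|rewrite asboolF].
have tC p s : trivIset setT (C p s).
  apply/trivIsetP => v w _ _ vw; rewrite -subset0 => x [[_ xv] [_ xw]].
  by move/eqP: vw; apply; apply/ffunP => i; rewrite -xv -xw.
have CF p s : \bigcup_v C p s v = F p.
  apply/seteqP; split => [x [v _ []//]|x Fx].
  exists [ffun i => `[< S0 s i x >]] => //; split => // i.
  by rewrite ffunE.
have CA p s v : C p s v `<=` A \/ C p s v `&` A = set0.
  case v0 : (v ord0); [left|right].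
    by move=> x [_ /(_ ord0)]; rewrite v0 => /asboolP.
  by rewrite -subset0 => x [[_ /(_ ord0)]]; rewrite v0 => /asboolP.
have key (U : forall s, set (I s -> \bar R)) p s :
    (forall b, b \in s -> measurable b.1) ->
    measurable [set t | U s (fun v => N1 t (C p s v))] ->
    measurable [set t | U s (fun v => N2 t (C p s v))] ->
    P1 [set t | U s (fun v => N1 t (C p s v))] =
    P2 [set t | U s (fun v => N2 t (C p s v))].
  move=> ms; apply: (count_vector_law (f := fun v t => N1 t (C p s v))
    (f' := fun v t => N2 t (C p s v))).
  - by move=> v; apply: mN1; exact: mC.
  - by move=> v; apply: mN2; exact: mC.
  - by move=> v; apply: (iN p _ _ _).1; [exact: mC|move=> x []].
  - by move=> v; apply: (iN p _ _ _).2; [exact: mC|move=> x []].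
  - by move=> w; apply: (cells p) => // v; exact: mC.
(* The event without any condition on the cells of [F 0]: the total masses agree, so [P1] is finite
   as well. *)
have PT : P1 setT = P2 setT.
  have := key (fun=> setT) 0%N [::].
  rewrite (_ : [set _ | _] = setT)//.
  by rewrite (_ : [set _ | _] = setT)//; exact.
rewrite eval_sigma_ray_cylinders => sE.
apply: (finite_law_unique (f := fun t => N1 t : set X -> \bar R)
  (f' := fun t => N2 t : set X -> \bar R) _ _ _ _ sE).
- exact: ray_cylinders_setI.
- by rewrite PT.
- by [].
move=> _ [s ms ->].
have mray d0 (T0 : measurableType d0) (N : T0 -> {measure set X -> \bar R}) :
    (forall B, measurable B -> measurable_fun setT (fun t => N t B)) ->
    measurable [set t | ray_cylinder s (N t : set X -> \bar R)].
  move=> mN; apply: measurable_eval_sigma => //.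
  by rewrite eval_sigma_ray_cylinders; apply: sub_sigma_algebra; exists s.
split; [exact: mray|exact: mray|].
pose G d0 (T0 : measurableType d0) (N : T0 -> {measure set X -> \bar R}) p :=
  [set t | forall b, b \in s -> N t (b.1 `&` F p) <= b.2%:E].
have mG d0 (T0 : measurableType d0) (N : T0 -> {measure set X -> \bar R}) p :
    (forall B, measurable B -> measurable_fun setT (fun t => N t B)) ->
    measurable (G _ T0 N p).
  move=> mN.
  rewrite (_ : G _ _ _ _ = [set t | ray_cylinder [seq (b.1 `&` F p, b.2) | b <- s]
      (N t : set X -> \bar R)]).
    apply: measurable_eval_sigma => //.
    rewrite eval_sigma_ray_cylinders; apply: sub_sigma_algebra.
    eexists; [|reflexivity] => _ /mapP[b bs ->] /=.
    by apply: measurableI => //; exact: ms.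
  apply/seteqP; split => t /= h b.
    by move=> /mapP[c cs ->]; exact: h.
  by move=> bs; apply: (h (b.1 `&` F p, b.2)); apply/mapP; exists b.
(* Continuity from below along [F]: a bound holds on a set when it holds on all its traces. *)
have capG d0 (T0 : measurableType d0) (N : T0 -> {measure set X -> \bar R}) :
    [set t | ray_cylinder s (N t : set X -> \bar R)] = \bigcap_p G _ T0 N p.
  apply/seteqP; split => t /= h.
    move=> p _ b bs; apply: (le_trans _ (h _ bs)).
    apply: le_measure; rewrite ?inE//; last exact: ms.
    by apply: measurableI => //; exact: ms.
  move=> b bs.
  have bE : b.1 = \bigcup_p (b.1 `&` F p) by rewrite -setI_bigcupr FT setIT.
  have mb p : measurable (b.1 `&` F p) by apply: measurableI => //; exact: ms.
  have cv : (N t (b.1 `&` F p)) @[p --> \oo] --> N t b.1.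
    rewrite [in X in _ --> X]bE; apply: nondecreasing_cvg_mu => //.
      by apply: bigcup_measurable.
    move=> m n mn; apply/subsetPset; apply: setIS.
    by apply/subsetPset; exact: ndF.
  rewrite -(cvg_lim _ cv)//; apply: lime_le.
    by apply/cvg_ex; exists (N t b.1).
  by near=> p; exact: h.
have niG d0 (T0 : measurableType d0) (N : T0 -> {measure set X -> \bar R}) :
    {homo G _ T0 N : n m / (n <= m)%N >-> (m <= n)%O}.
  move=> m n mn; apply/subsetPset => t /= h b bs.
  apply: (le_trans _ (h _ bs)); apply: le_measure; rewrite ?inE//.
  - by apply: measurableI => //; exact: ms.
  - by apply: measurableI => //; exact: ms.
  - by apply: setIS; apply/subsetPset; exact: ndF.
have c1 : (P1 \o G _ T1 N1) x @[x --> \oo] --> P1 [set t | ray_cylinder s (N1 t : set X -> \bar R)].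
  rewrite capG; apply: nonincreasing_cvg_mu => //.
  - rewrite (le_lt_trans _ P2oo)// -PT le_measure ?inE//; exact: mG.
  - by move=> p; exact: mG.
  - by rewrite -capG; exact: mray.
  - exact: niG.
have c2 : (P2 \o G _ T2 N2) x @[x --> \oo] --> P2 [set t | ray_cylinder s (N2 t : set X -> \bar R)].
  rewrite capG; apply: nonincreasing_cvg_mu => //.
  - rewrite (le_lt_trans _ P2oo)// le_measure ?inE//; exact: mG.
  - by move=> p; exact: mG.
  - by rewrite -capG; exact: mray.
  - exact: niG.
suff PG : P1 \o G _ T1 N1 = P2 \o G _ T2 N2.
  by move: c1; rewrite PG => c1; exact: (cvg_unique _ c1 c2).
apply/funext => p /=.
(* The count of a set inside [F p] is the sum of the counts of the cells that it contains. *)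
pose U s0 : set (I s0 -> \bar R) := [set y | forall j : 'I_(size s0),
  \sum_(v : I s0 | v (lift ord0 j)) y v <= (nth (A, 0%R) s0 j).2%:E].
have S0E (j : 'I_(size s)) : S0 s (lift ord0 j) = (nth (A, 0%R) s j).1.
  by rewrite /S0 lift0 /= (nth_map (A, 0%R)).
have GU d0 (T0 : measurableType d0) (N : T0 -> {measure set X -> \bar R}) :
    G _ T0 N p = [set t | U s (fun v => N t (C p s v))].
  have sE' t (j : 'I_(size s)) : \sum_(v : I s | v (lift ord0 j)) N t (C p s v) =
      N t ((nth (A, 0%R) s j).1 `&` F p).
    rewrite -(measure_bigcup_fin _ (fun v : I s => v (lift ord0 j)) (C := C p s))//; last first.
      by move=> v; exact: mC.
    congr (N t _); apply/seteqP; split => x.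
      move=> [v /= vj [Fx /(_ (lift ord0 j))]]; rewrite vj => /asboolP.
      by rewrite S0E.
    move=> [sx Fx]; have : (\bigcup_v C p s v) x by rewrite CF.
    move=> [v _ Cv]; exists v => //=; case: Cv => _ <-; apply/asboolP.
    by rewrite S0E.
  apply/seteqP; split => t /=.
    by move=> h j; rewrite sE'; apply: h; exact: mem_nth.
  move=> h b bs; have si : (index b s < size s)%N by rewrite index_mem.
  by have := h (Ordinal si); rewrite sE' /= nth_index.
by rewrite !GU; apply: key => //; rewrite -GU; exact: mG.
Unshelve. all: by end_near. Qed.

End law_unique.

(** * Poisson processes and Mecke's formula *)

Section configurations.
Context (R : realType) d (X : measurableType d).
Implicit Types (al : nat -> bool) (x : nat -> X).

Definition conf al x : {measure set X -> \bar R} :=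
  mseries (fun k => if al k then [the {measure set X -> \bar R} of \d_(x k)]
                    else mzero) 0.

Definition delete al n k := al k && (k != n).

Lemma confE al x A : conf al x A = \sum_(k <oo) (al k && (x k \in A))%:R%:E.
Proof.
rewrite /conf /= /mseries; apply: eq_eseriesr => k _.
by case: (al k) => //=; rewrite diracE.
Qed.

Lemma conf_delete al x n A : al n ->
  conf al x A = (x n \in A)%:R%:E + conf (delete al n) x A.
Proof.
move=> aln; rewrite !confE (@nneseriesD1 _ _ n)//.
rewrite aln; congr (_ + _); rewrite eseries_mkcond; apply: eq_eseriesr => k _.
by rewrite /delete; case: ifP => /= [->|->]; rewrite ?andbT ?andbF.
Qed.

(** The partial counts are nondecreasing integers: if bounded, they are eventually equal to their
    maximum; otherwise they tend to infinity. *)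
Lemma conf_integer al x A : conf al x A = +oo \/ integer_valued (conf al x A).
Proof.
pose u n := (\sum_(0 <= k < n) (al k && (x k \in A)))%N.
have uE n : \sum_(0 <= k < n) (al k && (x k \in A))%:R%:E = (u n)%:R%:E :> \bar R.
  by rewrite /u sumEFin natr_sum.
have nu : {homo u : m n / (m <= n)%N}.
  by move=> m n mn; rewrite /u [leqRHS](big_cat_nat (n := m))//= leq_addr.
have cE : conf al x A = limn (fun n => (u n)%:R%:E).
  by rewrite confE; congr (limn _); apply/funext.
have ndu : nondecreasing_seq (fun n => (u n)%:R%:E : \bar R).
  by move=> m n mn; rewrite lee_fin ler_nat nu.
have [[b ub]|nb] := pselect (exists b, forall n, (u n <= b)%N).
  right; have eM : exists m, `[< exists n, u n = m >].
    by exists (u 0%N); apply/asboolP; exists 0%N.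
  have lM m : `[< exists n, u n = m >] -> (m <= b)%N by move=> /asboolP[n <-].
  case: (ex_maxnP eM lM) => m /asboolP[n0 n0E] mM.
  exists m; rewrite cE; apply/cvg_lim => //; apply: cvg_near_cst.
  exists n0 => // n /= n0n; congr (_%:R%:E); apply/eqP; rewrite eqn_leq.
  by rewrite -{2}n0E nu// andbT mM//; apply/asboolP; exists n.
left; rewrite cE; apply/cvg_lim => //; apply/cvgeyPge => r.
have [n un] : exists n, (Num.bound `|r| < u n)%N.
  apply: contrapT => /forallNP h; apply: nb; exists (Num.bound `|r|) => n.
  by rewrite leqNgt; apply/negP/h.
exists n => // m /= nm; rewrite lee_fin.
apply: (le_trans (ler_norm r)); apply: (le_trans (ltW (archi_boundP (normr_ge0 r)))).
by rewrite ler_nat (leq_trans (ltnW un))// nu.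
Qed.

(** The combinatorial content of Mecke's formula. Deleting an atom of [C i] lowers the count of this
    cell alone, by one; and when the full count of [C i] is [c i + 1], there are [c i + 1] atoms to
    delete. *)
Lemma conf_cell (I : finType) (C : I -> set X) (i : I) (c : I -> nat) al x :
  trivIset setT C ->
  \sum_(n <oo) (`[< al n /\ C i (x n) /\
     forall j, conf (delete al n) x (C j) = (c j)%:R%:E >])%:R%:E =
  ((c i).+1%:R * (`[< forall j, conf al x (C j) = (c j + (j == i))%:R%:E >])%:R)%:E :> \bar R.
Proof.
move=> tC.
have h n : al n -> C i (x n) ->
    (forall j, conf (delete al n) x (C j) = (c j)%:R%:E) <->
    (forall j, conf al x (C j) = (c j + (j == i))%:R%:E).
  move=> aln Cx.
  have e j : (x n \in C j) = (j == i).
    apply/idP/eqP => [|->]; last by rewrite inE.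
    rewrite inE => Cj; apply: contrapT => ji; move/trivIsetP : tC => /(_ j i Logic.I Logic.I).
    by move/(_ (introN eqP ji)); rewrite -subset0 => /(_ (x n)); apply.
  split => hj j.
    by rewrite (conf_delete _ _ aln) e hj -EFinD addrC natrD.
  have := hj j; rewrite (conf_delete _ _ aln) e natrD EFinD [LHS]addeC.
  by move=> h0; rewrite -[LHS](@addeK _ (j == i)%:R%:E)// h0 addeK.
case: asboolP => [g|ng]; last first.
  rewrite mulr0 eseries0// => n _ _; case: asboolP => // -[aln [Cx gn]].
  by case: ng; apply/(h n).
rewrite mulr1; have := g i; rewrite eqxx addn1 => <-; rewrite confE.
apply: eq_eseriesr => n _; congr (_%:R%:E); congr nat_of_bool; apply/asboolP/idP.
  by move=> [-> [Cx _]]; rewrite inE.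
by move=> /andP[aln /[!inE] Cx]; split => //; split => //; apply/(h n).
Qed.

End configurations.

Section slices.
Context (R : realType) d (T : measurableType d) d' (Z : measurableType d').

Definition push (P : {measure set T -> \bar R}) (f : T -> Z)
    (mf : measurable_fun setT f) : {measure set Z -> \bar R} :=
  measure_function_pushforward__canonical__measure_function_Measure P mf.

Lemma pushE P f mf A : @push P f mf A = P (f @^-1` A).
Proof. by []. Qed.

Lemma integral_push P f mf h : (forall z, 0 <= h z) -> measurable_fun setT h ->
  \int[@push P f mf]_z h z = \int[P]_t h (f t).
Proof. by move=> h0 mh; rewrite ge0_integral_pushforward. Qed.

Variables (P : {measure set T -> \bar R}) (S : nat -> set T).
Hypothesis mS : forall n, measurable (S n).

Lemma integral_mrestr (S0 : set T) (mS0 : measurable S0) (h : T -> \bar R) :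
  (forall z, 0 <= h z) -> measurable_fun setT h ->
  \int[mrestr P mS0]_t h t = \int[P]_(t in S0) h t.
Proof.
move=> h0 mh.
have i0 t : 0 <= (\1_S0 t)%:E :> \bar R by rewrite lee_fin.
have mi : measurable_fun setT (fun t => (\1_S0 t)%:E : \bar R).
  by apply/measurable_EFinP; exact: measurable_indic.
transitivity (\int[density P i0 mi]_t h t).
  apply: eq_measure_integral => A mA _.
  by rewrite /density /= /mdens /mrestr integral_indic// setIC.
rewrite integral_density// [RHS]integral_mkcond.
by apply: eq_integral => t _; rewrite patchE indicE; case: ifP; rewrite ?mule1 ?mule0.
Qed.

Lemma measurable_pairr (n : nat) : measurable_fun setT (fun t : T => (t, n)).
Proof. exact: measurable_fun_pair. Qed.

(* Realizations with one picked atom, whose index is the second component. *)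
Definition slice : {measure set (T * nat) -> \bar R} :=
  mseries (fun n => measure_function_pushforward__canonical__measure_function_Measure
    (mrestr P (mS n)) (measurable_pairr n)) 0.

Lemma sliceE U : slice U = \sum_(n <oo) P ([set t | U (t, n)] `&` S n).
Proof. by []. Qed.

Lemma integral_slice (h : T * nat -> \bar R) : (forall z, 0 <= h z) -> measurable_fun setT h ->
  \int[slice]_z h z = \sum_(n <oo) \int[P]_(t in S n) h (t, n).
Proof.
move=> h0 mh; rewrite ge0_integral_measure_series//.
apply: eq_eseriesr => n _; rewrite ge0_integral_pushforward//.
rewrite preimage_setT (integral_mrestr (mS n) (h := fun t => h (t, n)))//.
exact: measurableT_comp (measurable_pairr n).
Qed.

End slices.

Section poisson_law.
Context (R : realType).

Definition pois (x : R) (n : nat) : R := (x ^+ n / n`!%:R * expR (- x))%R.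

Lemma pois_ge0 x n : (0 <= x)%R -> (0 <= pois x n)%R.
Proof. by move=> x0; rewrite /pois !mulr_ge0// ?exprn_ge0// ?expR_ge0. Qed.

(** The form that Mecke's formula takes on the counts of a cell of intensity [x]. It determines the
    weights up to a factor, and is used in both directions. *)
Lemma poisS x n : (n.+1%:R * pois x n.+1 = x * pois x n)%R.
Proof.
rewrite /pois exprS factS natrM; field.
by rewrite nat1r !pnatr_eq0 -lt0n fact_gt0.
Qed.

Lemma sum_pois x : (0 <= x)%R -> \sum_(n <oo) (pois x n)%:E = 1.
Proof.
rewrite le_eqVlt => /orP[/eqP <-|x0].
  rewrite (@nneseriesD1 _ _ 0%N)//; last first.
    by move=> k _; rewrite lee_fin pois_ge0.
  rewrite {1}/pois expr0 fact0 oppr0 expR0 divr1 mulr1 eseries0 ?adde0//.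
  by move=> [|k]//= _ _; rewrite /pois expr0n/= mul0r mul0r.
have := @probability_setT _ _ _ (poisson_prob x 0).
rewrite /= /poisson_prob x0 => h; rewrite -{}h -nneseries_esumT; last first.
  by move=> n; rewrite lee_fin poisson_pmf_ge0.
by apply: eq_eseriesr => n _; rewrite /poisson_pmf x0.
Qed.

Context d (X : measurableType d).

(* The total mass of [P] is arbitrary: picking an atom and restricting to an
   event change it. *)
Definition poisson d' (T : measurableType d') (P : {measure set T -> \bar R})
    (nu : set X -> \bar R) (N : T -> {measure set X -> \bar R}) : Prop :=
  (forall A, measurable A -> measurable_fun setT (fun t => N t A)) /\
  forall (I : finType) (C : I -> set X) (c : I -> nat),
    (forall i, measurable (C i)) -> trivIset setT C ->
    (forall i, nu (C i) < +oo) ->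
    P [set t | forall i, N t (C i) = (c i)%:R%:E] =
    P setT * (\prod_i pois (fine (nu (C i))) (c i))%:E.

Lemma is_PRM_poisson d' (T : measurableType d') (P : probability T R)
    (nu : set X -> \bar R) N : is_PRM P nu N -> poisson P nu N.
Proof.
move=> [mN cN _ iN]; split => // I C c mC tC Cfin.
pose C' (i : 'I_#|I|) := C (enum_val i).
pose D' (i : 'I_#|I|) : set (\bar R) := [set (c (enum_val i))%:R%:E].
have tC' : trivIset setT C'.
  apply/trivIsetP => i j _ _ ij; move/trivIsetP : tC; apply => //.
  by apply: contra_neq ij; exact: enum_val_inj.
have mD' i : measurable (D' i) by exact: emeasurable_set1.
have -> : [set t | forall i, N t (C i) = (c i)%:R%:E] =
    [set t | forall i, D' i (N t (C' i))].
  apply/seteqP; split => t /= h i; first exact: h.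
  by have := h (enum_rank i); rewrite /D' /C' enum_rankK.
apply: (etrans (iN _ C' D' (fun i => mC _) mD' tC')).
have -> : (P : {measure set T -> \bar R}) setT = 1 by exact: (@probability_setT _ _ _ P).
rewrite mul1e (reindex (@enum_val I I))/=; last first.
  by apply: onW_bij; exact: enum_val_bij.
rewrite -prodEFin; apply: eq_bigr => i _; rewrite /D' /C'.
exact: cN.
Qed.

(** The Poisson weights sum to [1], so the events [N t B = n] exhaust the total mass and leave none
    for an infinite count. *)
Lemma poisson_integer_valued d' (T : measurableType d')
    (P : {measure set T -> \bar R}) (nu : {measure set X -> \bar R}) N B :
  P setT < +oo -> poisson P nu N -> measurable B -> nu B < +oo ->
  {ae P, forall t, integer_valued (N t B)}.
Proof.
move=> Poo [mN cN] mB nuB.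
pose S n := [set t | N t B = n%:R%:E].
have mS n : measurable (S n).
  by have := mN _ mB measurableT _ (emeasurable_set1 n%:R%:E); rewrite setTI.
have PS n : P (S n) = P setT * (pois (fine (nu B)) n)%:E.
  have := cN unit (fun=> B) (fun=> n).
  rewrite big_const card_unit /= mulr1 => <-//.
    by congr (P _); apply/seteqP; split => [t h []|t /(_ tt)].
  by apply/trivIsetP => -[] [].
have mU : measurable (\bigcup_n S n) by apply: bigcup_measurable.
have PU : P (\bigcup_n S n) = P setT.
  rewrite measure_bigcup//; last first.
    apply/trivIsetP => m n _ _ mn; rewrite -subset0 => t [Sm Sn].
    by move: Sm; rewrite /S/= Sn => -[] /eqP; rewrite eqr_nat eq_sym (negbTE mn).
  under eq_eseriesr do rewrite PS.
  rewrite (eq_eseriesl (Q := xpredT)); last by move=> i; rewrite in_setT.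
  have Pfin : P setT \is a fin_num by rewrite ge0_fin_numE.
  rewrite -(fineK Pfin) nneseriesZl; last first.
    by move=> n _; rewrite lee_fin pois_ge0// fine_ge0.
  by rewrite sum_pois ?mule1// fine_ge0.
exists (~` \bigcup_n S n); split; first exact: measurableC.
  by rewrite finite_measureC// PU subee// ge0_fin_numE.
by move=> t /= h [n _ Sn]; apply: h; exists n.
Qed.

End poisson_law.

Lemma mem_asbool U (A : set U) u : (u \in A) = `[< A u >].
Proof. by apply/idP/asboolP => [/set_mem|/mem_set]. Qed.

Section atoms.
Context (R : realType) d (X : measurableType d) d' (T : measurableType d').
Variables (alive : nat -> T -> bool) (pts : nat -> T -> X).
Hypotheses (malive : forall k, measurable_fun setT (alive k))
  (mpts : forall k, measurable_fun setT (pts k)).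

(* Convertible to [atoms_measure]. *)
Definition atoms t : {measure set X -> \bar R} := conf R (alive ^~ t) (pts ^~ t).
Definition atoms_del n t : {measure set X -> \bar R} :=
  conf R (delete (alive ^~ t) n) (pts ^~ t).

Lemma measurable_alive_pts k A : measurable A ->
  measurable [set t | alive k t /\ A (pts k t)].
Proof.
move=> mA; rewrite (_ : [set _ | _] = (alive k @^-1` [set true]) `&` (pts k @^-1` A)) //.
apply: measurableI.
  by rewrite -[X in measurable X]setTI; exact: malive.
by rewrite -[X in measurable X]setTI; exact: mpts.
Qed.

Lemma measurable_atoms A : measurable A -> measurable_fun setT (fun t => atoms t A).
Proof.
move=> mA; under eq_fun do rewrite /atoms confE.
apply: ge0_emeasurable_sum => // k _.
rewrite (_ : (fun _ => _) =
    fun t => (\1_[set t | alive k t /\ A (pts k t)] t)%:E).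
  apply/measurable_EFinP; apply: measurable_indic.
  exact: measurable_alive_pts.
apply/funext => t; rewrite indicE; congr (_%:R%:E); congr nat_of_bool.
apply/andP/idP => [[a b]|]; first by apply/mem_set; split=> //; exact: set_mem.
by move=> /set_mem[a b]; split => //; exact: mem_set.
Qed.

End atoms.

Section atoms_delete.
Context (R : realType) d (X : measurableType d) d' (T : measurableType d').
Variables (alive : nat -> T -> bool) (pts : nat -> T -> X).
Hypotheses (malive : forall k, measurable_fun setT (alive k))
  (mpts : forall k, measurable_fun setT (pts k)).

Lemma measurable_delete n k :
  measurable_fun setT (fun t => delete (alive ^~ t) n k).
Proof.
rewrite /delete; apply: measurable_and => //; exact: measurable_cst.
Qed.

Lemma measurable_atoms_del n A : measurable A ->
  measurable_fun setT (fun t => atoms_del R alive pts n t A).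
Proof.
by apply: (measurable_atoms (alive := fun k t => delete (alive ^~ t) n k)) => //;
  exact: measurable_delete.
Qed.

(** Removing the picked atom changes only [alive]. The remaining process on the pairs (realization,
    picked index) is thus again given by a sequence of atoms, from which another one can be
    picked. *)
Definition alive_slice k (u : T * nat) := delete (alive ^~ u.1) u.2 k.
Definition pts_slice k (u : T * nat) := pts k u.1.

Lemma measurable_alive_slice k : measurable_fun setT (alive_slice k).
Proof.
apply: measurable_and; first exact: measurableT_comp (malive k) (measurable_fst).
apply: (measurableT_comp (f := fun n => k != n)); last exact: measurable_snd.
by [].
Qed.

Lemma measurable_pts_slice k : measurable_fun setT (pts_slice k).
Proof. exact: measurableT_comp (mpts k) measurable_fst. Qed.

Lemma atoms_del_le n t A : measurable A ->
  atoms_del R alive pts n t A <= atoms R alive pts t A.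
Proof.
move=> mA; rewrite /atoms_del /atoms !confE; apply: lee_nneseries => //.
move=> k _; rewrite lee_fin ler_nat /delete.
by case: (alive k t) => //=; case: (k != n).
Qed.

End atoms_delete.

(** A witness of sigma-finiteness; the total intensity, and with it the number of atoms, may be
    infinite. *)
Definition exhausts (R : realType) d (X : measurableType d)
    (nu : set X -> \bar R) (F : nat -> set X) :=
  [/\ forall p, measurable (F p), nondecreasing_seq F, \bigcup_p F p = setT &
      forall p, nu (F p) < +oo].

Section mecke.
Context (R : realType) d (X : measurableType d) d' (T : measurableType d').
Variables (alive : nat -> T -> bool) (pts : nat -> T -> X).
Hypotheses (malive : forall k, measurable_fun setT (alive k))
  (mpts : forall k, measurable_fun setT (pts k)).
Variable P : {measure set T -> \bar R}.
Hypothesis Poo : P setT < +oo.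
Local Notation N := (atoms R alive pts).
Local Notation Ndel := (atoms_del R alive pts).

(** [conf_cell] integrated over [P], valid for every such point process. The Poisson property enters
    only when the masses of the count events are evaluated. *)
Lemma mecke_cell (I : finType) (C : I -> set X) (i : I) (c : I -> nat) :
  (forall i, measurable (C i)) -> trivIset setT C ->
  \sum_(n <oo) P [set t | alive n t /\ C i (pts n t) /\
     forall j, Ndel n t (C j) = (c j)%:R%:E] =
  (c i).+1%:R%:E * P [set t | forall j, N t (C j) = (c j + (j == i))%:R%:E].
Proof.
move=> mC tC.
pose S n := [set t | alive n t /\ C i (pts n t) /\
     forall j, Ndel n t (C j) = (c j)%:R%:E].
have mcount d0 (T0 : measurableType d0) (f : I -> T0 -> \bar R) (v : I -> nat) :
    (forall j, measurable_fun setT (f j)) ->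
    measurable [set t | forall j, f j t = (v j)%:R%:E].
  move=> mf; rewrite (_ : [set _ | _] =
      \bigcap_(j in [set: I]) (f j @^-1` [set (v j)%:R%:E])).
    apply: fin_bigcap_measurable; first exact: finite_finset.
    by move=> j _; rewrite -[X in measurable X]setTI; exact: mf.
  by apply/seteqP; split => t /= h j => [_|]; exact: h.
have mS n : measurable (S n).
  rewrite (_ : S n = [set t | alive n t /\ C i (pts n t)] `&`
      [set t | forall j, Ndel n t (C j) = (c j)%:R%:E]).
    apply: measurableI; first exact: (measurable_alive_pts malive mpts n (mC i)).
    by apply: (mcount _ _ (fun j t => Ndel n t (C j))) => j; exact: measurable_atoms_del.
  by apply/seteqP; split => t /= => [[a [b]]|[[a b]]].
pose G := [set t | forall j, N t (C j) = (c j + (j == i))%:R%:E].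
have mG : measurable G.
  by apply: (mcount _ _ (fun j t => N t (C j))) => j; exact: measurable_atoms.
transitivity (\sum_(n <oo) \int[P]_t (\1_(S n) t)%:E).
  by apply: eq_eseriesr => n _; rewrite integral_indic// setIT.
rewrite -integral_nneseries//; last first.
  by move=> n; apply/measurable_EFinP; exact: measurable_indic.
transitivity (\int[P]_t ((c i).+1%:R%:E * (\1_G t)%:E)).
  apply: eq_integral => t _; rewrite -EFinM.
  have := conf_cell R i c (alive ^~ t) (pts ^~ t) tC.
  rewrite indicE mem_asbool => <-.
  by apply: eq_eseriesr => n _; rewrite indicE mem_asbool.
rewrite ge0_integralZl//; last by apply/measurable_EFinP; exact: measurable_indic.
by rewrite integral_indic// setIT.
Qed.

End mecke.

Section poisson_unique.
Context (R : realType) d (X : measurableType d).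
Variables (nu : {measure set X -> \bar R}) (F : nat -> set X).
Hypothesis exF : exhausts nu F.

Lemma poisson_mscale d' (T : measurableType d') (P : {measure set T -> \bar R})
    (c : {nonneg R}) N : poisson P nu N -> poisson (mscale c P) nu N.
Proof.
move=> [mN cN]; split => // I C v mC tC Cfin.
transitivity (c%:num%:E * P [set t | forall i, N t (C i) = (v i)%:R%:E]) => //.
by rewrite (cN I C v)// muleA.
Qed.

Lemma poisson_unique d1 (T1 : measurableType d1) d2 (T2 : measurableType d2)
  (P1 : {measure set T1 -> \bar R}) (P2 : {measure set T2 -> \bar R}) N1 N2 :
  P2 setT < +oo -> P1 setT = P2 setT ->
  poisson P1 nu N1 -> poisson P2 nu N2 ->
  forall E, eval_sigma E ->
  P1 [set t | E (N1 t : set X -> \bar R)] =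
  P2 [set t | E (N2 t : set X -> \bar R)].
Proof.
move=> P2oo P12 p1 p2; have [mF ndF FT Foo] := exF.
apply: (law_unique (A := setT) (F := F)) => //.
- exact: p1.1.
- exact: p2.1.
- move=> p B mB BF.
  have Boo : nu B < +oo.
    by apply: (le_lt_trans _ (Foo p)); apply: le_measure; rewrite ?inE.
  split; [apply: (poisson_integer_valued _ p1 mB Boo)|
          exact: (poisson_integer_valued _ p2 mB Boo)].
  by rewrite P12.
- move=> p I C mC tC CF _ v.
  have Coo i : nu (C i) < +oo.
    apply: (le_lt_trans _ (Foo p)); apply: le_measure; rewrite ?inE//.
    by rewrite -CF; exact: bigcup_sup.
  by rewrite (p1.2 I C v)// (p2.2 I C v)// P12.
Qed.

Lemma poisson_eq_law d1 (T1 : measurableType d1) d2 (T2 : measurableType d2)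
  (P1 : {measure set T1 -> \bar R}) (P2 : {measure set T2 -> \bar R})
  (N1 : T1 -> {measure set X -> \bar R}) (N2 : T2 -> {measure set X -> \bar R}) :
  (forall A, measurable A -> measurable_fun setT (fun t => N1 t A)) ->
  (forall E, eval_sigma E ->
    P1 [set t | E (N1 t : set X -> \bar R)] =
    P2 [set t | E (N2 t : set X -> \bar R)]) ->
  poisson P2 nu N2 -> poisson P1 nu N1.
Proof.
move=> mN1 e [mN2 c2]; split => // I C v mC tC Coo.
have PT : P1 setT = P2 setT.
  have := e setT; rewrite /= => ->//.
  by rewrite -setC0; apply: sigma_algebraC; exact: sigma_algebra0.
rewrite PT -(c2 I C v)//.
by apply: (e [set m | forall i, m (C i) = (v i)%:R%:E]); exact: eval_sigma_counts.
Qed.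

End poisson_unique.

Section mecke_poisson.
Context (R : realType) d (X : measurableType d) d' (T : measurableType d').
Variables (alive : nat -> T -> bool) (pts : nat -> T -> X).
Hypotheses (malive : forall k, measurable_fun setT (alive k))
  (mpts : forall k, measurable_fun setT (pts k)).
Variables (P : {measure set T -> \bar R}) (nu : {measure set X -> \bar R}).
Hypothesis Poo : P setT < +oo.
Local Notation N := (atoms R alive pts).
Local Notation Ndel := (atoms_del R alive pts).

(** [law_unique] compares two laws: that of the configuration left after an atom is picked in [A],
    under [slice], and that of [N] under [P] scaled by [nu A]. On cells they agree by [mecke_cell]
    and the recursion [poisS]. *)
Lemma poisson_mecke_finite (F : nat -> set X) A : exhausts nu F ->
  poisson P nu N -> measurable A -> nu A < +oo ->
  forall E, eval_sigma E ->
  \sum_(n <oo) P [set t | (alive n t /\ A (pts n t)) /\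
                           E (Ndel n t : set X -> \bar R)] =
  nu A * P [set t | E (N t : set X -> \bar R)].
Proof.
move=> [mF ndF FT Foo] pN mA nuA E sE.
pose S n := [set t | alive n t /\ A (pts n t)].
have mS n : measurable (S n) by exact: (measurable_alive_pts malive mpts n mA).
pose N1 (u : T * nat) := atoms R (alive_slice alive) (pts_slice pts) u.
have nuA0 : (0 <= fine (nu A))%R by rewrite fine_ge0.
pose P2 : {measure set T -> \bar R} := mscale (NngNum nuA0) P.
have nuAE : nu A = (fine (nu A))%:E by rewrite fineK// ge0_fin_numE.
have P2E U : P2 U = nu A * P U by rewrite [in RHS]nuAE.
transitivity (slice P mS [set u | E (N1 u : set X -> \bar R)]).
  by rewrite sliceE; apply: eq_eseriesr => n _; congr (P _);
    apply/seteqP; split => t /= [].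
have <- : P2 [set t | E (N t : set X -> \bar R)] = nu A * P [set t | E (N t : set X -> \bar R)].
  by rewrite P2E.
(* Enlarged so that [A] is contained in every member, hence a union of cells of each partition. *)
pose F' p := F p `|` A.
have mF' p : measurable (F' p) by exact: measurableU.
have F'oo p : nu (F' p) < +oo.
  by apply: (le_lt_trans (measureU2 nu (mF p) mA)); exact: (lte_add_pinfty (Foo p) nuA).
have sub_oo p B : measurable B -> B `<=` F' p -> nu B < +oo.
  move=> mB BF; apply: (le_lt_trans _ (F'oo p)).
  by apply: le_measure; rewrite ?inE.
move: E sE; apply: (law_unique (A := A) (F := F')) => //.
- by rewrite P2E nuAE; apply: lte_mul_pinfty.
- move=> B mB; apply: measurable_atoms => // k.
    exact: measurable_alive_slice.
  exact: measurable_pts_slice.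
- by move=> B mB; exact: measurable_atoms.
- by move=> m n mn; apply/subsetPset; apply: setSU; apply/subsetPset; exact: ndF.
- by apply/seteqP; split => // x _; have : (\bigcup_p F p) x by [rewrite FT];
    move=> [p _ Fx]; exists p => //; left.
- move=> p B mB BF; have Boo := sub_oo _ _ mB BF.
  have [M [mM PM0 MB]] := poisson_integer_valued Poo pN mB Boo.
  split; last first.
    by exists M; split => //; rewrite P2E PM0 mule0.
  exists (M `*` setT); split => /=; first exact: measurableX.
    rewrite sliceE eseries0// => n _ _.
    apply: (subset_measure0 _ _ _ PM0) => //.
      apply: measurableI => //.
      by rewrite (_ : [set _ | _] = M)//; apply/seteqP; split => t // [].
    by move=> t [[]].
  (* Off the null set [M] the count of [B] is finite; deletion cannot make it infinite, and a count
     that is not infinite is an integer. *)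
  move=> [t n] h; split => //; apply: MB => hN; apply: h.
  have [h|//] := conf_integer R (delete (alive ^~ t) n) (pts ^~ t) B.
  have : integer_valued (N t B) by exact: hN.
  have := atoms_del_le R alive pts n t mB; rewrite /atoms_del h => le [m hm].
  by move: le; rewrite hm leye_eq.
- move=> p I C mC tC CF CA v.
  pose Q i := `[< C i `<=` A >].
  have AE : A = \bigcup_(i in [set i | Q i]) C i.
    apply/seteqP; split => [x Ax|x [i /asboolP]]; last exact.
    have : (F' p) x by right.
    rewrite -CF => -[i _ Cx]; exists i => //; apply/asboolP.
    by have [//|/seteqP[h _]] := CA i; have := h x; case.
  have Coo i : nu (C i) < +oo.
    by apply: (sub_oo p) => //; rewrite -CF; exact: bigcup_sup.
  rewrite sliceE.
  transitivity (\sum_(n <oo) \sum_(i | Q i)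
     P [set t | alive n t /\ C i (pts n t) /\
        forall j, Ndel n t (C j) = (v j)%:R%:E]).
    apply: eq_eseriesr => n _.
    rewrite -(@measure_bigcup_fin _ _ _ P _ Q (fun i => [set t | alive n t /\ C i (pts n t) /\
        forall j, Ndel n t (C j) = (v j)%:R%:E])).
    + congr (P _); apply/seteqP; split => t /=.
        move=> [h [aln]]; rewrite AE => -[i Qi Ci]; exists i => //.
      move=> [i Qi [aln [Ci h]]]; split=> //; split => //.
      by rewrite AE; exists i.
    + move=> i.
      rewrite (_ : [set _ | _] = [set t | alive n t /\ C i (pts n t)] `&`
        \bigcap_(j in [set: I]) ((fun t => Ndel n t (C j)) @^-1` [set (v j)%:R%:E])).
        apply: measurableI; first exact: (measurable_alive_pts malive mpts n (mC i)).
        apply: fin_bigcap_measurable; first exact: finite_finset.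
        move=> j _; exact: (measurable_preimage (measurable_atoms_del malive mpts n (mC j))).
      apply/seteqP; split => t /=.
        by move=> [a [b h]]; split => // j _; exact: h.
      by move=> [[a b] h]; split => //; split => // j; exact: h.
    + apply/trivIsetP => i j _ _ ij; rewrite -subset0 => t [[_ [Ci _]] [_ [Cj _]]].
      by move/trivIsetP : tC => /(_ i j Logic.I Logic.I ij); rewrite -subset0; apply; split; [exact: Ci|exact: Cj].
  rewrite nneseries_sum//.
  under eq_bigr => i _ do rewrite (mecke_cell malive mpts P i v mC tC) (pN.2 _ C _ mC tC Coo).
  rewrite P2E (pN.2 _ C v mC tC Coo).
  rewrite [in RHS]AE measure_bigcup_fin// ge0_sume_distrl//.
  apply: eq_bigr => i _.
  have -> : nu (C i) = (fine (nu (C i)))%:E by rewrite fineK// ge0_fin_numE.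
  rewrite muleCA [RHS]muleCA; congr (_ * _); rewrite -!EFinM; congr (_%:E).
  (* Only the weight of the cell of the picked atom changes, and [poisS] accounts for it. *)
  rewrite (bigD1 i)//= [in RHS](bigD1 i)//= [LHS]mulrA [RHS]mulrA eqxx addn1 poisS.
  congr (_ * _)%R; apply: eq_bigr => j ji.
  by rewrite (negbTE ji) addn0.
Qed.

End mecke_poisson.

Section mecke_functional.
Context (R : realType) d (X : measurableType d) d' (T : measurableType d').
Variables (alive : nat -> T -> bool) (pts : nat -> T -> X).
Hypotheses (malive : forall k, measurable_fun setT (alive k))
  (mpts : forall k, measurable_fun setT (pts k)).
Variables (P : {measure set T -> \bar R}) (nu : {measure set X -> \bar R}).
Hypothesis Poo : P setT < +oo.
Local Notation N := (atoms R alive pts).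
Local Notation Ndel := (atoms_del R alive pts).

Lemma measurable_sub_exhaust (F : nat -> set X) : exhausts nu F ->
  measurable = <<s [set A : set X | measurable A /\ exists p, A `<=` F p] >>.
Proof.
move=> [mF ndF FT Foo]; apply/seteqP; split.
  move=> A mA; rewrite -(setIT A) -FT setI_bigcupr.
  apply: sigma_algebra_bigcup => p; apply: sub_sigma_algebra; split.
    exact: measurableI.
  by exists p; exact: subIsetr.
apply: smallest_sub; first exact: sigma_algebra_measurable.
by move=> A [].
Qed.

Lemma measure_unique_exhaust (F : nat -> set X)
    (m1 m2 : {measure set X -> \bar R}) : exhausts nu F ->
  (forall p, m1 (F p) < +oo) ->
  (forall A, measurable A -> nu A < +oo -> m1 A = m2 A) ->
  forall A, measurable A -> m1 A = m2 A.
Proof.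
move=> exF m1F m12 A mA; have [mF ndF FT Foo] := exF.
apply: (measure_unique [set A : set X | measurable A /\ exists p, A `<=` F p] F) => //.
- exact: measurable_sub_exhaust exF.
- move=> B C [mB [p Bp]] [mC _]; split; first exact: measurableI.
  by exists p; apply: subset_trans Bp; exact: subIsetl.
- by move=> p; split => //; exists p.
- move=> B [mB [p Bp]]; apply: m12 => //.
  by apply: (le_lt_trans _ (Foo p)); apply: le_measure; rewrite ?inE.
Qed.

Lemma measurable_alive_del n E : eval_sigma E ->
  measurable [set t | alive n t /\ E (Ndel n t : set X -> \bar R)].
Proof.
move=> sE; rewrite (_ : [set _ | _] = (alive n @^-1` [set true]) `&`
    [set t | E (Ndel n t : set X -> \bar R)])//.
apply: measurableI; first exact: measurable_preimage.
apply: measurable_eval_sigma => // A mA.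
exact: measurable_atoms_del.
Qed.

(** For fixed [E] both sides are integrals of [phi], against two measures that agree on the sets of
    finite intensity by [poisson_mecke_finite]. *)
Lemma poisson_mecke (F : nat -> set X) E (phi : X -> \bar R) : exhausts nu F ->
  poisson P nu N -> eval_sigma E -> (forall x, 0 <= phi x) ->
  measurable_fun setT phi ->
  \sum_(n <oo) \int[P]_(t in [set t | alive n t /\ E (Ndel n t : set X -> \bar R)])
     phi (pts n t) =
  P [set t | E (N t : set X -> \bar R)] * \int[nu]_x phi x.
Proof.
move=> exF pN sE phi0 mphi.
have mS n := measurable_alive_del n sE.
pose m1 : {measure set X -> \bar R} := mseries (fun n => push (mrestr P (mS n)) (mpts n)) 0.
have mE : measurable [set t | E (N t : set X -> \bar R)].
  by apply: measurable_eval_sigma => // A mA; exact: measurable_atoms.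
set PE := P [set t | E (N t : set X -> \bar R)].
have PEoo : PE < +oo.
  by apply: (le_lt_trans _ Poo); apply: le_measure; rewrite ?inE.
have PEg0 : 0 <= PE by exact: measure_ge0.
have PE0 : (0 <= fine PE)%R by rewrite fine_ge0.
have PEE : PE = (fine PE)%:E by rewrite fineK// ge0_fin_numE.
pose m2 : {measure set X -> \bar R} := mscale (NngNum PE0) nu.
have m2E A : m2 A = PE * nu A by rewrite [in RHS]PEE.
have m12 A : measurable A -> nu A < +oo -> m1 A = m2 A.
  move=> mA nuA; rewrite m2E muleC -(poisson_mecke_finite malive mpts Poo exF pN mA nuA sE).
  apply: eq_eseriesr => n _; rewrite pushE /mrestr; congr (P _).
  by apply/seteqP; split => t /=; tauto.
transitivity (\int[m1]_x phi x).
  rewrite ge0_integral_measure_series//; apply: eq_eseriesr => n _.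
  by rewrite integral_push// integral_mrestr//; exact: measurableT_comp.
rewrite PEE -[RHS](ge0_integral_mscale _ measurableT (NngNum PE0))//.
apply: eq_measure_integral => A mA _.
apply: (measure_unique_exhaust exF) => // p.
have [mF _ _ Foo] := exF.
by rewrite m12// m2E PEE; apply: lte_mul_pinfty.
Qed.

End mecke_functional.

(** * The converse of Mecke's formula *)

Section mecke_converse.
Context (R : realType) d (X : measurableType d) d' (T : measurableType d').
Variables (alive : nat -> T -> bool) (pts : nat -> T -> X).
Hypotheses (malive : forall k, measurable_fun setT (alive k))
  (mpts : forall k, measurable_fun setT (pts k)).
Variables (P : {measure set T -> \bar R}) (nu : {measure set X -> \bar R}).
Hypothesis Poo : P setT < +oo.
Local Notation N := (atoms R alive pts).
Local Notation Ndel := (atoms_del R alive pts).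

(** With no condition on the rest, Mecke's formula says that the integral of the number of atoms in
    [A] is [nu A * P setT], which is finite. *)
Lemma mecke_atoms_finite A : measurable A -> nu A < +oo ->
  \sum_(n <oo) P [set t | alive n t /\ A (pts n t)] = nu A * P setT ->
  {ae P, forall t, N t A < +oo}.
Proof.
move=> mA nuA h.
have mS n := measurable_alive_pts malive mpts n mA.
have iN : \int[P]_t N t A < +oo.
  rewrite (_ : \int[P]_t _ = nu A * P setT).
    by apply: lte_mul_pinfty => //; rewrite ge0_fin_numE.
  rewrite -h; under eq_integral do rewrite /atoms confE.
  rewrite integral_nneseries//.
  - apply: eq_eseriesr => n _; rewrite -(setIT [set t | _]) -integral_indic//.
    apply: eq_integral => t _; rewrite indicE; congr (_%:R%:E); congr nat_of_bool.
    apply/andP/idP => [[a b]|]; first by apply/mem_set; split=> //; exact: set_mem.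
    by move=> /set_mem[a b]; split => //; exact: mem_set.
  - move=> n; rewrite (_ : (fun _ => _) =
      fun t => (\1_[set t | alive n t /\ A (pts n t)] t)%:E).
      by apply/measurable_EFinP; exact: measurable_indic.
    apply/funext => t; rewrite indicE; congr (_%:R%:E); congr nat_of_bool.
    apply/andP/idP => [[a b]|]; first by apply/mem_set; split=> //; exact: set_mem.
    by move=> /set_mem[a b]; split => //; exact: mem_set.
have : P.-integrable setT (fun t => N t A).
  apply/integrableP; split; first exact: measurable_atoms.
  by under eq_integral do rewrite gee0_abs//.
move=> /integrable_ae -/(_ measurableT); apply: filterS => t /(_ Logic.I).
by rewrite ge0_fin_numE.
Qed.

(** Cells are added one at a time. With the counts of the others fixed, Mecke's formula makes the
    masses of [N t (C i) = n] satisfy the Poisson recursion, so they are proportional to [pois x n];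
    summation over [n] identifies the factor as the mass of the event for the other cells. *)
Lemma mecke_poisson :
  (forall A E, measurable A -> nu A < +oo -> eval_sigma E ->
    \sum_(n <oo) P [set t | (alive n t /\ A (pts n t)) /\
                             E (Ndel n t : set X -> \bar R)] =
    nu A * P [set t | E (N t : set X -> \bar R)]) ->
  poisson P nu N.
Proof.
move=> mecke; split; first by move=> A mA; exact: measurable_atoms.
move=> I C c mC tC Coo.
(* Cells not yet treated become empty with required count [0], which is no condition; the index type
   stays [I]. *)
pose C' (s : seq I) j := if j \in s then C j else set0.
pose c' (s : seq I) j := if j \in s then c j else 0%N.
have mC' s j : measurable (C' s j) by rewrite /C'; case: ifP.
have tC' s : trivIset setT (C' s).
  apply/trivIsetP => i j _ _ ij; rewrite /C'; case: ifP => _; last by rewrite set0I.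
  by case: ifP => _; [move/trivIsetP : tC; exact|rewrite setI0].
have mcount s (v : I -> nat) :
    measurable [set t | forall j, N t (C' s j) = (v j)%:R%:E].
  apply: (@measurable_eval_sigma _ _ _ _ _ (fun t => N t : set X -> \bar R) _
    [set m | forall j, m (C' s j) = (v j)%:R%:E]).
    by move=> A mA; exact: measurable_atoms.
  by apply: eval_sigma_counts => j; exact: mC'.
suff key s : uniq s -> P [set t | forall j, N t (C' s j) = (c' s j)%:R%:E] =
    P setT * (\prod_(j <- s) pois (fine (nu (C j))) (c j))%:E.
  have := key (index_enum I) (index_enum_uniq I).
  rewrite (_ : [set t | _] = [set t | forall i, N t (C i) = (c i)%:R%:E])//.
  apply/seteqP; split => t /= h j; have := h j;
    by rewrite /C' /c' mem_index_enum.
elim: s => [_|i s IH /= /andP[ni us]].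
  rewrite big_nil mule1; congr (P _); apply/seteqP; split => // t _ j.
  by rewrite /C' /c' /= measure0.
pose x := fine (nu (C i)).
have xE : nu (C i) = x%:E by rewrite fineK// ge0_fin_numE.
have x0 : (0 <= x)%R by rewrite fine_ge0.
pose v n j := if j == i then n else c' s j.
pose S n := [set t | forall j, N t (C' (i :: s) j) = (v n j)%:R%:E].
have mS n : measurable (S n) by exact: mcount.
have C'i : C' (i :: s) i = C i by rewrite /C' inE eqxx.
have rec n : n.+1%:R%:E * P (S n.+1) = x%:E * P (S n).
  rewrite -xE -(mecke _ [set m | forall j, m (C' (i :: s) j) = (v n j)%:R%:E])//; last first.
    by apply: eval_sigma_counts => j; exact: mC'.
  have := mecke_cell malive mpts P i (v n) (mC' (i :: s)) (tC' (i :: s)).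
  have -> : v n i = n by rewrite /v eqxx.
  move=> h.
  transitivity (n.+1%:R%:E * P [set t | forall j, N t (C' (i :: s) j) =
      (v n j + (j == i))%:R%:E]).
    have vS : v n.+1 = (fun j => (v n j + (j == i))%N).
      by apply/funext => j; rewrite /v; case: eqP => _;
        rewrite ?addn1 ?addn0.
    by rewrite /S vS.
  rewrite -h; apply: eq_eseriesr => n' _; congr (P _).
  by rewrite C'i; apply/seteqP; split => t /=; tauto.
have Sfin n : P (S n) \is a fin_num.
  rewrite ge0_fin_numE//; apply: (le_lt_trans _ Poo).
  by apply: le_measure; rewrite ?inE.
pose r n := fine (P (S n)).
have rE n : P (S n) = (r n)%:E by rewrite fineK.
have recr n : (n.+1%:R * r n.+1 = x * r n)%R.
  by have := rec n; rewrite !rE -!EFinM => -[].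
(* The factor [expR x * r 0] is dictated by the case [n = 0], where [pois x 0] is [expR (- x)]. *)
have rpois n : r n = (pois x n * (expR x * r 0%N))%R.
  elim: n => [|n IHn].
    by rewrite /pois expr0 fact0 divr1 mul1r mulrA -expRD addNr expR0 mul1r.
  apply: (@mulfI _ n.+1%:R); first by rewrite pnatr_eq0.
  by rewrite recr IHn [LHS]mulrA [RHS]mulrA poisS.
have Ci_oo : {ae P, forall t, N t (C i) < +oo}.
  apply: mecke_atoms_finite => //.
  have := mecke (C i) setT (mC i) (Coo i).
  rewrite (_ : [set t | [set: set X -> \bar R] (N t)] = setT)// => <-.
    by apply: eq_eseriesr => n _; congr (P _); apply/seteqP; split => t /=; tauto.
  by rewrite -setC0; apply: sigma_algebraC; exact: sigma_algebra0.
(* An infinite count of [C i] lies in no [S n]; hence the almost sure finiteness [Ci_oo]. *)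
have PU : P [set t | forall j, N t (C' s j) = (c' s j)%:R%:E] = P (\bigcup_n S n).
  apply: eq_measure_ae => //; first exact: bigcup_measurable.
  apply: filterS Ci_oo => t Nt; split => [h|].
    have [|[n hn]] := conf_integer R (alive ^~ t) (pts ^~ t) (C i).
      by move: Nt; rewrite /atoms => + e; rewrite e.
    exists n => // j; rewrite /v; case: eqP => [->|/eqP ji]; first by rewrite C'i.
    by rewrite -h /C' inE (negbTE ji).
  move=> [n _ h] j; have [->|ji] := eqVneq j i.
    by rewrite /C' /c' (negbTE ni) measure0.
  by have := h j; rewrite /v (negbTE ji) /C' inE (negbTE ji).
have sumS : P (\bigcup_n S n) = (expR x * r 0%N)%:E.
  rewrite measure_bigcup//; last first.
    apply/trivIsetP => m n _ _ mn; rewrite -subset0 => t [Sm Sn].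
    have := Sm i; rewrite (Sn i) /v eqxx => -[] /eqP.
    by rewrite eqr_nat eq_sym (negbTE mn).
  rewrite (eq_eseriesl (Q := xpredT)); last by move=> j; rewrite in_setT.
  under eq_eseriesr => n _ do rewrite rE rpois mulrC EFinM.
  rewrite nneseriesZl; last by move=> n _; rewrite lee_fin pois_ge0.
  by rewrite sum_pois// mule1.
have -> : [set t | forall j, N t (C' (i :: s) j) = (c' (i :: s) j)%:R%:E] = S (c i).
  have -> : c' (i :: s) = v (c i) by apply/funext => j; rewrite /v /c' inE; case: eqP => // ->.
  by [].
rewrite rE rpois EFinM -sumS -PU IH// big_cons [in RHS]EFinM.
by rewrite muleCA.
Qed.

End mecke_converse.

(** * Marked Poisson processes *)

Section marks.
Context (R : realType) d (X : measurableType d) dW (W : measurableType dW).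
Variables (g : R.-pker X ~> W) (DD : set (set W)).
Hypotheses (mDD : DD `<=` measurable) (DDT : DD setT).

Section marked.
Context d' (T : measurableType d').
Variables (P : {measure set T -> \bar R}) (alive : nat -> T -> bool)
  (pts : nat -> T -> X) (A : nat -> T -> W).

Definition atoms_gen : set (set T) :=
  [set E | exists k, exists2 D, measurable D &
                     E = [set t | alive k t /\ D (pts k t)]].

Definition mark_prob (D : nat -> set W) n t : \bar R :=
  \prod_(k < n) (if alive k t then g (pts k t) (D k) else 1).

(* Conditional independence of the marks, with laws [g (pts k)], given the
   atoms; stated for functionals of the atoms, so that it survives the change
   of measure made by picking an atom. *)
Definition marked : Prop :=
  forall h : T -> \bar R, (forall t, 0 <= h t) ->
  measurable_fun setT (h : g_sigma_algebraType atoms_gen -> \bar R) ->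
  forall n (D : nat -> set W), (forall k, DD (D k)) ->
  (forall k, (n <= k)%N -> D k = setT) ->
  \int[P]_(t in [set t | forall k, alive k t -> D k (A k t)]) h t =
  \int[P]_t (h t * mark_prob D n t).

Lemma mark_prob_ge0 D n t : 0 <= mark_prob D n t.
Proof. by apply: prode_ge0 => k _; case: ifP. Qed.

Lemma mark_prob_widen D n n' t : (n <= n')%N ->
  (forall k, (n <= k)%N -> D k = setT) -> mark_prob D n t = mark_prob D n' t.
Proof.
move=> nn' DT; rewrite /mark_prob (big_ord_widen n' (fun k : nat => if alive k t then g (pts k t) (D k) else 1))//.
rewrite big_mkcond; apply: eq_bigr => k _; case: ifPn => //; rewrite -leqNgt => nk.
by rewrite DT// prob_kernel; case: ifP.
Qed.

Hypotheses (malive : forall k, measurable_fun setT (alive k))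
  (mpts : forall k, measurable_fun setT (pts k)).

Lemma measurable_atoms_gen S : <<s atoms_gen >> S -> measurable S.
Proof.
apply: smallest_sub; first exact: sigma_algebra_measurable.
by move=> _ [k [D mD ->]]; exact: (measurable_alive_pts malive mpts k mD).
Qed.

Lemma measurable_fun_atoms_gen d0 (Z : measurableType d0) (h : T -> Z) :
  measurable_fun setT (h : g_sigma_algebraType atoms_gen -> Z) ->
  measurable_fun setT h.
Proof.
move=> mh _ C mC; rewrite setTI; apply: measurable_atoms_gen.
by have := mh measurableT C mC; rewrite setTI.
Qed.

(** The generators see [pts k] only where the atom exists, hence the constant [c] elsewhere. *)
Lemma atoms_gen_comp k (phi : X -> \bar R) (c : \bar R) : measurable_fun setT phi ->
  measurable_fun setT ((fun t => if alive k t then phi (pts k t) else c)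
    : g_sigma_algebraType atoms_gen -> \bar R).
Proof.
move=> mphi _ C mC; rewrite setTI.
rewrite (_ : _ @^-1` C = [set t | alive k t /\ (phi @^-1` C) (pts k t)] `|`
    (if `[< C c >] then ~` [set t | alive k t /\ setT (pts k t)] else set0)).
  apply: measurableU.
    apply: sub_sigma_algebra; exists k, (phi @^-1` C) => //.
    exact: measurable_preimage.
  case: ifP => _ //; apply: measurableC; apply: sub_sigma_algebra.
  by exists k, setT.
apply/seteqP; split => t /=.
  case: ifPn => [at_ Ct|nat_ Cc]; first by left.
  by right; rewrite asboolT//= => -[alk _]; rewrite alk in nat_.
move=> [[-> //]|]; case: asboolP => // Cc h.
by case: ifPn => // at_; case: h; split.
Qed.

Lemma atoms_gen_mark_prob D n : (forall k, DD (D k)) ->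
  measurable_fun setT (mark_prob D n : g_sigma_algebraType atoms_gen -> \bar R).
Proof.
move=> DDD; rewrite /mark_prob; elim: n => [|n IH].
  by under eq_fun do rewrite big_ord0; exact: measurable_cst.
under eq_fun do rewrite big_ord_recr/=; apply: emeasurable_funM => //.
by apply: (@atoms_gen_comp _ (fun x => g x (D n))); exact/measurable_kernel/mDD.
Qed.

Lemma measurable_marks (mA : forall k, measurable_fun setT (A k)) D :
  (forall k, DD (D k)) ->
  measurable [set t | forall k, alive k t -> D k (A k t)].
Proof.
move=> DDD.
rewrite (_ : [set _ | _] = \bigcap_k ((alive k @^-1` [set false]) `|` (A k @^-1` D k))).
  apply: bigcapT_measurable => k; apply: measurableU; apply: measurable_preimage => //.
  exact: mDD.
apply/seteqP; split => t /= h k => [_|al].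
  by case alk : (alive k t); [right; apply: h|left].
by have [|//] := h k Logic.I; rewrite /= al.
Qed.

Lemma atoms_gen_eval n E : @eval_sigma R _ X E ->
  <<s atoms_gen >> [set t | alive n t /\ E (atoms_del R alive pts n t : set X -> \bar R)].
Proof.
move=> sE.
rewrite (_ : [set _ | _] = [set t | alive n t /\ setT (pts n t)] `&`
  [set t | E (atoms_del R alive pts n t : set X -> \bar R)]); last first.
  by apply/seteqP; split => t /= [a b]; [split|case: a].
apply: sigma_algebra_setI; first by apply: sub_sigma_algebra; exists n, setT.
apply: (@eval_sigma_preimage _ _ _ _ _ (fun t => atoms_del R alive pts n t : set X -> \bar R) _ _ _ sE).
  exact: smallest_sigma_algebra.
move=> B C mB mC.
have mm : measurable_fun setT ((fun t => atoms_del R alive pts n t B)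
    : g_sigma_algebraType atoms_gen -> \bar R).
  under eq_fun do rewrite /atoms_del confE.
  apply: ge0_emeasurable_sum => // k _.
  rewrite (_ : (fun _ => _) = (fun t => if alive k t then
    ((k != n) && (pts k t \in B))%:R%:E else 0)).
    apply: (@atoms_gen_comp _ (fun x => ((k != n) && (x \in B))%:R%:E)).
    case: (k != n) => /=; last exact: measurable_cst.
    by apply/measurable_EFinP; exact: measurable_indic.
  by apply/funext => t; rewrite /delete; case: (alive k t).
by have := mm measurableT C mC; rewrite setTI.
Qed.

(** For a fixed family [D] both sides are measures in [S] on the sigma-algebra of the atoms. Being
    equal, they give the same integral to every nonnegative function measurable for it. *)
Lemma markedP (mA : forall k, measurable_fun setT (A k)) :
  (forall S, <<s atoms_gen >> S -> forall n (D : nat -> set W),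
    (forall k, DD (D k)) -> (forall k, (n <= k)%N -> D k = setT) ->
    P (S `&` [set t | forall k, alive k t -> D k (A k t)]) =
    \int[P]_(t in S) mark_prob D n t) -> marked.
Proof.
move=> hS h h0 mh n D DDD DT.
pose F := [set t | forall k, alive k t -> D k (A k t)].
have mF : measurable F by exact: measurable_marks.
have mid : measurable_fun setT (id : T -> g_sigma_algebraType atoms_gen).
  by move=> _ S sS; rewrite setTI preimage_id; exact: measurable_atoms_gen.
have mh' := measurable_fun_atoms_gen mh.
have mmp := atoms_gen_mark_prob n DDD.
have mmp' := measurable_fun_atoms_gen mmp.
have mp0 := mark_prob_ge0 D n.
transitivity (\int[push (mrestr P mF) mid]_t h t).
  by rewrite integral_push// integral_mrestr.
transitivity (\int[push (density P mp0 mmp') mid]_t h t).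
  apply: eq_measure_integral => S mS _.
  by rewrite !pushE /mrestr preimage_id; exact: hS.
by rewrite integral_push// integral_density.
Qed.

End marked.
End marks.

Section marked_poisson.
Context (R : realType) d (X : measurableType d) dW (W : measurableType dW).
Variables (g : R.-pker X ~> W) (DD : set (set W)).
Hypotheses (mDD : DD `<=` measurable) (DDT : DD setT).
Variables (nu : {measure set X -> \bar R}) (F : nat -> set X).
Hypothesis exF : exhausts nu F.
Variable m : {measure set (X * W) -> \bar R}.
Hypothesis mE : forall C D, measurable C -> DD D ->
  m (C `*` D) = \int[nu]_(x in C) g x D.

(** A class of processes stable under picking an atom ([peel_marked_poisson]), which is why the
    measure is only required to be finite. Marks are tested on sets of [DD], in the model the
    product sets. *)
Record marked_poisson d' (T : measurableType d') (P : {measure set T -> \bar R})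
    (alive : nat -> T -> bool) (pts : nat -> T -> X) (A : nat -> T -> W) : Prop := {
  mp_fin : P setT < +oo ;
  mp_alive : forall k, measurable_fun setT (alive k) ;
  mp_pts : forall k, measurable_fun setT (pts k) ;
  mp_marks : forall k, measurable_fun setT (A k) ;
  mp_poisson : poisson P nu (atoms R alive pts) ;
  mp_marked : marked g DD P alive pts A }.

Lemma marked_fin C D : measurable C -> nu C < +oo -> DD D -> m (C `*` D) < +oo.
Proof.
move=> mC nuC DDD; rewrite mE//.
apply: (le_lt_trans _ nuC); rewrite -[leRHS]mul1e -integral_cst//.
apply: ge0_le_integral => //.
- by apply: measurable_funTS; apply: measurable_kernel; exact: mDD.
- by move=> x _; rewrite /cst -(@prob_kernel _ _ _ _ _ g x); apply: le_measure; rewrite ?inE//; exact: mDD.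
Qed.

Section peel.
Context d' (T : measurableType d') (P : {measure set T -> \bar R}).
Variables (alive : nat -> T -> bool) (pts : nat -> T -> X) (A : nat -> T -> W).
Hypothesis MP : marked_poisson P alive pts A.
Variables (C : set X) (D0 : set W).
Hypotheses (mC : measurable C) (nuC : nu C < +oo) (DD0 : DD D0).

Let malive := mp_alive MP.
Let mpts := mp_pts MP.
Let mA := mp_marks MP.
Local Notation Tat := (g_sigma_algebraType (atoms_gen alive pts)).

Definition chosen n := [set t | [/\ alive n t, C (pts n t) & D0 (A n t)]].

Lemma measurable_chosen n : measurable (chosen n).
Proof.
rewrite (_ : chosen n = (alive n @^-1` [set true]) `&` (pts n @^-1` C) `&`
  (A n @^-1` D0)).
  apply: measurableI; last by apply: measurable_preimage => //; exact: mDD.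
  by apply: measurableI; exact: measurable_preimage.
by apply/seteqP; split => t /= [] // [].
Qed.

(** Given the atoms, the mark of atom [n] lies in [D0] with probability [g (pts n t) D0]: the
    property [marked] is applied to the family that constrains this mark alone. *)
Lemma integral_chosen n (h : T -> \bar R) : (forall t, 0 <= h t) ->
  measurable_fun setT (h : Tat -> \bar R) ->
  \int[P]_(t in chosen n) h t =
  \int[P]_t (h t * (if alive n t then (\1_C (pts n t))%:E * g (pts n t) D0 else 0)).
Proof.
move=> h0 mh.
pose h' t := h t * (if alive n t then (\1_C (pts n t))%:E else 0).
have h'0 t : 0 <= h' t.
  by apply: mule_ge0 => //; case: ifP => // _; rewrite lee_fin.
have mh' : measurable_fun setT (h' : Tat -> \bar R).
  apply: emeasurable_funM => //.
  apply: (@atoms_gen_comp _ _ _ _ _ _ _ _ (fun x => (\1_C x)%:E)).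
  by apply/measurable_EFinP; exact: measurable_indic.
pose D k := if k == n then D0 else setT.
have DDD k : DD (D k) by rewrite /D; case: ifP.
have := mp_marked MP h'0 mh' (n := n.+1) DDD.
rewrite (_ : \int[P]_(t in _) h' t = \int[P]_(t in chosen n) h t); last first.
  rewrite integral_mkcond [RHS]integral_mkcond; apply: eq_integral => t _.
  rewrite !patchE !mem_asbool.
  case: asboolP => [h1|h1]; case: asboolP => [h2|h2] //.
  - have [alt Ct _] := h2.
    by rewrite /h' alt indicE mem_set// mule1.
  - rewrite /h'; case: ifPn => alt; last by rewrite mule0.
    have [Ct|nCt] := pselect (C (pts n t)); last by rewrite indicE memNset// mule0.
    case: h2; split => //.
    by have := h1 n alt; rewrite /D eqxx.
  - case: h1 => k; rewrite /D; case: eqP => // ->.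
    by case: h2.
move=> -> //; last by move=> k nk; rewrite /D gtn_eqF.
apply: eq_integral => t _; rewrite /mark_prob big_ord_recr/= big1 => [|k _]; last first.
  by rewrite /D ltn_eqF// prob_kernel; case: ifP.
rewrite mul1e /D eqxx /h' -muleA; congr (_ * _).
by case: ifP => //; rewrite mul0e.
Qed.

Local Notation Q := (slice P measurable_chosen).
Local Notation alive' := (alive_slice alive).
Local Notation pts' := (pts_slice pts).
Let A' k (u : T * nat) := A k u.1.

(** The mark of the picked atom is integrated out first. What remains is Mecke's formula for
    [phi x = 1_C x * g x D0], whose integral is the mass of the rectangle. *)
Lemma peel_law E : eval_sigma E ->
  Q [set u | E (atoms R alive' pts' u : set X -> \bar R)] =
  m (C `*` D0) * P [set t | E (atoms R alive pts t : set X -> \bar R)].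
Proof.
move=> sE; rewrite sliceE.
pose phi x := (\1_C x)%:E * g x D0.
have phi0 x : 0 <= phi x by rewrite mule_ge0// lee_fin.
have mphi : measurable_fun setT phi.
  apply: emeasurable_funM; first by apply/measurable_EFinP; exact: measurable_indic.
  by apply: measurable_kernel; exact: mDD.
have -> : m (C `*` D0) = \int[nu]_x phi x.
  rewrite mE// integral_mkcond; apply: eq_integral => x _; rewrite patchE /phi indicE.
  by case: ifP; rewrite ?mul1e ?mul0e.
rewrite muleC -(poisson_mecke malive mpts (mp_fin MP) exF (mp_poisson MP) sE phi0 mphi).
apply: eq_eseriesr => n _.
pose B := [set t | alive n t /\ E (atoms_del R alive pts n t : set X -> \bar R)].
have sB : <<s atoms_gen alive pts >> B by exact: atoms_gen_eval.
have mB : measurable B by apply: (measurable_atoms_gen malive mpts sB).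
transitivity (\int[P]_(t in chosen n) (\1_B t)%:E).
  rewrite integral_indic//; last exact: measurable_chosen.
  congr (P _); apply/seteqP; split => t /=; last by move=> [[_ Et] c].
  by move=> [Et c]; split => //; split => //; case: c.
rewrite integral_chosen//; last first.
  apply/measurable_EFinP.
  exact: (@measurable_indic _ Tat R setT B sB).
rewrite [RHS]integral_mkcond; apply: eq_integral => t _; rewrite patchE indicE.
rewrite mem_asbool; case: asboolP => [[alt _]|_]; last by rewrite mul0e.
by rewrite alt mul1e.
Qed.

(** By [peel_law] the remaining configuration has the law of the original one up to a factor, hence
    is Poisson. Its marks stay conditionally independent because the choice of atom [n] involves,
    besides the atoms, only the mark of [n], whose factor splits off the product. *)
Lemma peel_marked_poisson : marked_poisson Q alive' pts' A'.
Proof.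
have malive' := measurable_alive_slice malive.
have mpts' := measurable_pts_slice mpts.
have mA' k : measurable_fun setT (A' k).
  exact: measurableT_comp (mA k) measurable_fst.
have QT : Q setT = m (C `*` D0) * P setT.
  by apply: (@peel_law setT); rewrite -setC0; apply: sigma_algebraC; exact: sigma_algebra0.
have mfin : m (C `*` D0) < +oo by exact: marked_fin.
have Qoo : Q setT < +oo.
  rewrite QT; apply: lte_mul_pinfty => //; last exact: (mp_fin MP).
  by rewrite ge0_fin_numE.
split => //.
- have m0 : (0 <= fine (m (C `*` D0)))%R by rewrite fine_ge0.
  pose P2 : {measure set T -> \bar R} := mscale (NngNum m0) P.
  have P2E U : P2 U = m (C `*` D0) * P U.
    by rewrite -[in RHS](@fineK _ (m (C `*` D0))) ?ge0_fin_numE.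
  apply: (@poisson_eq_law _ _ _ _ _ _ _ _ _ P2 _ (atoms R alive pts)).
  + by move=> B mB; exact: measurable_atoms.
  + by move=> E sE; rewrite peel_law// P2E.
  + exact: poisson_mscale (mp_poisson MP).
- move=> h h0 mh n D DDD DT.
  have mh1 := measurable_fun_atoms_gen malive' mpts' mh.
  (* With the picked index fixed, an event of the remaining atoms is an event of all the atoms. *)
  have sec (B : set (T * nat)) k : <<s atoms_gen alive' pts' >> B ->
      <<s atoms_gen alive pts >> [set t | B (t, k)].
    apply: (@sigma_preimage _ _ (fun t => (t, k)) _ <<s atoms_gen alive pts >>).
      exact: smallest_sigma_algebra.
    move=> _ [j [B0 mB0 ->]]; rewrite (_ : _ @^-1` _ =
      if j != k then [set t | alive j t /\ B0 (pts j t)] else set0).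
      case: ifP => _; last exact: sigma_algebra0.
      by apply: sub_sigma_algebra; exists j, B0.
    apply/seteqP; split => t /=; rewrite /alive_slice /delete /pts_slice /=.
      by move=> [/andP[a ->] b].
    by case: ifP => // _ [-> b].
  have mhk k : measurable_fun setT ((fun t => h (t, k)) : Tat -> \bar R).
    move=> _ B mB; rewrite setTI.
    apply: (sec (h @^-1` B)).
    by have := mh measurableT B mB; rewrite setTI.
  have mmp : measurable_fun setT (mark_prob g alive' pts' D n : _ -> \bar R).
    by apply: (measurable_fun_atoms_gen malive' mpts'); exact: (atoms_gen_mark_prob g mDD n DDD).
  have mmpk k : measurable_fun setT ((fun t => mark_prob g alive' pts' D n (t, k)) : Tat -> \bar R).
    move=> _ B mB; rewrite setTI.
    apply: (sec (mark_prob g alive' pts' D n @^-1` B)).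
    by have := @atoms_gen_mark_prob _ _ _ _ _ g _ mDD _ _ alive' pts' _ n DDD measurableT _ mB; rewrite setTI.
  have mF' := measurable_marks mDD malive' mA' DDD.
  rewrite integral_mkcond integral_slice; last 2 first.
  + by move=> u; rewrite patchE; case: ifP.
  + by apply/(measurable_restrictT _ _).1 => //; exact: measurable_funTS.
  rewrite integral_slice; last 2 first.
  + by move=> u; rewrite mule_ge0// mark_prob_ge0.
  + exact: emeasurable_funM.
  apply: eq_eseriesr => k _.
  rewrite [RHS]integral_chosen; last 2 first.
  + by move=> t; rewrite mule_ge0// mark_prob_ge0.
  + exact: emeasurable_funM.
  (* One family for both conditions: [D0] for the picked mark, [D] for the others. Its bound [n1]
     must exceed [k], even when [D] constrains only smaller indices. *)
  pose D1 j := if j == k then D0 else D j.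
  have DD1 j : DD (D1 j) by rewrite /D1; case: ifP.
  pose n1 := maxn n k.+1.
  have D1T j : (n1 <= j)%N -> D1 j = setT.
    rewrite geq_max => /andP[nj kj]; rewrite /D1 gtn_eqF//; exact: DT.
  pose h1 t := h (t, k) * (if alive k t then (\1_C (pts k t))%:E else 0).
  have h10 t : 0 <= h1 t.
    by apply: mule_ge0 => //; case: ifP => // _; rewrite lee_fin.
  have mh1' : measurable_fun setT (h1 : Tat -> \bar R).
    apply: emeasurable_funM => //.
    apply: (@atoms_gen_comp _ _ _ _ _ _ _ _ (fun x => (\1_C x)%:E)).
    by apply/measurable_EFinP; exact: measurable_indic.
  have := mp_marked MP h10 mh1' DD1 D1T.
  rewrite (_ : \int[P]_(t in _) h1 t = \int[P]_(t in chosen k)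
     ((h \_ [set u | forall j, alive' j u -> D j (A' j u)]) (t, k))); last first.
    rewrite integral_mkcond [RHS]integral_mkcond; apply: eq_integral => t _.
    rewrite !patchE !mem_asbool.
    case: asboolP => [p1|p1]; case: asboolP => [p2|p2] //.
    * have [alt Ct _] := p2; rewrite asboolT /h1 ?alt ?indicE ?mem_set ?mule1//.
      move=> j; rewrite /alive_slice /delete /A' /= => /andP[alj jk].
      by have := p1 j alj; rewrite /D1 (negbTE jk).
    * rewrite /h1; case: ifPn => alt; last by rewrite mule0.
      have [Ct|nCt] := pselect (C (pts k t)); last by rewrite indicE memNset// mule0.
      case: p2; split => //.
      by have := p1 k alt; rewrite /D1 eqxx.
    * have [alt Ct Dt] := p2; case: asboolP => // p3; case: p1 => j alj.
      rewrite /D1; case: eqP => [->//|/eqP jk].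
      by apply: p3; rewrite /alive_slice /delete /= alj.
  move=> ->; apply: eq_integral => t _; rewrite /h1 -!muleA; congr (_ * _).
  case: ifPn => alt; last by rewrite mul0e mule0.
  rewrite [RHS]muleCA; congr (_ * _).
  rewrite (mark_prob_widen g alive' pts' (t, k) (leq_maxl n k.+1) DT).
  rewrite /mark_prob -/n1.
  have kn1 : (k < n1)%N by rewrite leq_max ltnSn orbT.
  rewrite (bigD1 (Ordinal kn1))//= [in RHS](bigD1 (Ordinal kn1))//=.
  rewrite alt {1}/D1 eqxx /alive_slice /delete /= eqxx andbF mul1e muleC.
  congr (_ * _); apply: eq_bigr => j jk.
  have jk' : (j != k :> nat) by [].
  by rewrite /D1 (negbTE jk') andbT.
Qed.

End peel.
End marked_poisson.

(** * The space of set functions and its measurable functionals *)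

Section paths.
Context (R : realType) d (X : measurableType d).
Import HBNNSimple.

Definition eval_gen : set (set (set X -> \bar R)) :=
  [set E | exists2 A, measurable A & exists2 C : set (\bar R), measurable C &
        E = [set m : set X -> \bar R | C (m A)]].
Definition path := g_sigma_algebraType eval_gen.

Lemma eval_sigmaT : @eval_sigma R _ X setT.
Proof. by rewrite -setC0; apply: sigma_algebraC; exact: sigma_algebra0. Qed.

Lemma measurable_path_eval A : measurable A ->
  measurable_fun setT ((fun m => m A) : path -> \bar R).
Proof.
move=> mA _ C mC; rewrite setTI; apply: sub_sigma_algebra.
by exists A => //; exists C.
Qed.

Lemma measurable_expeR : measurable_fun setT (@expeR R).
Proof.
apply: (measurability (ErealGenOInfty.G (R := R))).
  exact: ErealGenOInfty.measurableE.
move=> _ [_ [r ->] <-]; rewrite setTI.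
have [r0|r0] := ltP r 0%R.
  rewrite (_ : _ @^-1` _ = setT)//; apply/seteqP; split => // x _ /=.
  by rewrite in_itv/= andbT (lt_le_trans _ (expeR_ge0 x)).
have r0' : 0 <= r%:E by rewrite lee_fin.
have [y yr] := expeR_total r0'.
rewrite -yr (_ : _ @^-1` _ = `]y, +oo[%classic).
  exact: emeasurable_itv.
by apply/seteqP; split => x /=; rewrite !in_itv/= !andbT lte_expeR.
Qed.

(* [I] extends the integral to all set functions. *)
Lemma eval_integral (f : X -> \bar R) : (forall x, 0 <= f x) ->
  measurable_fun setT f ->
  exists I : (set X -> \bar R) -> \bar R,
    measurable_fun setT (I : path -> \bar R) /\
    forall mu : {measure set X -> \bar R}, I mu = \int[mu]_x f x.
Proof.
move=> f0 mf; pose f_ := nnsfun_approx measurableT mf.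
(* For a measure these sums increase to the integral. For other set functions they may fail to
   converge, hence the upper limit, which is always measurable. *)
exists (fun m => limn_esup (fun n =>
  \sum_(y \in range (f_ n)) y%:E * m (f_ n @^-1` [set y]))); split.
  apply: measurable_fun_limn_esup => n.
  apply: emeasurable_fsum; first exact: fimfunP.
  by move=> y; apply: measurable_funeM; exact: measurable_path_eval.
move=> mu.
have nd x : nondecreasing_seq (f_ ^~ x).
  by move=> a b ab; exact/lefP/nd_nnsfun_approx.
have e n : \sum_(y \in range (f_ n)) y%:E * mu (f_ n @^-1` [set y]) =
    \int[mu]_x (f_ n x)%:E.
  by rewrite integralT_nnsfun sintegralE.
under eq_fun do rewrite e.
have -> : \int[mu]_x f x = limn (fun n => \int[mu]_x (f_ n x)%:E).
  rewrite (@nd_ge0_integral_lim _ _ _ mu f f_)//; last by move=> x; exact: cvg_nnsfun_approx.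
  by congr (limn _); apply/funext => n /=; rewrite integralT_nnsfun.
apply: is_cvg_limn_esupE; apply: ereal_nondecreasing_is_cvgn => a b ab.
apply: ge0_le_integral => //.
- by move=> x _; rewrite lee_fin.
- by apply/measurable_EFinP.
- by apply/measurable_EFinP.
- by move=> x _; rewrite lee_fin; exact: nd.
Qed.

Lemma path_integral d1 (T1 : measurableType d1) d2 (T2 : measurableType d2)
    (P1 : {measure set T1 -> \bar R}) (P2 : {measure set T2 -> \bar R})
    (Y1 : T1 -> set X -> \bar R) (Y2 : T2 -> set X -> \bar R) (c : {nonneg R})
    (h : (set X -> \bar R) -> \bar R) :
  (forall A, measurable A -> measurable_fun setT (Y1 ^~ A)) ->
  (forall A, measurable A -> measurable_fun setT (Y2 ^~ A)) ->
  (forall E, eval_sigma E ->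
    P1 [set t | E (Y1 t)] = c%:num%:E * P2 [set t | E (Y2 t)]) ->
  (forall m, 0 <= h m) -> measurable_fun setT (h : path -> \bar R) ->
  \int[P1]_t h (Y1 t) = c%:num%:E * \int[P2]_t h (Y2 t).
Proof.
move=> mY1 mY2 e h0 mh.
have mp d0 (T0 : measurableType d0) (Y : T0 -> set X -> \bar R) :
    (forall A, measurable A -> measurable_fun setT (Y ^~ A)) ->
    measurable_fun setT (Y : T0 -> path).
  by move=> mY _ E sE; rewrite setTI; exact: measurable_eval_sigma.
have mY1' := mp _ _ _ mY1; have mY2' := mp _ _ _ mY2.
transitivity (\int[push P1 mY1']_m h m); first by rewrite integral_push.
rewrite -(integral_push P2 mY2' h0 mh).
rewrite -(ge0_integral_mscale _ measurableT c mh)//.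
by apply: eq_measure_integral => E mE _; exact: e.
Qed.

End paths.

Section lne_conf.
Context (R : realType).

Lemma measurable_lne : measurable_fun setT (@lne R).
Proof.
apply: (measurability (ErealGenOInfty.G (R := R))).
  exact: ErealGenOInfty.measurableE.
move=> _ [_ [r ->] <-]; rewrite setTI.
rewrite (_ : _ @^-1` _ = `](expeR r%:E), +oo[%classic).
  exact: emeasurable_itv.
apply/seteqP; split => x /=; rewrite !in_itv/= !andbT.
  have [x0|x0] := leP 0 x.
    by rewrite -lte_expeR lneK// in_itv/= x0 leey.
  by rewrite le0_lneNy ?ltW.
move=> h; have x0 : 0 <= x by rewrite (le_trans _ (ltW h))// expeR_ge0.
by rewrite -lte_expeR lneK// in_itv/= x0 leey.
Qed.

Lemma integral_conf d (X : measurableType d) (al : nat -> bool) (x : nat -> X)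
    (f : X -> \bar R) : (forall x, 0 <= f x) -> measurable_fun setT f ->
  \int[conf R al x]_y f y = \sum_(k <oo) (if al k then f (x k) else 0).
Proof.
move=> f0 mf; rewrite ge0_integral_measure_series//; apply: eq_eseriesr => k _.
case: (al k); last by rewrite integral_measure_zero.
by rewrite integral_dirac// diracT mul1e.
Qed.

End lne_conf.

(** * Conditional void probabilities *)

Section void.
Context (R : realType) d (X : measurableType d) dW (W : measurableType dW).
Variables (g : R.-pker X ~> W) (DD : set (set W)).
Hypotheses (mDD : DD `<=` measurable) (DDT : DD setT).
Variable D1 : set W.
Hypothesis DD1 : DD D1.

(** The logarithm turns the product of the probabilities [g x D1] over the atoms into an integral
    against the configuration; its value is [+oo] where [g x D1] is [0]. *)
Definition loss x : \bar R := - lne (g x D1).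

Lemma loss_ge0 x : 0 <= loss x.
Proof.
rewrite oppe_ge0 lne_le0 -(@prob_kernel _ _ _ _ _ g x).
by apply: le_measure; rewrite ?inE//; exact: mDD.
Qed.

Lemma measurable_loss : measurable_fun setT loss.
Proof.
apply: measurableT_comp => //.
by apply: (measurableT_comp (@measurable_lne R)); apply: measurable_kernel; exact: mDD.
Qed.

Lemma expeR_loss x : expeR (- loss x) = g x D1.
Proof. by rewrite oppeK lneK// in_itv/= leey andbT. Qed.

Definition void_marks d' (T : measurableType d') (alive : nat -> T -> bool)
    (A : nat -> T -> W) : set T := [set t | forall k, alive k t -> D1 (A k t)].

(** On measures, [L] is the exponential of minus the integral of [loss]: the conditional
    probability, given the configuration, that all marks lie in [D1]. The order of the quantifiers
    matters: one [L] serves all processes with mark kernel [g], so that an equality between laws of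
    configurations carries over to void events. *)
Lemma void_probability :
  exists L : (set X -> \bar R) -> \bar R,
  [/\ forall mu, 0 <= L mu, measurable_fun setT (L : path R X -> \bar R) &
  forall d' (T : measurableType d') (P : {measure set T -> \bar R})
    (alive : nat -> T -> bool) (pts : nat -> T -> X) (A : nat -> T -> W),
    P setT < +oo -> (forall k, measurable_fun setT (alive k)) ->
    (forall k, measurable_fun setT (pts k)) ->
    (forall k, measurable_fun setT (A k)) -> marked g DD P alive pts A ->
    forall E, eval_sigma E ->
    P (void_marks alive A `&` [set t | E (atoms R alive pts t : set X -> \bar R)]) =
    \int[P]_t ((\1_E (atoms R alive pts t : set X -> \bar R))%:E *
               L (atoms R alive pts t))].
Proof.
have [I [mI IE]] := eval_integral loss_ge0 measurable_loss.
exists (fun m => expeR (- I m)); split.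
- by move=> mu; exact: expeR_ge0.
- by apply: (measurableT_comp (@measurable_expeR R)); exact: measurableT_comp.
move=> d' T P alive pts A Poo malive mpts mA mk E sE.
pose B := [set t | E (atoms R alive pts t : set X -> \bar R)].
have sB : <<s atoms_gen alive pts >> B.
  apply: (@eval_sigma_preimage _ _ _ _ _ (fun t => atoms R alive pts t : set X -> \bar R) _ _ _ sE).
    exact: smallest_sigma_algebra.
  move=> B0 C mB0 mC.
  have mm : measurable_fun setT ((fun t => atoms R alive pts t B0)
      : g_sigma_algebraType (atoms_gen alive pts) -> \bar R).
    under eq_fun do rewrite /atoms confE.
    apply: ge0_emeasurable_sum => // k _.
    rewrite (_ : (fun _ => _) = (fun t => if alive k t then
      (pts k t \in B0)%:R%:E else 0)).
      apply: (@atoms_gen_comp _ _ _ _ _ _ _ _ (fun x => (x \in B0)%:R%:E)).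
      by apply/measurable_EFinP; exact: measurable_indic.
    by apply/funext => t; case: (alive k t).
  by have := mm measurableT C mC; rewrite setTI.
have mB := measurable_atoms_gen malive mpts sB.
pose D n k := if (k < n)%N then D1 else setT.
have DDD n k : DD (D n k) by rewrite /D; case: ifP.
pose S n := [set t | forall k, alive k t -> D n k (A k t)].
have mS n : measurable (S n) by exact: (measurable_marks mDD malive mA (DDD n)).
have mV : measurable (void_marks alive A).
  exact: (measurable_marks mDD malive mA (fun=> DD1)).
have m1B : measurable_fun setT (fun t => (\1_B t)%:E : \bar R).
  by apply/measurable_EFinP; exact: measurable_indic.
have PS n : P (S n `&` B) = \int[P]_t ((\1_B t)%:E * mark_prob g alive pts (D n) n t).
  rewrite -(mk (fun t => (\1_B t)%:E) _ _ n (D n))//.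
  - by rewrite integral_indic//; [rewrite setIC|exact: (mS n)].
  - apply/measurable_EFinP.
    exact: (@measurable_indic _ (g_sigma_algebraType (atoms_gen alive pts)) R setT B sB).
  - by move=> k nk; rewrite /D ltnNge nk.
have c1 : P (S n `&` B) @[n --> \oo] --> P (void_marks alive A `&` B).
  rewrite (_ : void_marks alive A `&` B = \bigcap_n (S n `&` B)); last first.
    apply/seteqP; split => t.
      move=> [h Bt] n _; split => // k alk; rewrite /D.
      by case: ifP => // _; exact: h.
    move=> h; split; last by have [] := h 0%N Logic.I.
    by move=> k alk; have [+ _] := h k.+1 Logic.I; move/(_ k alk); rewrite /D ltnSn.
  apply: nonincreasing_cvg_mu.
  - by apply: (le_lt_trans _ Poo); apply: le_measure; rewrite ?inE//; exact: measurableI.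
  - by move=> n; exact: measurableI.
  - by apply: bigcapT_measurable => n; exact: measurableI.
  - move=> m n mn; apply/subsetPset; apply: setSI => t h k alk.
    have := h k alk; rewrite /D; case: (ltnP k m) => // km.
    by rewrite (leq_trans km mn).
pose s t n := \sum_(0 <= k < n) (if alive k t then loss (pts k t) else 0).
have s0 t k : 0 <= (if alive k t then loss (pts k t) else 0).
  by case: ifP => // _; exact: loss_ge0.
have mpE n t : mark_prob g alive pts (D n) n t = expeR (- s t n).
  rewrite /mark_prob /s big_mkord.
  have -> : \prod_(k < n) (if alive k t then g (pts k t) (D n k) else 1) =
      \prod_(k < n) expeR (- (if alive k t then loss (pts k t) else 0)).
    apply: eq_bigr => k _; rewrite /D ltn_ord.
    by case: ifP => _; rewrite ?expeR_loss// oppe0 expeR0.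
  elim: n => [|n IH]; first by rewrite !big_ord0 oppe0 expeR0.
  rewrite !big_ord_recr/= IH -expeRD oppeD//.
  by apply: ge0_adde_def; rewrite inE ?sume_ge0.
have sI t : I (atoms R alive pts t) = limn (s t).
  by rewrite IE integral_conf//; [exact: loss_ge0|exact: measurable_loss].
have nds t : nondecreasing_seq (s t).
  by move=> a b ab; apply: lee_sum_nneg_natr.
(* Continuity of [expeR] along an increasing sequence whose limit may be [+oo]. *)
have cvp t : expeR (- s t n) @[n --> \oo] --> expeR (- limn (s t)).
  have cs : cvgn (s t) by exact: ereal_nondecreasing_is_cvgn.
  have les n : s t n <= limn (s t).
    by apply: lime_ge => //; exists n => // k /= nk; exact: nds.
  have ni : nonincreasing_seq (fun n => expeR (- s t n)).
    by move=> a b ab; rewrite lee_expeR leeN2; exact: nds.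
  have ce := ereal_nonincreasing_is_cvgn ni.
  suff <- : limn (fun n => expeR (- s t n)) = expeR (- limn (s t)) by exact: ce.
  apply/eqP; rewrite eq_le; apply/andP; split; last first.
    by apply: lime_ge => //; near=> n; rewrite lee_expeR leeN2.
  have L0 : 0 <= limn (fun n => expeR (- s t n)).
    by apply: lime_ge => //; near=> n; exact: expeR_ge0.
  have [y yE] := expeR_total L0; rewrite -yE lee_expeR leeNr.
  apply: lime_le => //; near=> n; rewrite leeNr -lee_expeR yE.
  by apply: lime_le => //; near=> k; apply: ni; near: k; exists n.
have c2 : \int[P]_t ((\1_B t)%:E * mark_prob g alive pts (D n) n t) @[n --> \oo] -->
    \int[P]_t ((\1_B t)%:E * expeR (- I (atoms R alive pts t))).
  have mmp n : measurable_fun setT (fun t => (\1_B t)%:E * mark_prob g alive pts (D n) n t).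
    apply: emeasurable_funM => //.
    by apply: (measurable_fun_atoms_gen malive mpts); exact: (atoms_gen_mark_prob g mDD n (DDD n)).
  have mlim : measurable_fun setT (fun t => (\1_B t)%:E * expeR (- I (atoms R alive pts t))).
    apply: emeasurable_funM => //; apply: (measurableT_comp (@measurable_expeR R)).
    apply: measurableT_comp => //; apply: (measurableT_comp mI (g := fun t => (atoms R alive pts t : path R X))).
    move=> _ E0 sE0; rewrite setTI.
    apply: (@measurable_eval_sigma _ _ _ _ _ (fun t => atoms R alive pts t : set X -> \bar R) _ _ sE0).
    by move=> B0 mB0; exact: measurable_atoms.
  have mp1 n t : `|(\1_B t)%:E * mark_prob g alive pts (D n) n t| <= 1.
    rewrite gee0_abs; last by rewrite mule_ge0 ?lee_fin// mark_prob_ge0.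
    have e1 : mark_prob g alive pts (D n) n t <= 1.
      by rewrite mpE -expeR0 lee_expeR oppe_le0 sume_ge0.
    have i0 : 0 <= (\1_B t)%:E :> \bar R by rewrite lee_fin.
    have i1 : (\1_B t)%:E <= 1 :> \bar R.
      by rewrite lee_fin indicE; case: (_ \in _).
    by rewrite -[leRHS]mule1; apply: lee_pmul => //; exact: mark_prob_ge0.
  have h1 : {ae P, forall t, setT t ->
      ((\1_B t)%:E * mark_prob g alive pts (D n) n t) @[n --> \oo] -->
      (\1_B t)%:E * expeR (- I (atoms R alive pts t))}.
    apply: nearW => t _; rewrite indicE; case: (t \in B).
      under eq_fun do rewrite mul1e mpE.
      by rewrite mul1e sI; exact: cvp.
    by under eq_fun do rewrite mul0e; rewrite mul0e; exact: cvg_cst.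
  have h2 : P.-integrable setT (cst 1).
    apply/integrableP; split; first exact: measurable_cst.
    by under eq_integral do rewrite abse1; rewrite integral_cst// mul1e.
  have h3 : {ae P, forall t, forall n, setT t ->
      `|(\1_B t)%:E * mark_prob g alive pts (D n) n t| <= cst 1 t}.
    by apply: nearW => t n _; exact: mp1.
  by have [] := dominated_convergence measurableT mmp mlim h1 h2 h3.
move: c1; rewrite (_ : (fun n => P (S n `&` B)) = fun n => \int[P]_t ((\1_B t)%:E * mark_prob g alive pts (D n) n t)); last exact/funext.
by move=> c1; exact: (cvg_unique _ c1 c2).
Unshelve. all: by end_near. Qed.

End void.

Section countable_sums.
Context (R : realType).

Lemma esum_fin (I : finType) (a : I -> \bar R) : (forall i, 0 <= a i) ->
  \esum_(i in [set: I]) a i = \sum_i a i.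
Proof.
move=> a0; rewrite esum_fset//; last exact: finite_finset.
rewrite (@fsbigE _ _ _ _ _ (index_enum I)) ?index_enum_uniq//.
  by apply: eq_bigl => i; rewrite in_setT.
by move=> i _; rewrite mem_index_enum.
Qed.

Lemma esum_pickle (I : countType) (a : I -> \bar R) : (forall i, 0 <= a i) ->
  \esum_(i in [set: I]) a i =
  \sum_(j <oo) (if @pickle_inv I j is Some i then a i else 0).
Proof.
move=> a0.
pose b (j : nat) : \bar R := if @pickle_inv I j is Some i then a i else 0.
have b0 j : 0 <= b j by rewrite /b; case: (@pickle_inv I j).
rewrite -/(b _) (nneseries_esumT b0).
transitivity (\esum_(j in [set pickle i | i in [set: I]]) b j).
  rewrite esum_image; last by move=> i j _ _; exact: (pcan_inj pickleK).
  by apply: eq_esum => i _; rewrite /b pickleK_inv.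
rewrite esum_mkcond; apply: eq_esum => j _; rewrite mem_asbool.
case: asboolP => // h; rewrite /b; case E : pickle_inv => [i|//].
case: h; exists i => //.
by have := @pickle_invK I j; rewrite E.
Qed.

Lemma esum_seq (a : seq nat -> \bar R) : (forall s, 0 <= a s) ->
  \esum_(s in [set: seq nat]) a s =
  a [::] + \sum_(n <oo) \esum_(s in [set: seq nat]) a (n :: s).
Proof.
move=> a0; rewrite (esumID [set [::]])//; congr (_ + _).
  by rewrite setTI esum_set1.
rewrite setTI nneseries_esumT; last by move=> n; exact: esum_ge0.
rewrite (esum_esum (a := fun n s => a (n :: s)))//.
rewrite -(@esum_image R _ _ ([set: nat] `*`` (fun=> [set: seq nat]))
  (fun p => p.1 :: p.2) a).
  congr esum; apply/seteqP; split => [[|n s] //= h|].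
    by exists (n, s).
  by move=> _ [[n s] _ <-].
by move=> [n s] [n' s'] _ _ /= [-> ->].
Qed.

Lemma measurable_esum d (T : measurableType d) (I : countType) (a : I -> T -> \bar R) :
  (forall i t, 0 <= a i t) -> (forall i, measurable_fun setT (a i)) ->
  measurable_fun setT (fun t => \esum_(i in [set: I]) a i t).
Proof.
move=> a0 ma; under eq_fun do rewrite esum_pickle//.
apply: ge0_emeasurable_sum => [j t _ _|j _]; first by case: pickle_inv.
by case: pickle_inv => // *; exact: measurable_cst.
Qed.

Lemma integral_esum d (T : measurableType d) (P : {measure set T -> \bar R})
    (I : countType) (a : I -> T -> \bar R) :
  (forall i t, 0 <= a i t) -> (forall i, measurable_fun setT (a i)) ->
  \int[P]_t (\esum_(i in [set: I]) a i t) = \esum_(i in [set: I]) \int[P]_t a i t.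
Proof.
move=> a0 ma; rewrite esum_pickle; last by move=> i; exact: integral_ge0.
under eq_integral do rewrite esum_pickle//.
rewrite integral_nneseries//.
- apply: eq_eseriesr => j _; case: pickle_inv => //.
  by rewrite integral0.
- by move=> j; case: pickle_inv => // *; exact: measurable_cst.
- by move=> j t _; case: pickle_inv.
Qed.

End countable_sums.

(** * The iterated Mecke formula *)

Section kfold.
Context (R : realType) d (X : measurableType d) dW (W : measurableType dW).
Variables (g : R.-pker X ~> W) (DD : set (set W)).
Hypotheses (mDD : DD `<=` measurable) (DDT : DD setT) (DDI : setI_closed DD)
  (DDgen : measurable = <<s DD >>).
Variables (nu : {measure set X -> \bar R}) (F : nat -> set X).
Hypothesis exF : exhausts nu F.
Variable m : {measure set (X * W) -> \bar R}.
Hypothesis mE : forall C D, measurable C -> DD D ->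
  m (C `*` D) = \int[nu]_(x in C) g x D.
Variable D1 : set W.
Hypothesis DD1 : DD D1.
Variable E : set (set X -> \bar R).
Hypothesis sE : eval_sigma E.
Local Notation marked_poisson := (marked_poisson g DD nu).

Definition void_conf (al : nat -> bool) (x : nat -> X) (a : nat -> W) : Prop :=
  (forall k, al k -> D1 (a k)) /\ E (conf R al x : set X -> \bar R).

(** The weight of one list of indices. Each listed atom is deleted before the rest is evaluated, so
    a list with a repetition has weight [0] and the final test concerns the other atoms. Lists of
    the wrong length have weight [0] as well. *)
Fixpoint pick_sum (phis : seq (X * W -> \bar R)) (al : nat -> bool)
    (x : nat -> X) (a : nat -> W) (es : seq nat) : \bar R :=
  match phis, es with
  | [::], [::] => `[< void_conf al x a >]%:R%:E
  | phi :: phis', n :: es' =>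
      (if al n then phi (x n, a n) else 0) * pick_sum phis' (delete al n) x a es'
  | _, _ => 0
  end.

Definition pick_int d' (T : measurableType d') (P : {measure set T -> \bar R}) alive pts A phis :=
  \esum_(es in [set: seq nat])
    \int[P]_t pick_sum phis (alive ^~ t) (pts ^~ t) (A ^~ t) es.

Lemma pick_sum_ge0 phis al x a es : (forall phi, List.In phi phis -> forall y, 0 <= phi y) ->
  0 <= pick_sum phis al x a es.
Proof.
elim: phis al es => [|phi phis IH] al [|n es] //= h; rewrite ?lee_fin//.
apply: mule_ge0; first by case: ifP => // _; apply: h; left.
by apply: IH => psi hpsi; apply: h; right.
Qed.

Lemma void_confE d' (T : measurableType d') (alive : nat -> T -> bool) pts A :
  [set t | void_conf (alive ^~ t) (pts ^~ t) (A ^~ t)] =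
  void_marks D1 alive A `&` [set t | E (atoms R alive pts t : set X -> \bar R)].
Proof. by []. Qed.

Lemma measurable_void_conf d' (T : measurableType d') (alive : nat -> T -> bool) pts A :
  (forall k, measurable_fun setT (alive k)) ->
  (forall k, measurable_fun setT (pts k)) ->
  (forall k, measurable_fun setT (A k)) ->
  measurable [set t | void_conf (alive ^~ t) (pts ^~ t) (A ^~ t)].
Proof.
move=> malive mpts mA; rewrite void_confE; apply: measurableI.
  exact: (measurable_marks mDD malive mA (fun=> DD1)).
by apply: measurable_eval_sigma => // B mB; exact: measurable_atoms.
Qed.

Lemma measurable_pick_sum d' (T : measurableType d') (alive : nat -> T -> bool) pts A phis es :
  (forall k, measurable_fun setT (alive k)) ->
  (forall k, measurable_fun setT (pts k)) ->
  (forall k, measurable_fun setT (A k)) ->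
  (forall phi, List.In phi phis -> measurable_fun setT phi) ->
  measurable_fun setT (fun t => pick_sum phis (alive ^~ t) (pts ^~ t) (A ^~ t) es).
Proof.
move=> + mpts mA; elim: phis es alive => [|phi phis IH] [|n es] alive malive mphi /=.
- rewrite (_ : (fun _ => _) =
    fun t => (\1_[set t | void_conf (alive ^~ t) (pts ^~ t) (A ^~ t)] t)%:E).
    by apply/measurable_EFinP; apply: measurable_indic; exact: measurable_void_conf.
  by apply/funext => t; rewrite indicE mem_asbool.
- exact: measurable_cst.
- exact: measurable_cst.
- apply: emeasurable_funM.
    apply: measurable_fun_ifT => //.
    apply: measurableT_comp; first by apply: mphi; left.
    exact: measurable_fun_pair.
  apply: (IH es (fun k t => delete (alive ^~ t) n k)).
    by move=> k; exact: measurable_delete.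
  by move=> psi hpsi; apply: mphi; right.
Qed.

(** By [void_probability] both sides are integrals of one functional of the configuration, and by
    [peel_law] the two laws are proportional. *)
Lemma peel_void d' (T : measurableType d') (P : {measure set T -> \bar R}) alive pts A
    (MP : marked_poisson P alive pts A) C D0 (mC : measurable C)
    (nuC : nu C < +oo) (DD0 : DD D0) :
  slice P (measurable_chosen mDD MP mC DD0)
    [set u | void_conf (alive_slice alive ^~ u) (pts_slice pts ^~ u) (fun k => A k u.1)] =
  m (C `*` D0) * P [set t | void_conf (alive ^~ t) (pts ^~ t) (A ^~ t)].
Proof.
have [L [L0 mL LE]] := void_probability g mDD DDT DD1.
have MP' := peel_marked_poisson mDD DDT exF mE MP mC nuC DD0.
have mfin : m (C `*` D0) < +oo by exact: (marked_fin mDD mE mC nuC DD0).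
have m0 : (0 <= fine (m (C `*` D0)))%R by rewrite fine_ge0.
have mfE : m (C `*` D0) = (fine (m (C `*` D0)))%:E by rewrite fineK// ge0_fin_numE.
rewrite [X in slice _ _ X](_ : _ = void_marks D1 (alive_slice alive) (fun k u => A k u.1)
  `&` [set u | E (atoms R (alive_slice alive) (pts_slice pts) u : set X -> \bar R)])//.
rewrite (LE _ _ _ _ (pts_slice pts))//; try by case: MP'.
rewrite void_confE (LE _ _ P)//; try by case: MP.
rewrite [in RHS]mfE.
apply: (path_integral (c := NngNum m0) (h := fun m0 => (\1_E m0)%:E * L m0)
  (Y1 := fun u => atoms R (alive_slice alive) (pts_slice pts) u)
  (Y2 := fun t => atoms R alive pts t)).
- by move=> B mB; apply: measurable_atoms; [exact: mp_alive MP'|exact: mp_pts MP'|].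
- by move=> B mB; apply: measurable_atoms; [exact: mp_alive MP|exact: mp_pts MP|].
- by move=> E0 sE0; rewrite /= -mfE; exact: (peel_law mDD DDT exF mE MP).
- by move=> mu; rewrite mule_ge0// lee_fin.
- apply: emeasurable_funM => //; apply/measurable_EFinP.
  exact: (@measurable_indic _ (path R X) R setT E sE).
all: by clear MP'; case: MP.
Qed.

End kfold.

Section kfold_main.
Context (R : realType) d (X : measurableType d) dW (W : measurableType dW).
Variables (g : R.-pker X ~> W) (DD : set (set W)).
Hypotheses (mDD : DD `<=` measurable) (DDT : DD setT) (DDI : setI_closed DD)
  (DDgen : measurable = <<s DD >>).
Variables (nu : {measure set X -> \bar R}) (F : nat -> set X).
Hypothesis exF : exhausts nu F.
Variable m : {measure set (X * W) -> \bar R}.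
Hypothesis mE : forall C D, measurable C -> DD D ->
  m (C `*` D) = \int[nu]_(x in C) g x D.

Definition mrects : set (set (X * W)) :=
  [set B | exists C D, [/\ measurable C, exists p, C `<=` F p, DD D & B = C `*` D]].

Lemma mrects_setI : setI_closed mrects.
Proof.
move=> _ _ [C [D [mC [p Cp] DDD ->]]] [C' [D' [mC' [p' Cp'] DDD' ->]]].
exists (C `&` C'), (D `&` D'); split.
- exact: measurableI.
- by exists p; apply: subset_trans Cp; exact: subIsetl.
- exact: DDI.
- by rewrite setXI.
Qed.

Lemma measurable_mrects : measurable = <<s mrects >>.
Proof.
have [mF ndF FT Foo] := exF.
have sG : sigma_algebra setT <<s mrects >> by exact: smallest_sigma_algebra.
apply/seteqP; split.
  rewrite measurable_prod_measurableType; apply: smallest_sub => //.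
  move=> _ [A mA [B mB <-]].
  rewrite (_ : A `*` B = (fst @^-1` A) `&` (snd @^-1` B)); last first.
    by apply/seteqP; split => -[].
  apply: sigma_algebra_setI.
    rewrite (_ : _ @^-1` _ = \bigcup_p ((A `&` F p) `*` setT)).
      apply: sigma_algebra_bigcup => p; apply: sub_sigma_algebra.
      exists (A `&` F p), setT; split => //; first exact: measurableI.
      by exists p; exact: subIsetr.
    apply/seteqP; split => [[x w] /= Ax|[x w] [p _ [[Ax _] _]]//].
    have : (\bigcup_p F p) x by rewrite FT.
    by move=> [p _ Fx]; exists p.
  move: mB; rewrite DDgen; apply: (sigma_preimage (f := @snd X W) sG).
  move=> D DDD; rewrite (_ : _ @^-1` _ = \bigcup_p (F p `*` D)).
    apply: sigma_algebra_bigcup => p; apply: sub_sigma_algebra.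
    by exists (F p), D; split => //; exists p.
  apply/seteqP; split => [[x w] /= Dw|[x w] [p _ [_ Dw]]//].
  have : (\bigcup_p F p) x by rewrite FT.
  by move=> [p _ Fx]; exists p.
apply: smallest_sub; first exact: sigma_algebra_measurable.
move=> _ [C [D [mC _ DDD ->]]]; apply: measurableX => //; exact: mDD.
Qed.

Lemma mrects_measure_unique (m1 m2 : {measure set (X * W) -> \bar R}) :
  (forall p, m1 (F p `*` setT) < +oo) ->
  (forall C D, measurable C -> (exists p, C `<=` F p) -> DD D ->
    m1 (C `*` D) = m2 (C `*` D)) ->
  forall B, measurable B -> m1 B = m2 B.
Proof.
move=> m1F m12 B mB; have [mF ndF FT Foo] := exF.
apply: (measure_unique mrects (fun p => F p `*` setT)) => //.
- exact: measurable_mrects.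
- exact: mrects_setI.
- by move=> p; exists (F p), setT; split => //; exists p.
- apply/seteqP; split => // -[x w] _.
  have : (\bigcup_p F p) x by rewrite FT.
  by move=> [p _ Fx]; exists p.
- by move=> _ [C [D [mC Cp DDD ->]]]; exact: m12.
Qed.

Variable D1 : set W.
Hypothesis DD1 : DD D1.
Variable E : set (set X -> \bar R).
Hypothesis sE : eval_sigma E.

Local Notation void t alive pts A := (void_conf D1 E (alive ^~ t) (pts ^~ t) (A ^~ t)).

(* The phis are integrated one at a time: by Mecke's formula and the peeled
   process, the first factor is a measure in phi, known on rectangles. *)
Lemma multivariate_mecke (phis : seq (X * W -> \bar R)) :
  (forall phi, List.In phi phis -> [/\ forall y, 0 <= phi y,
     measurable_fun setT phi & \int[m]_y phi y < +oo]) ->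
  forall d' (T : measurableType d') (P : {measure set T -> \bar R}) alive pts A,
  marked_poisson g DD nu P alive pts A ->
  pick_int D1 E P alive pts A phis =
  (\prod_(phi <- phis) \int[m]_y phi y) * P [set t | void t alive pts A].
Proof.
elim: phis => [_|phi phis IH hphi] d' T P alive pts A MP.
  have mv := measurable_void_conf mDD DD1 sE (mp_alive MP) (mp_pts MP) (mp_marks MP).
  rewrite /pick_int esum_seq; last first.
    by move=> es; apply: integral_ge0 => t _; exact: pick_sum_ge0.
  rewrite [X in _ + X]eseries0 ?adde0; last first.
    by move=> n _ _; apply: esum1 => es _ /=; rewrite integral0.
  rewrite big_nil mul1e /=.
  rewrite -(setIT [set t | void t alive pts A]) -integral_indic//; exact: eq_integral.
have [phi0 mphi ophi] : [/\ forall y, 0 <= phi y,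
     measurable_fun setT phi & \int[m]_y phi y < +oo] by apply: hphi; left.
have hphis psi : List.In psi phis -> [/\ forall y, 0 <= psi y,
     measurable_fun setT psi & \int[m]_y psi y < +oo] by move=> h; apply: hphi; right.
have {}IH := IH hphis.
have malive := mp_alive MP; have mpts := mp_pts MP; have mA := mp_marks MP.
pose h n es t := if alive n t
  then pick_sum D1 E phis (delete (alive ^~ t) n) (pts ^~ t) (A ^~ t) es else 0.
have ps0 al x a es : 0 <= pick_sum D1 E phis al x a es.
  by apply: pick_sum_ge0 => psi /hphis[].
have h0 n es t : 0 <= h n es t by rewrite /h; case: ifP.
have mh n es : measurable_fun setT (h n es).
  apply: measurable_fun_ifT => //.
  apply: (measurable_pick_sum mDD DD1 sE (alive := fun k t => delete (alive ^~ t) n k)) => //.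
    by move=> k; exact: measurable_delete.
  by move=> psi /hphis[].
have my n : measurable_fun setT (fun t => (pts n t, A n t)) by exact: measurable_fun_pair.
(* A measure that represents the left side as a function of the first test function: the sum, over
   the picked index [n] and the rest [es] of the list, of the image under [(pts n, A n)] of the
   density [h n es]. *)
pose mu : {measure set (X * W) -> \bar R} := mseries (fun n => mseries (fun j =>
  if @pickle_inv (seq nat) j is Some es
  then push (density P (h0 n es) (mh n es)) (my n) else mzero) 0) 0.
have muE psi : (forall y, 0 <= psi y) -> measurable_fun setT psi ->
    \int[mu]_y psi y =
    \sum_(n <oo) \esum_(es in [set: seq nat]) \int[P]_t (psi (pts n t, A n t) * h n es t).
  move=> psi0 mpsi; rewrite ge0_integral_measure_series//.
  apply: eq_eseriesr => n _; rewrite ge0_integral_measure_series//.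
  rewrite esum_pickle; last by move=> es; apply: integral_ge0 => t _; rewrite mule_ge0.
  apply: eq_eseriesr => j _; case: pickle_inv => [es|]; last by rewrite integral_measure_zero.
  by rewrite integral_push// integral_density//; exact: (measurableT_comp mpsi (my n)).
pose k := (\prod_(psi <- phis) \int[m]_y psi y) * P [set t | void t alive pts A].
have k0 : 0 <= k.
  rewrite mule_ge0//; elim: phis hphis {hphi IH h ps0 h0 mh mu muE k} => [|psi phis IH] hphis.
    by rewrite big_nil.
  rewrite big_cons mule_ge0//; last by apply: IH => psi' ?; apply: hphis; right.
  by apply: integral_ge0 => y _; have [+ _ _] := hphis psi (or_introl erefl).
(* Uniqueness of measures will need finite values on an exhaustion, so the constant must be
   finite. *)
have koo : k < +oo.
  have Pfin : P [set t | void t alive pts A] \is a fin_num.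
    rewrite ge0_fin_numE//; apply: (le_lt_trans _ (mp_fin MP)).
    apply: le_measure; rewrite ?inE//.
    exact: (measurable_void_conf mDD DD1 sE malive mpts mA).
  rewrite -ge0_fin_numE// fin_numM//.
  elim: phis hphis {hphi IH h ps0 h0 mh mu muE k k0} => [|psi phis IH] hphis.
    by rewrite big_nil.
  rewrite big_cons fin_numM//; last by apply: IH => psi' ?; apply: hphis; right.
  have [psi0 _ psioo] := hphis psi (or_introl erefl).
  by rewrite ge0_fin_numE//; apply: integral_ge0.
have kf : (0 <= fine k)%R by rewrite fine_ge0.
have kE : k = (fine k)%:E by rewrite fineK// ge0_fin_numE.
(* On a rectangle the sum over [n] is an integral against [slice]: [mu] is then [pick_int] of the
   peeled process, to which the induction hypothesis applies. *)
have rect C D0 : measurable C -> nu C < +oo -> DD D0 -> mu (C `*` D0) = k * m (C `*` D0).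
  move=> mC nuC DD0.
  have MP' := peel_marked_poisson mDD DDT exF mE MP mC nuC DD0.
  have mch := measurable_chosen mDD MP mC DD0.
  rewrite /k -muleA [X in _ * X]muleC -(peel_void mDD DDT exF mE DD1 sE MP mC nuC DD0).
  rewrite -(IH _ _ _ _ _ _ MP') /pick_int.
  have mCD : measurable (C `*` D0) by apply: measurableX => //; exact: mDD.
  rewrite -(setIT (C `*` D0)) -integral_indic// muE//; last by apply/measurable_EFinP; exact: measurable_indic.
  have i0 n es : 0 <= \int[P]_t ((\1_(C `*` D0) (pts n t, A n t))%:E * h n es t).
    by apply: integral_ge0 => t _; rewrite mule_ge0// lee_fin.
  under eq_eseriesr => n _ do rewrite esum_pickle//.
  rewrite nneseries_interchange; last by move=> n j; case: pickle_inv.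
  rewrite esum_pickle; last by move=> es; apply: integral_ge0 => u _; exact: ps0.
  apply: eq_eseriesr => j _; case: pickle_inv => [es|]; last by rewrite eseries0.
  rewrite integral_slice; last 2 first.
  - by move=> u; exact: ps0.
  - refine (measurable_pick_sum mDD DD1 sE _ (mp_alive MP') (mp_pts MP') (mp_marks MP') _).
    by move=> psi /hphis[].
  apply: eq_eseriesr => n _; rewrite [RHS]integral_mkcond; apply: eq_integral => t _.
  rewrite patchE mem_asbool indicE mem_asbool /h.
  case: asboolP => [[Cp Dp]|nCD]; case: asboolP => [[alt Ct Dt]|nch].
  - by rewrite mul1e alt.
  - by case: ifP => alt; rewrite ?mule0//; case: nch.
  - by case: nCD.
  - by rewrite mul0e.
transitivity (\int[mu]_y phi y).
  rewrite muE// /pick_int esum_seq; last first.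
    move=> es; apply: integral_ge0 => t _; apply: pick_sum_ge0 => psi.
    by move=> /hphi[].
  rewrite [X in X + _](_ : _ = 0) ?add0e; last by rewrite /= integral0.
  apply: eq_eseriesr => n _; apply: eq_esum => es _; apply: eq_integral => t _ /=.
  by rewrite /h; case: ifP; rewrite ?mul0e ?mule0.
rewrite big_cons -muleA -/k muleC kE -[RHS](ge0_integral_mscale _ measurableT (NngNum kf))//.
apply: eq_measure_integral => B mB _.
have [mF ndF FT Foo] := exF.
have rect' C D0 : measurable C -> (exists p, C `<=` F p) -> DD D0 ->
    mu (C `*` D0) = k * m (C `*` D0).
  move=> mC [p Cp] DD0; apply: rect => //.
  by apply: (le_lt_trans _ (Foo p)); apply: le_measure; rewrite ?inE.
apply: mrects_measure_unique => //.
  move=> p; rewrite rect// kE; apply: lte_mul_pinfty => //.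
  exact: (marked_fin mDD mE).
move=> C D mC Cp DDD; rewrite rect'//.
by rewrite [in LHS]kE.
Qed.

End kfold_main.

(** * The void event: its probability and the law on it *)

Section void.
Context (R : realType) d (X : measurableType d) dW (W : measurableType dW).
Variables (g : R.-pker X ~> W) (DD : set (set W)).
Hypotheses (mDD : DD `<=` measurable) (DDT : DD setT) (DDI : setI_closed DD)
  (DDgen : measurable = <<s DD >>).
Variables (nu : {measure set X -> \bar R}) (F : nat -> set X).
Hypothesis exF : exhausts nu F.
Variable m : {measure set (X * W) -> \bar R}.
Hypothesis mE : forall C D, measurable C -> DD D ->
  m (C `*` D) = \int[nu]_(x in C) g x D.
Context d' (T : measurableType d') (P : {measure set T -> \bar R}).
Variables (alive : nat -> T -> bool) (pts : nat -> T -> X) (A : nat -> T -> W).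
Hypothesis MP : marked_poisson g DD nu P alive pts A.
Local Notation N := (atoms R alive pts).
Local Notation Ndel := (atoms_del R alive pts).

Lemma marked_setT C : measurable C -> m (C `*` setT) = nu C.
Proof.
move=> mC; rewrite mE//; under eq_integral do rewrite prob_kernel.
by rewrite integral_cst// mul1e.
Qed.

(** Lists of length one reduce to a sum over [n]. Here [B] need not be a rectangle, unlike the sets
    used in peeling. *)
Lemma mecke_single D1 (B : set (X * W)) E : DD D1 -> measurable B -> m B < +oo ->
  eval_sigma E ->
  \sum_(n <oo) P [set t | [/\ alive n t, B (pts n t, A n t),
     (forall k, alive k t -> k != n -> D1 (A k t)) &
     E (Ndel n t : set X -> \bar R)]] =
  m B * P (void_marks D1 alive A `&` [set t | E (N t : set X -> \bar R)]).
Proof.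
move=> DD1 mB mBoo sE.
have [malive mpts mA] : [/\ forall k, measurable_fun setT (alive k),
  forall k, measurable_fun setT (pts k) & forall k, measurable_fun setT (A k)].
  by case: MP.
pose phi y : \bar R := (\1_B y)%:E.
have phi0 y : 0 <= phi y by rewrite lee_fin.
have mphi : measurable_fun setT phi by apply/measurable_EFinP; exact: measurable_indic.
have iphi : \int[m]_y phi y = m B by rewrite integral_indic// setIT.
have hphi psi : List.In psi [:: phi] -> [/\ forall y, 0 <= psi y,
     measurable_fun setT psi & \int[m]_y psi y < +oo].
  by case=> // <-; split => //; rewrite iphi.
have := multivariate_mecke mDD DDT DDI DDgen exF mE DD1 sE hphi MP.
rewrite big_seq1 iphi => <-; rewrite /pick_int esum_seq; last first.
  by move=> es; apply: integral_ge0 => t _; apply: pick_sum_ge0 => psi /hphi[].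
rewrite /= integral0 add0e; apply: eq_eseriesr => n _.
have mv : measurable [set t | void_conf D1 E (delete (alive ^~ t) n) (pts ^~ t) (A ^~ t)].
  apply: (measurable_void_conf mDD DD1 sE (alive := fun k t => delete (alive ^~ t) n k)) => //.
  by move=> k; exact: measurable_delete.
have mS : measurable [set t | [/\ alive n t, B (pts n t, A n t),
     (forall k, alive k t -> k != n -> D1 (A k t)) &
     E (Ndel n t : set X -> \bar R)]].
  rewrite (_ : [set t | _] = (alive n @^-1` [set true]) `&`
     ((fun t => (pts n t, A n t)) @^-1` B) `&`
     [set t | void_conf D1 E (delete (alive ^~ t) n) (pts ^~ t) (A ^~ t)]).
    apply: measurableI => //; apply: measurableI; apply: measurable_preimage => //.
    exact: measurable_fun_pair.
  apply/seteqP; split => t /=.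
    move=> [a b c e]; split => //; split => // k; rewrite /delete => /andP[alk kn].
    exact: c.
  move=> [[a b] [c e]]; split => // k alk kn; apply: c.
  by rewrite /delete alk.
rewrite esum_seq; last first.
  move=> es; apply: integral_ge0 => t _; apply: mule_ge0; first by case: ifP.
  by case: es => //=; rewrite lee_fin.
rewrite [X in _ + X]eseries0 ?adde0; last first.
  move=> k _ _; apply: esum1 => es _; rewrite integral0_eq// => t _.
  by rewrite mule0.
rewrite -[X in P X]setIT -integral_indic//; apply: eq_integral => t _ /=.
rewrite indicE mem_asbool; case: asboolP => [[alt Bt h Et]|nS].
  rewrite alt /phi indicE mem_set// mul1e asboolT//.
  by split => // k /andP[alk kn]; exact: h.
case: ifPn => alt; last by rewrite mul0e.
rewrite /phi indicE mem_asbool; case: asboolP => Bt; last by rewrite mul0e.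
rewrite mul1e; case: asboolP => // -[h Et]; case: nS; split => // k alk kn.
by apply: h; rewrite /delete alk.
Qed.

Section void_law.
Variable D1 : set W.
Hypothesis DD1 : DD D1.

Lemma measurable_void : measurable (void_marks D1 alive A).
Proof. exact: (measurable_marks mDD (mp_alive MP) (mp_marks MP) (fun=> DD1)). Qed.

Lemma measurable_cyl : measurable ([set: X] `*` D1).
Proof. by apply: measurableX => //; exact: mDD. Qed.

(** The thinned intensity, with density [g x D1] with respect to [nu]; in the model it is the
    intensity of [rho_post]. *)
Definition void_intensity : {measure set X -> \bar R} :=
  push (mrestr m measurable_cyl) measurable_fst.

Lemma void_intensityE C : void_intensity C = m (C `*` D1).
Proof.
rewrite /void_intensity pushE /mrestr; congr (m _).
by apply/seteqP; split => -[x w] /= []; [move=> Cx []|move=> Cx Dw].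
Qed.

Lemma void_intensity_le C : measurable C -> void_intensity C <= nu C.
Proof.
move=> mC; rewrite void_intensityE -marked_setT//; apply: le_measure; rewrite ?inE//.
- by apply: measurableX => //; exact: mDD.
- exact: measurableX.
- by move=> [x w] [].
Qed.

(* By Mecke's formula for a picked unmarked atom. *)
Lemma void_poisson : poisson (mrestr P measurable_void) void_intensity N.
Proof.
have [malive mpts mA] : [/\ forall k, measurable_fun setT (alive k),
  forall k, measurable_fun setT (pts k) & forall k, measurable_fun setT (A k)].
  by case: MP.
apply: mecke_poisson => //.
  change (P (setT `&` void_marks D1 alive A) < +oo).
  apply: (le_lt_trans _ (mp_fin MP)); apply: le_measure; rewrite ?inE//.
  by rewrite setTI; exact: measurable_void.
move=> C E mC Coo sE; rewrite void_intensityE in Coo *.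
transitivity (m (C `*` D1) *
    P (void_marks D1 alive A `&` [set t | E (N t : set X -> \bar R)])); last first.
  by rewrite setIC.
rewrite -mecke_single//; last by apply: measurableX => //; exact: mDD.
apply: eq_eseriesr => n _; rewrite /mrestr; congr (P _).
apply/seteqP; split => t /=.
  move=> [[[alt Ct] Et] v]; split => //; first by split => //; exact: v.
  by move=> k alk _; exact: v.
move=> [alt [Ct Dt] h Et]; split => // k alk.
by have [->//|kn] := eqVneq k n; apply: h.
Qed.

Let c := fine (P (void_marks D1 alive A)).
Let M := fine (P setT).
Let Z p := [set t | N t (F p) = 0].

(** [N] is Poisson under [P] and also on the void event, whose mass [c] is unknown. Both laws give
    the mass of the realizations without atoms in [F p]; comparing them bounds [c] above. Mecke's
    formula for an atom outside [F p] with its mark outside [D1] bounds [c] below. The bounds meet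
    as [p] tends to infinity. *)
Lemma void_mass :
  P (void_marks D1 alive A) = P setT * expeR (- m ([set: X] `*` ~` D1)).
Proof.
have [mF ndF FT Foo] := exF.
have [malive mpts mA] : [/\ forall k, measurable_fun setT (alive k),
  forall k, measurable_fun setT (pts k) & forall k, measurable_fun setT (A k)].
  by case: MP.
have mV := measurable_void.
have Poo := mp_fin MP.
have cE : P (void_marks D1 alive A) = c%:E.
  rewrite fineK// ge0_fin_numE//; apply: (le_lt_trans _ Poo).
  by apply: le_measure; rewrite ?inE.
have ME : P setT = M%:E by rewrite fineK// ge0_fin_numE.
have mD1 : measurable D1 by exact: mDD.
have mCyl C D : measurable C -> measurable D -> measurable (C `*` D : set (X * W)).
  by move=> *; exact: measurableX.
have nuF p : m (F p `*` setT) < +oo by rewrite marked_setT.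
have fin1 p : m (F p `*` D1) < +oo.
  apply: (le_lt_trans _ (nuF p)); apply: le_measure; rewrite ?inE; try exact: mCyl.
  by move=> [x w] [].
have fin2 p : m (F p `*` ~` D1) < +oo.
  apply: (le_lt_trans _ (nuF p)); apply: le_measure; rewrite ?inE; try by apply: mCyl => //; exact: measurableC.
  by move=> [x w] [].
pose v1 p := fine (m (F p `*` D1)).
pose k p := fine (m (F p `*` ~` D1)).
have v1E p : m (F p `*` D1) = (v1 p)%:E by rewrite fineK// ge0_fin_numE.
have kE p : m (F p `*` ~` D1) = (k p)%:E by rewrite fineK// ge0_fin_numE.
have nuE p : nu (F p) = (v1 p + k p)%:E.
  rewrite -marked_setT// EFinD -v1E -kE -measureU//.
  - congr (m _); apply/seteqP; split => -[x w] /=; last by case=> -[].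
    by move=> [Fx _]; have [Dw|Dw] := pselect (D1 w); [left|right].
  - exact: mCyl.
  - by apply: mCyl => //; exact: measurableC.
  - by rewrite -subset0 => -[x w] /= [[_ Dw] [_ nDw]].
have k0 p : (0 <= k p)%R by rewrite fine_ge0.
have PZ p : P (Z p) = (M * expR (- (v1 p + k p)))%:E.
  have := (mp_poisson MP).2 unit (fun=> F p) (fun=> 0%N).
  rewrite big_const card_unit /= mulr1 /pois expr0 fact0 divr1 mul1r nuE /= ME EFinM => <-//.
  - by congr (P _); apply/seteqP; split => [t h []|t /(_ tt)].
  - by apply/trivIsetP => -[] [].
  - by move=> _; rewrite ltry.
have mZ p : measurable (Z p).
  by apply: (measurable_preimage (f := fun t => N t (F p)) (C := [set 0])) => //; exact: measurable_atoms.
have PVZ p : P (Z p `&` void_marks D1 alive A) = (c * expR (- v1 p))%:E.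
  have := void_poisson.2 unit (fun=> F p) (fun=> 0%N).
  rewrite big_const card_unit /= mulr1 /pois expr0 fact0 divr1 mul1r void_intensityE v1E /=.
  have -> : mrestr P measurable_void setT = c%:E.
    by rewrite -cE -[in RHS](setTI (void_marks D1 alive A)).
  rewrite EFinM => <-//.
  - by congr (P (_ `&` _)); apply/seteqP; split => [t h []|t /(_ tt)].
  - by apply/trivIsetP => -[] [].
  - by move=> _; rewrite ltry.
(* Monotonicity: [c * expR (- v1 p)] is at most [M * expR (- (v1 p + k p))]. *)
have upper p : (c <= M * expR (- k p))%R.
  have : P (Z p `&` void_marks D1 alive A) <= P (Z p).
    by apply: le_measure; rewrite ?inE//; exact: measurableI.
  rewrite PVZ PZ lee_fin opprD expRD => h.
  have e1 := expR_gt0 (- v1 p)%R.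
  by rewrite -(ler_pM2r e1); lra.
have mCD : measurable (~` D1) by exact: measurableC.
have cvk : (k p)%:E @[p --> \oo] --> m ([set: X] `*` ~` D1).
  under eq_fun do rewrite -kE.
  rewrite (_ : [set: X] `*` ~` D1 = \bigcup_p (F p `*` ~` D1)); last first.
    apply/seteqP; split => [[x w] /= [_ nD]|[x w] [p _ [_ nD]]//].
    have : (\bigcup_p F p) x by rewrite FT.
    by move=> [p _ Fx]; exists p.
  apply: nondecreasing_cvg_mu.
  - by move=> p; exact: mCyl.
  - by apply: bigcupT_measurable => p; exact: mCyl.
  - move=> p q pq; apply/subsetPset => -[x w] [/= Fx nD]; split => //.
    by move/subsetPset : (ndF _ _ pq); apply.
have c0 : (0 <= c)%R by rewrite fine_ge0.
rewrite cE ME.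
(* In the infinite case the upper bound suffices: for positive [c], the inequalities
   [1 + k p <= expR (k p) <= M / c] would keep [k p] bounded. *)
have [koo|] := eqVneq (m ([set: X] `*` ~` D1)) +oo.
  rewrite koo /= mule0; congr (_%:E); apply/eqP; apply: contraT => cn0.
  have cgt0 : (0 < c)%R by rewrite lt_def cn0.
  have : m ([set: X] `*` ~` D1) <= (M / c)%:E.
    rewrite -(cvg_lim _ cvk)//; apply: lime_le; first by apply/cvg_ex; exists (m ([set: X] `*` ~` D1)).
    near=> p; rewrite lee_fin ler_pdivlMr//.
    have up := upper p; rewrite expRN in up.
    have ep : (0 < expR (k p))%R by exact: expR_gt0.
    have : (c * expR (k p) <= M)%R by rewrite -ler_pdivlMr.
    apply: le_trans; rewrite mulrC ler_pM2l//.
    by apply: le_trans (expR_ge1Dx _); rewrite lerDr.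
  by rewrite koo leye_eq.
move=> kfin; have {}kfin : m ([set: X] `*` ~` D1) \is a fin_num.
  by rewrite ge0_fin_numE// ltey.
pose K := fine (m ([set: X] `*` ~` D1)).
have KE : m ([set: X] `*` ~` D1) = K%:E by rewrite fineK.
(* If [F p] has no atom and the void condition fails, some atom outside [F p] has its mark outside
   [D1]. By Mecke's formula such realizations have mass at most [(K - k p) * P (Z p)]. *)
have lower p : (M * expR (- k p) * (1 - (K - k p)) <= c)%R.
  pose B := (~` F p) `*` (~` D1).
  have mB : measurable B by apply: mCyl => //; exact: measurableC.
  have mBE : m B = (K - k p)%:E.
    have : K%:E = (k p)%:E + m B.
      rewrite -KE -kE -measureU//; [|exact: mCyl|].
        congr (m _); apply/seteqP; split => -[x w] /=.
          by move=> [_ nD]; have [Fx|Fx] := pselect (F p x); [left|right].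
        by case=> -[].
      by rewrite -subset0 => -[x w] /= [[Fx _] [nFx _]].
    have mBfin : m B \is a fin_num.
      rewrite ge0_fin_numE//; apply: (le_lt_trans _ (ltry K)); rewrite -KE.
      by apply: le_measure; rewrite ?inE; [|exact: mCyl|move=> [x w] []].
    by rewrite -(fineK mBfin) -EFinD => -[->]; congr (_%:E); ring.
  pose S n := [set t | [/\ alive n t, B (pts n t, A n t),
     (forall k, alive k t -> k != n -> [set: W] (A k t)) &
     [set mu : set X -> \bar R | mu (F p) = 0] (Ndel n t : set X -> \bar R)]].
  have sZ : eval_sigma [set mu : set X -> \bar R | mu (F p) = 0].
    by apply: (eval_sigma_eval (C := [set 0]) (mF p)).
  have mS n : measurable (S n).
    rewrite (_ : S n = [set t | alive n t /\ [set mu : set X -> \bar R | mu (F p) = 0] (Ndel n t : set X -> \bar R)]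
      `&` ((fun t => (pts n t, A n t)) @^-1` B)).
      apply: measurableI; first exact: measurable_alive_del.
      by apply: measurable_preimage => //; exact: measurable_fun_pair.
    by apply/seteqP; split => t /=; [case|move=> [[a e] b]; split].
  have sumS : \sum_(n <oo) P (S n) = m B * P (Z p).
    rewrite mecke_single//; last by rewrite mBE ltry.
    by congr (_ * P _); apply/seteqP; split => t //= [].
  have cover : Z p `\` void_marks D1 alive A `<=` \bigcup_n S n.
    move=> t [Zt nV]; apply: contrapT => nS; apply: nV => n aln.
    apply: contrapT => nD; apply: nS; exists n => //.
    have := conf_delete R (pts ^~ t) (F p) (al := alive ^~ t) aln.
    rewrite -/(N t) -/(Ndel n t) Zt mem_asbool.
    case: asboolP => [Fp|nFp] h; last first.
      by split => //=; rewrite add0e in h.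
    have : 1%:E <= (true%:R)%:E + Ndel n t (F p) by rewrite leeDl.
    by rewrite -h lee_fin ler10.
  have : P (Z p) <= P (Z p `&` void_marks D1 alive A) + m B * P (Z p).
    rewrite -sumS -[X in P X <= _](setUIDK (Z p) (void_marks D1 alive A)).
    rewrite measureU; last first.
    - by rewrite -subset0 => t [[_ v] [_ nv]].
    - exact: measurableD.
    - exact: measurableI.
    rewrite leeD2l//; apply: measure_sigma_subadditive => //.
    exact: measurableD.
  rewrite PVZ PZ mBE -EFinM -EFinD lee_fin.
  have e1 := expR_gt0 (- v1 p)%R.
  rewrite opprD expRD => h.
  rewrite -(ler_pM2r e1); nra.
have cvkR : k p @[p --> \oo] --> K by move: cvk; rewrite KE => /fine_cvgP[].
have cve : (M * expR (- k p))%R @[p --> \oo] --> (M * expR (- K))%R.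
  apply: cvgMr; have cvn : (- k p)%R @[p --> \oo] --> (- K)%R by apply: cvgN.
  exact: (continuous_cvg _ (@continuous_expR R _) cvn).
rewrite KE /= -EFinM; congr (_%:E); apply/eqP; rewrite eq_le; apply/andP; split.
  rewrite -(cvg_lim _ cve)//; apply: limr_ge; first by apply/cvg_ex; exists (M * expR (- K))%R.
  by near=> p; exact: upper.
have cvl : (M * expR (- k p) * (1 - (K - k p)))%R @[p --> \oo] --> (M * expR (- K))%R.
  rewrite -[X in _ --> X]mulr1 -[X in (_ * X)%R](subr0 1%R) -[X in (1 - X)%R](subrr K).
  by apply: cvgM => //; apply: cvgB; [exact: cvg_cst|apply: cvgB => //; exact: cvg_cst].
rewrite -(cvg_lim _ cvl)//; apply: limr_le; first by apply/cvg_ex; exists (M * expR (- K))%R.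
by near=> p; exact: lower.
Unshelve. all: by end_near. Qed.

End void_law.
End void.

(** * Listings of the marked atoms *)

Section enumerations.
Context (R : realType) d (X : measurableType d) dW (W : measurableType dW).
Variable D0 : set W.
Implicit Types (al : nat -> bool) (x : nat -> X) (a : nat -> W).

(* An atom is marked when its mark lies outside [D0]. *)
Definition enum_marked al a (es : seq nat) : Prop :=
  uniq es /\ forall n, (al n /\ ~ D0 (a n)) <-> n \in es.

Definition unlisted al (es : seq nat) n := al n && (n \notin es).

(** Test functions that vanish on marks in [D0] force each listed atom to be marked, and the final
    test forces each marked atom to be listed. *)
Lemma pick_sumE E (phis : seq (X * W -> \bar R)) al x a es :
  (forall phi, List.In phi phis -> forall u v, D0 v -> phi (u, v) = 0) ->
  pick_sum D0 E phis al x a es =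
  if `[< [/\ size es = size phis, enum_marked al a es &
         E (conf R (unlisted al es) x : set X -> \bar R)] >]
  then \prod_(i < size phis) nth (cst 0) phis i (x (nth 0%N es i), a (nth 0%N es i))
  else 0.
Proof.
elim: phis al es => [|phi phis IH] al [|n es] hphi /=.
- rewrite big_ord0 (_ : unlisted al [::] = al); last first.
    by apply/funext => k; rewrite /unlisted andbT.
  case: asboolP => [[h Ec]|nh]; case: asboolP => [|nh']//.
    case: nh'; split => //; split => // k; split => // -[alk nD].
    by case: nD; exact: h.
  move=> [_ [_ h] Ec]; case: nh; split => // k alk; apply: contrapT => nD.
  by have := (h k).1 (conj alk nD).
- by case: asboolP => // -[].
- by case: asboolP => // -[].
rewrite big_ord_recl /= IH; last by move=> psi hpsi; apply: hphi; right.
case: ifPn => aln; last first.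
  rewrite mul0e; case: asboolP => // -[_ [_ /(_ n)[_ h]] _].
  by case/h: (mem_head n es) => aln'; rewrite ?aln' in aln.
have [Dn|nDn] := pselect (D0 (a n)).
  rewrite (hphi phi (or_introl erefl))// mul0e.
  case: asboolP => // -[_ [_ /(_ n)[_ h]] _].
  by case/h: (mem_head n es) => aln'; rewrite ?aln' in aln.
have unE : unlisted (delete al n) es = unlisted al (n :: es).
  by apply/funext => k; rewrite /unlisted /delete in_cons negb_or andbA.
rewrite unE [in LHS]/asbool; case: pselect => h; case: asboolP => h'; rewrite ?mule0//.
  case: h' ; case: h => [sz [ues h] Ec]; split => //; first by rewrite sz.
  have nes : n \notin es by apply/negP => /h[]; rewrite /delete eqxx andbF.
  split; first by rewrite /= nes.
  move=> k; rewrite in_cons; split.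
    move=> [alk nD]; have [->//|kn] := eqVneq k n.
    by rewrite orFb; apply/h; split => //; rewrite /delete alk.
  by move=> /orP[/eqP->//|/h[/andP[alk _] nD]].
case: h; case: h' => -[sz] [/= /andP[nes ues] h] Ec; split => //; split => // k; split.
  move=> [/andP[alk kn] nD]; have := (h k).1 (conj alk nD).
  by rewrite in_cons (negPf kn).
move=> kes; have /h[alk nD] : k \in n :: es by rewrite in_cons kes orbT.
by split => //; rewrite /delete alk; apply: contraNneq nes => <-.
Qed.

Definition enum_fun al a k (e : 'I_k -> nat) : Prop :=
  injective e /\ forall n, (al n /\ ~ D0 (a n)) <-> exists l, e l = n.

Lemma enum_fun_seq al a k (e : 'I_k -> nat) :
  enum_fun al a e -> enum_marked al a [seq e l | l <- enum 'I_k].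
Proof.
move=> [ei h]; split; first by rewrite map_inj_uniq ?enum_uniq.
move=> n; split; first by move=> /h[l <-]; apply: map_f; rewrite mem_enum.
by move=> /mapP[l _ ->]; apply/h; exists l.
Qed.

Lemma enum_marked_size al a es es' :
  enum_marked al a es -> enum_marked al a es' -> size es = size es'.
Proof.
move=> [u h] [u' h']; apply: perm_size; apply: uniq_perm => // n.
by apply/idP/idP; [move=> /h/h'|move=> /h'/h].
Qed.

(** The listings of one finite set are the rearrangements of a given one, each by exactly one
    permutation; none has length [k] when the set has another size. *)
Lemma sum_enum_marked al a k k' (e : 'I_k' -> nat) (H : seq nat -> \bar R) :
  enum_fun al a e -> (forall es, 0 <= H es) ->
  \esum_(es in [set: seq nat])
    (if `[< size es = k /\ enum_marked al a es >] then H es else 0) =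
  if k' == k then \sum_(p : {perm 'I_k'}) H [seq e (p l) | l <- enum 'I_k'] else 0.
Proof.
move=> en H0; case: eqP => [kk|nk]; last first.
  apply: esum1 => es _; case: asboolP => // -[sz em]; case: nk.
  have /esym := enum_marked_size (enum_fun_seq en) em.
  by rewrite size_map size_enum_ord sz.
subst k'.
pose h (p : {perm 'I_k}) := [seq e (p l) | l <- enum 'I_k].
pose S := [set es | size es = k /\ enum_marked al a es].
have [ei eh] := en.
rewrite -(esum_fin (a := fun p => H (h p)))// -(@reindex_esum _ _ _ _ S); last first.
  split.
  - move=> p _; split; first by rewrite size_map size_enum_ord.
    apply: enum_fun_seq; split; first by move=> i j /ei/perm_inj.
    move=> n; rewrite eh; split => -[l <-]; last by exists (p l).
    by exists (p^-1%g l); rewrite permKV.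
  - move=> p p' _ _ /eq_in_map pp'; apply/permP => l.
    by apply: ei; apply: pp'; rewrite mem_enum.
  - move=> es [sz em].
    (* Surjectivity: each entry of [es] is some [e l'], and [l'] depends injectively on [l] because
       [es] has no repetition. *)
    have ex (l : 'I_k) : exists l', e l' == nth 0%N es l.
      have /em.2/eh[l' <-] : nth 0%N es l \in es by rewrite mem_nth ?sz.
      by exists l'.
    pose f l := xchoose (ex l).
    have fE l : e (f l) = nth 0%N es l by apply/eqP; exact: xchooseP (ex l).
    have fi : injective f.
      move=> i j ij; apply/val_inj/eqP.
      by rewrite -(nth_uniq 0%N (s := es) _ _ em.1) ?sz ?ltn_ord// -!fE ij.
    exists (perm fi) => //; rewrite /h.
    apply: (@eq_from_nth _ 0%N); first by rewrite size_map size_enum_ord sz.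
    move=> i; rewrite size_map size_enum_ord => ik.
    by rewrite (nth_map (Ordinal ik)) ?size_enum_ord// permE fE nth_enum_ord.
rewrite [RHS]esum_mkcond; apply: eq_esum => es _.
by rewrite mem_asbool.
Qed.
End enumerations.

Section listings.
Context (R : realType) d (X : measurableType d) dW (W : measurableType dW).
Variables (g : R.-pker X ~> W) (DD : set (set W)).
Hypotheses (mDD : DD `<=` measurable) (DDT : DD setT) (DDI : setI_closed DD)
  (DDgen : measurable = <<s DD >>).
Variables (nu : {measure set X -> \bar R}) (F : nat -> set X).
Hypothesis exF : exhausts nu F.
Variable m : {measure set (X * W) -> \bar R}.
Hypothesis mE : forall C D, measurable C -> DD D ->
  m (C `*` D) = \int[nu]_(x in C) g x D.
Context d' (T : measurableType d') (P : {measure set T -> \bar R}).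
Variables (alive : nat -> T -> bool) (pts : nat -> T -> X) (A : nat -> T -> W).
Hypothesis MP : marked_poisson g DD nu P alive pts A.
Variable D0 : set W.
Hypothesis DD0 : DD D0.
Local Notation N := (atoms R alive pts).
Let malive := mp_alive MP.
Let mpts := mp_pts MP.
Let mA := mp_marks MP.

Definition listing k es : set T :=
  [set t | size es = k /\ enum_marked D0 (alive ^~ t) (A ^~ t) es].

Lemma measurable_listing k es : measurable (listing k es).
Proof.
have [sz|nsz] := pselect (size es = k); last first.
  rewrite (_ : listing k es = set0)//; apply/seteqP; split => t //.
  by case=> /nsz.
have [u|nu'] := pselect (uniq es); last first.
  rewrite (_ : listing k es = set0)//; apply/seteqP; split => t //.
  by case=> _ [/nu'].
rewrite (_ : listing k es = \bigcap_n
   [set t | (alive n t /\ (~` D0) (A n t)) <-> n \in es]); last first.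
  apply/seteqP; split => t; first by move=> [_ [_ h]] n _; exact: h.
  by move=> h; split => //; split => // n; exact: h n I.
apply: bigcapT_measurable => n.
have mS : measurable [set t | alive n t /\ (~` D0) (A n t)].
  apply: measurable_alive_pts => //; apply: measurableC; exact: mDD.
case: (boolP (n \in es)) => nes.
  rewrite (_ : [set t | _] = [set t | alive n t /\ (~` D0) (A n t)])//.
  by apply/seteqP; split => t /= h; [exact/h|split].
rewrite (_ : [set t | _] = ~` [set t | alive n t /\ (~` D0) (A n t)]).
  exact: measurableC.
apply/seteqP; split => t /=; first by move=> h /h.
by move=> h; split => // /h.
Qed.

Definition atoms_unlisted es t : {measure set X -> \bar R} :=
  conf R (unlisted (alive ^~ t) es) (pts ^~ t).

Lemma measurable_unlisted es k :
  measurable_fun setT (fun t => unlisted (alive ^~ t) es k).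
Proof. by apply: measurable_and. Qed.

Lemma measurable_atoms_unlisted es C : measurable C ->
  measurable_fun setT (fun t => atoms_unlisted es t C).
Proof.
exact: (measurable_atoms (alive := fun k t => unlisted (alive ^~ t) es k)
  (measurable_unlisted es) mpts).
Qed.

Lemma multivariate_mecke_listing k (f : 'I_k -> X * W -> \bar R) E : eval_sigma E ->
  (forall l y, 0 <= f l y) -> (forall l, measurable_fun setT (f l)) ->
  (forall l x w, D0 w -> f l (x, w) = 0) ->
  (forall l, \int[m]_y f l y < +oo) ->
  \esum_(es in [set: seq nat]) \int[P]_t
    (if `[< listing k es t /\ E (atoms_unlisted es t : set X -> \bar R) >] then
      \prod_(l < k) f l (pts (nth 0%N es l) t, A (nth 0%N es l) t) else 0) =
  (\prod_(l < k) \int[m]_y f l y) *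
  P (void_marks D0 alive A `&` [set t | E (N t : set X -> \bar R)]).
Proof.
move=> sE f0 mf fD fi.
pose phis := [seq f l | l <- enum 'I_k].
have phisP phi : List.In phi phis -> exists l, phi = f l.
  rewrite /phis; elim: (enum 'I_k) => //= l s IH [<-|/IH//]; by exists l.
have hphi phi : List.In phi phis -> [/\ forall y, 0 <= phi y,
     measurable_fun setT phi & \int[m]_y phi y < +oo].
  by move=> /phisP[l ->]; split.
have := multivariate_mecke mDD DDT DDI DDgen exF mE DD0 sE hphi MP.
rewrite void_confE /phis big_map big_enum/= => <-; apply: eq_esum => es _.
apply: eq_integral => t _; rewrite pick_sumE; last first.
  by move=> phi /phisP[l ->]; exact: fD.
rewrite /phis size_map size_enum_ord; congr (if _ then _ else _).
  by apply/asboolP/asboolP => [[[]]|[]].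
apply: eq_bigr => l _; rewrite (nth_map l) ?size_enum_ord ?ltn_ord//.
by rewrite nth_ord_enum.
Qed.

Section count.
Variable K : T -> nat.
Hypothesis mK : forall k, measurable (K @^-1` [set k]).
Hypothesis aeK : {ae P, forall t, exists e : 'I_(K t) -> nat,
  enum_fun D0 (alive ^~ t) (A ^~ t) e}.

(** The left side depends on the indexing of the atoms; the right side can be a function of an
    observed list. Almost surely the index lists are the rearrangements of one enumeration, along
    which [H] takes the values [H']. *)
Lemma esum_listing k (H : seq nat -> T -> \bar R) (H' : {perm 'I_k} -> T -> \bar R) :
  (forall es t, 0 <= H es t) -> (forall p t, 0 <= H' p t) ->
  (forall es, measurable_fun setT (H es)) ->
  (forall p, measurable_fun setT (H' p)) ->
  {ae P, forall t, K t = k -> exists e : 'I_k -> nat,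
    enum_fun D0 (alive ^~ t) (A ^~ t) e /\
    forall p : {perm 'I_k}, H [seq e (p l) | l <- enum 'I_k] t = H' p t} ->
  \esum_(es in [set: seq nat]) \int[P]_(t in listing k es) H es t =
  \sum_(p : {perm 'I_k}) \int[P]_(t in K @^-1` [set k]) H' p t.
Proof.
move=> H0 H'0 mH mH' aeH.
have mres S (h : T -> \bar R) : measurable S -> measurable_fun setT h ->
    measurable_fun setT (h \_ S).
  move=> mS mh; apply/(measurable_restrictT _ mS).1; exact: measurable_funTS.
have res0 S (h : T -> \bar R) : (forall t, 0 <= h t) -> forall t, 0 <= (h \_ S) t.
  by move=> h0 t; rewrite patchE; case: ifP.
under eq_esum do rewrite integral_mkcond.
rewrite -integral_esum; last 2 first.
- by move=> es t; exact: res0.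
- by move=> es; apply: mres => //; exact: measurable_listing.
under [RHS]eq_bigr do rewrite integral_mkcond.
rewrite -ge0_integral_sum//=; last 2 first.
- by move=> p; exact: mres.
- by move=> p t _; exact: res0.
apply: ge0_ae_eq_integral => //.
- apply: measurable_esum; first by move=> es t; exact: res0.
  by move=> es; apply: mres => //; exact: measurable_listing.
- by apply: emeasurable_sum => p; exact: mres.
- by move=> t _; apply: esum_ge0 => es _; exact: res0.
- by move=> t _; apply: sume_ge0 => p _; exact: res0.
near=> t => _.
have [e0 en0] : exists e : 'I_(K t) -> nat, enum_fun D0 (alive ^~ t) (A ^~ t) e.
  by near: t.
have hk : K t = k -> exists e : 'I_k -> nat,
    enum_fun D0 (alive ^~ t) (A ^~ t) e /\
    forall p : {perm 'I_k}, H [seq e (p l) | l <- enum 'I_k] t = H' p t.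
  by near: t.
transitivity (\esum_(es in [set: seq nat])
    (if `[< size es = k /\ enum_marked D0 (alive ^~ t) (A ^~ t) es >]
     then H es t else 0)).
  by apply: eq_esum => es _; rewrite patchE mem_asbool.
have [Kk|nKk] := eqVneq (K t) k.
  have [e [en eH]] := hk Kk.
  rewrite (sum_enum_marked _ en)// eqxx; apply: eq_bigr => p _.
  by rewrite patchE mem_set// eH.
rewrite (sum_enum_marked _ en0)// (negPf nKk) big1// => p _.
by rewrite patchE memNset// => /eqP; exact/negP.
Unshelve. all: by end_near. Qed.

End count.
End listings.

(** * The posterior of a marked Poisson process *)

Lemma emeasurable_prod (R : realType) d (T : measurableType d) I (s : seq I)
    (h : I -> T -> \bar R) : (forall i, measurable_fun setT (h i)) ->
  measurable_fun setT (fun t => \prod_(i <- s) h i t).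
Proof.
move=> mh; elim: s => [|i s IH].
  by under eq_fun do rewrite big_nil; exact: measurable_cst.
by under eq_fun do rewrite big_cons; exact: emeasurable_funM.
Qed.

Lemma sume_const (R : realType) (I : finType) (x : \bar R) : 0 <= x ->
  \sum_(i : I) x = #|I|%:R%:E * x.
Proof.
move=> x0; rewrite big_const; elim: #|I| => [|n IH] /=; first by rewrite mul0e.
by rewrite IH -addn1 natrD EFinD ge0_muleDl ?lee_fin// mul1e addeC.
Qed.

Section count_sum.
Context (R : realType).

Context d (Z : measurableType d).

Definition count_sum (I : countType) (mu : I -> {measure set Z -> \bar R}) :
    {measure set Z -> \bar R} :=
  mseries (fun n => if @pickle_inv I n is Some i then mu i else mzero) 0.

Lemma count_sumE (I : countType) (mu : I -> {measure set Z -> \bar R}) U :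
  count_sum mu U = \esum_(i in [set: I]) mu i U.
Proof.
rewrite esum_pickle//; apply: eq_eseriesr => n _.
by case: pickle_inv.
Qed.

Lemma measurable_measure_gen d' (T : measurableType d') (G : set (set Z))
    (k : T -> {measure set Z -> \bar R}) :
  measurable = <<s G >> -> setI_closed G -> G setT ->
  (forall t, k t setT < +oo) ->
  (forall U, G U -> measurable_fun setT (k ^~ U)) ->
  forall U, measurable U -> measurable_fun setT (k ^~ U).
Proof.
move=> Ggen GI GT koo mG U mU.
have mGU V : <<s G >> V -> measurable V by rewrite -Ggen.
suff : <<s G >> `<=` [set V | measurable V /\ measurable_fun setT (k ^~ V)].
  move=> h; have sU : <<s G >> U by rewrite -Ggen.
  by case: (h U sU).
apply: pi_lambda => //.
  by move=> V GV; split; [apply: mGU; exact: sub_sigma_algebra|exact: mG].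
split.
- by split => //; exact: mG.
- move=> V [mV kV]; split; first exact: measurableC.
  rewrite (_ : k ^~ _ = (fun t => k t setT - k t V)); last first.
    by apply/funext => t; rewrite finite_measureC.
  by apply: emeasurable_funB => //; exact: mG.
- move=> V tV VD; have mV n : measurable (V n) by case: (VD n).
  split; first exact: bigcupT_measurable.
  rewrite (_ : k ^~ _ = (fun t => \sum_(n <oo) k t (V n))); last first.
    apply/funext => t; rewrite measure_bigcup//.
    by apply: eq_eseriesl => n; rewrite mem_setT.
  by apply: ge0_emeasurable_sum => // n _; case: (VD n).
Qed.

End count_sum.

Section label_jump.
Context (R : realType) dL (L : measurableType dL) dV (V : measurableType dV).
Variable k : nat.

(** Rectangles for the triples: a label and a jump in each of [k] slots, and a set function for the
    rest. They generate the sigma-algebra on which two laws will be compared. *)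
Definition lj_rects : set (set (('I_k -> L * R) * (set V -> \bar R))) :=
  [set G | exists (C : 'I_k -> set (L * R)) E, [/\ forall l, measurable (C l),
     eval_sigma E & G = [set z | (forall l, C l (z.1 l)) /\ E z.2]]].

Local Notation Z := (g_sigma_algebraType lj_rects).

Lemma lj_rects_setI : setI_closed lj_rects.
Proof.
move=> _ _ [C [E [mC sE ->]]] [C' [E' [mC' sE' ->]]].
exists (fun l => C l `&` C' l), (E `&` E'); split.
- by move=> l; exact: measurableI.
- exact: sigma_algebra_setI.
- apply/seteqP; split => z /=; first by move=> [[h1 h2] [h3 h4]]; split => // l; split.
  by move=> [h [h2 h4]]; split; split => // l; case: (h l).
Qed.

Lemma lj_rectsT : lj_rects setT.
Proof.
exists (fun=> setT), setT; split => //; first exact: eval_sigmaT.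
by apply/seteqP; split.
Qed.

Lemma measurable_lj1 l : measurable_fun setT (fun z : Z => z.1 l).
Proof.
move=> _ C mC; rewrite setTI; apply: sub_sigma_algebra.
exists (fun l' => if l' == l then C else setT), setT; split => //.
- by move=> l'; case: ifP.
- exact: eval_sigmaT.
- apply/seteqP; split => z /=.
    by move=> Cz; split => // l'; case: eqP => // ->.
  by case=> /(_ l); rewrite eqxx.
Qed.

Lemma measurable_lj2 D : measurable D -> measurable_fun setT (fun z : Z => z.2 D).
Proof.
move=> mD _ C mC; rewrite setTI; apply: sub_sigma_algebra.
exists (fun=> setT), [set m | C (m D)]; split => //; first exact: eval_sigma_eval.
by apply/seteqP; split => z /= => [|[]].
Qed.

Lemma measurable_to_lj d (T : measurableType d) (f : T -> Z) :
  (forall l, measurable_fun setT (fun t => (f t).1 l)) ->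
  (forall D, measurable D -> measurable_fun setT (fun t => (f t).2 D)) ->
  measurable_fun setT f.
Proof.
move=> m1 m2 _ G mG; rewrite setTI.
apply: (sigma_preimage (F := measurable) _ _ mG).
  exact: sigma_algebra_measurable.
move=> _ [C [E [mC sE ->]]].
rewrite (_ : f @^-1` _ = (\bigcap_(l in [set: 'I_k]) ((fun t => (f t).1 l) @^-1` C l)) `&`
    [set t | E ((f t).2)]); last first.
  apply/seteqP; split => t /= [h1 h2]; split => // l; first by move=> _; exact: h1.
  exact: h1.
apply: measurableI; last exact: measurable_eval_sigma.
apply: fin_bigcap_measurable => // l _; exact: measurable_preimage.
Qed.

(** Puts the listed atoms back: [c] is the contribution of one of them, a Dirac mass in (i) and a
    weighted one in (ii). *)
Definition lj_add (c : L * R -> set V -> \bar R) (z : Z) : set V -> \bar R :=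
  fun D => z.2 D + \sum_(l < k) c (z.1 l) D.

Lemma measurable_lj_add c : (forall D, measurable D -> measurable_fun setT (c ^~ D)) ->
  forall E, eval_sigma E -> measurable [set z : Z | E (lj_add c z)].
Proof.
move=> mc; apply: measurable_eval_sigma => D mD.
apply: emeasurable_funD; first exact: measurable_lj2.
apply: emeasurable_sum => l; apply: (measurableT_comp (mc _ mD)).
exact: measurable_lj1.
Qed.

Definition label_rects : set (set ('I_k -> L)) :=
  [set U | exists l C, measurable C /\ U = [set u | C (u l)]].

Lemma measurable_lj_label U : <<s label_rects >> U ->
  measurable [set z : Z | U (fun l => (z.1 l).1)].
Proof.
move=> sU; apply: (sigma_preimage (F := measurable) (f := fun z : Z => fun l => (z.1 l).1) _ _ sU).
  exact: sigma_algebra_measurable.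
move=> _ [l [C [mC ->]]].
apply: (measurable_preimage (f := fun z : Z => (z.1 l).1)) => //.
by apply: (measurableT_comp measurable_fst); exact: measurable_lj1.
Qed.

End label_jump.

Section posterior.
Context (R : realType) d (X : measurableType d) dW (W : measurableType dW).
Variables (g : R.-pker X ~> W) (DD : set (set W)).
Hypotheses (mDD : DD `<=` measurable) (DDT : DD setT) (DDI : setI_closed DD)
  (DDgen : measurable = <<s DD >>).
Variables (nu : {measure set X -> \bar R}) (F : nat -> set X).
Hypothesis exF : exhausts nu F.
Variable m : {measure set (X * W) -> \bar R}.
Hypothesis mE : forall C D, measurable C -> DD D ->
  m (C `*` D) = \int[nu]_(x in C) g x D.
Context d' (T : measurableType d') (P : {measure set T -> \bar R}).
Variables (alive : nat -> T -> bool) (pts : nat -> T -> X) (A : nat -> T -> W).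
Hypothesis MP : marked_poisson g DD nu P alive pts A.
Variable D0 : set W.
Hypothesis DD0 : DD D0.
Hypothesis mfin : m (setT `*` ~` D0) < +oo.
Local Notation N := (atoms R alive pts).
Local Notation listing := (listing alive A D0).
Local Notation void := (void_marks D0 alive A).
Let malive := mp_alive MP.
Let mpts := mp_pts MP.
Let mA := mp_marks MP.
Let mD0 : measurable D0 := mDD DD0.

Context dL (L : measurableType dL).
(** Splits a marked atom into its label, which is observed, and its jump, which is not. *)
Variable Theta : X * W -> L * R.
Hypothesis mTheta : measurable_fun setT Theta.
Variables (K : T -> nat) (lab : nat -> T -> L).
Hypothesis mK : forall k, measurable (K @^-1` [set k]).
Hypothesis mlab : forall l, measurable_fun setT (lab l).
Hypothesis aeK : {ae P, forall t, exists e : 'I_(K t) -> nat,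
  enum_fun D0 (alive ^~ t) (A ^~ t) e /\
  forall l : 'I_(K t), lab l t = (Theta (pts (e l) t, A (e l) t)).1}.

Definition off (f : X * W -> \bar R) (y : X * W) : \bar R :=
  if y.2 \in D0 then 0 else f y.

Lemma off_ge0 f : (forall y, 0 <= f y) -> forall y, 0 <= off f y.
Proof. by move=> f0 y; rewrite /off; case: ifP. Qed.

Lemma measurable_off f : measurable_fun setT f -> measurable_fun setT (off f).
Proof.
move=> mf; apply: measurable_fun_ifT => //.
apply: (measurable_fun_bool true); rewrite setTI.
rewrite (_ : _ @^-1` _ = setT `*` D0); first exact: measurableX.
by apply/seteqP; split => -[x w] /=; [move/set_mem|move=> [_ /mem_set]].
Qed.

Lemma offE f : (forall y, 0 <= f y) -> measurable_fun setT f ->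
  \int[m]_y off f y = \int[m]_(y in setT `*` ~` D0) f y.
Proof.
move=> f0 mf; rewrite [RHS]integral_mkcond; apply: eq_integral => -[x w] _.
rewrite /off patchE /= !mem_asbool; case: asboolP => Dw; case: asboolP => //=.
  by case.
by move=> h; case: h.
Qed.

Lemma off_le1 f : (forall y, 0 <= f y) -> (forall y, f y <= 1) ->
  measurable_fun setT f -> \int[m]_y off f y < +oo.
Proof.
move=> f0 f1 mf; rewrite offE//; apply: le_lt_trans mfin.
have mS : measurable ([set: X] `*` ~` D0) by apply: measurableX => //; exact: measurableC.
rewrite -[leRHS]mul1e -integral_cst//; apply: ge0_le_integral => //.
exact: measurable_funTS.
Qed.

Let y es t (l : nat) := Theta (pts (nth 0%N es l) t, A (nth 0%N es l) t).

Let my es l : measurable_fun setT (fun t => y es t l).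
Proof. by apply: (measurableT_comp mTheta); exact: measurable_fun_pair. Qed.

Let aeK0 : {ae P, forall t, exists e : 'I_(K t) -> nat,
  enum_fun D0 (alive ^~ t) (A ^~ t) e}.
Proof. by apply: filterS aeK => t [e [en _]]; exists e. Qed.

(** The sum over the permutations turns the observed list into all the index lists, to which the
    iterated Mecke formula applies. With [f l] the indicator of a rectangle this becomes (iii). *)
Lemma symmetric_product k (f : 'I_k -> L -> \bar R) :
  (forall l x, 0 <= f l x) -> (forall l, measurable_fun setT (f l)) ->
  (forall l, \int[m]_z off (fun z => f l (Theta z).1) z < +oo) ->
  \sum_(p : {perm 'I_k}) \int[P]_(t in K @^-1` [set k]) \prod_(l < k) f l (lab (p l) t) =
  (\prod_(l < k) \int[m]_z off (fun z => f l (Theta z).1) z) * P void.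
Proof.
move=> f0 mf fi.
have mft l : measurable_fun setT (fun z => f l (Theta z).1).
  by apply: (measurableT_comp (mf l)); exact: (measurableT_comp measurable_fst).
rewrite -(esum_listing mDD MP DD0 mK aeK0
  (H := fun es t => \prod_(l < k) f l (y es t l).1)); last 5 first.
- by move=> es t; apply: prode_ge0.
- by move=> p t; apply: prode_ge0.
- move=> es; apply: emeasurable_prod => l; apply: (measurableT_comp (mf l)).
  exact: (measurableT_comp measurable_fst).
- move=> p; apply: emeasurable_prod => l; exact: (measurableT_comp (mf l)).
- apply: filterS aeK => t [e [en labE]] Kk; subst k; exists e; split => // p.
  apply: eq_bigr => l _; rewrite labE /y (nth_map l) ?size_enum_ord//.
  by rewrite nth_ord_enum.
have := multivariate_mecke_listing mDD DDT DDI DDgen exF mE MP DD0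
  (f := fun l => off (fun z => f l (Theta z).1)) (@eval_sigmaT R _ X).
rewrite setIT => <-//.
- apply: eq_esum => es _; rewrite integral_mkcond; apply: eq_integral => t _.
  rewrite patchE mem_asbool; case: asboolP => [lt|nl]; last first.
    by case: asboolP => // -[].
  rewrite asboolT//; apply: eq_bigr => l _; rewrite /off /=.
  rewrite mem_asbool; case: asboolP => // Dl.
  have [sz [_ /(_ (nth 0%N es l))[_]]] := lt.
  by case; rewrite ?mem_nth ?sz.
- by move=> l z; exact: off_ge0.
- by move=> l; exact: measurable_off.
- by move=> l x w Dw; rewrite /off mem_set.
Qed.

Section compound.
Context dV (V : measurableType dV).
Variable Phi : {measure set X -> \bar R} -> set V -> \bar R.
Hypothesis PhiE : forall E, @eval_sigma R _ V E -> exists2 E', @eval_sigma R _ X E' &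
  forall mu : {measure set X -> \bar R}, E (Phi mu) <-> E' mu.
Variable kappa : R.-pker L ~> R.
Hypothesis kappaE : forall C, measurable C ->
  \int[m]_z off (fun z => kappa (Theta z).1 (xsection C (Theta z).1)) z =
  m [set z | C (Theta z) /\ ~ D0 z.2].
Context d'' (T' : measurableType d'') (P' : probability T' R).
Variables (Y : T' -> set V -> \bar R) (J : T -> nat -> T' -> R).
Hypothesis mY : forall D, measurable D -> measurable_fun setT (Y ^~ D).
Hypothesis YE : forall E, eval_sigma E ->
  P (void `&` [set t | E (Phi (N t))]) = P void * P' [set t | E (Y t)].
Hypothesis YJ : forall t, posterior_jumps P' kappa (K t) (lab ^~ t) Y (J t).
Variable GG : set (set T).
Hypothesis GGm : GG `<=` measurable.
Local Notation TZ := (g_sigma_algebraType GG).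
Hypothesis GGK : forall k, <<s GG >> (K @^-1` [set k]).
Hypothesis GGlab : forall l B, measurable B -> <<s GG >> (lab l @^-1` B).

Lemma measurable_GG S : <<s GG >> S -> measurable S.
Proof. by apply: smallest_sub => //; exact: sigma_algebra_measurable. Qed.

Lemma measurable_fun_GG d0 (Z : measurableType d0) (h : T -> Z) :
  measurable_fun setT (h : TZ -> Z) -> measurable_fun setT h.
Proof.
move=> mh _ C mC; rewrite setTI; apply: measurable_GG.
by have := mh measurableT C mC; rewrite setTI.
Qed.

Section fixed_number.
Variable k : nat.
Local Notation Z := (g_sigma_algebraType (@lj_rects R _ L _ V k)).

(** [posterior_jumps] controls only the jumps below [K t]. The others get a default value, so that a
    draw is measurable for every [t]. *)
Let J' t l t' : R := if (K t == k) && (l < k)%N then J t l t' else point.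

Let mJ' t l : measurable_fun setT (J' t l).
Proof.
rewrite /J'; case: eqVneq => [Kk|_]; last exact: measurable_cst.
case: ltnP => lk; last exact: measurable_cst.
by have [mJ _ _] := YJ t; apply: mJ; rewrite Kk.
Qed.

(** A draw from the claimed posterior, with the slots filled in the order [p]. *)
Definition lj_draw (p : {perm 'I_k}) t (t' : T') : Z :=
  (fun l => (lab (p l) t, J' t (p l) t'), Y t').

Lemma measurable_lj_draw p t : measurable_fun setT (lj_draw p t).
Proof.
apply: measurable_to_lj => [l|D mD]; last exact: mY.
by apply: measurable_fun_pair => //; exact: mJ'.
Qed.

Definition lj_law p t : {measure set Z -> \bar R} :=
  if K t == k then push P' (measurable_lj_draw p t) else mzero.

Lemma lj_law_rect p t (C : 'I_k -> set (L * R)) E :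
  (forall l, measurable (C l)) -> eval_sigma E -> K t = k ->
  lj_law p t [set z | (forall l, C l (z.1 l)) /\ E z.2] =
  P' [set t' | E (Y t')] *
  \prod_(l < k) kappa (lab (p l) t) (xsection (C l) (lab (p l) t)).
Proof.
move=> mC sE Kk; rewrite /lj_law Kk eqxx pushE.
have [mJ lJ iJ] := YJ t; rewrite Kk in mJ lJ iJ.
(* Independence is given in the order of the list, and entry [l] of the list sits in the slot
   [p^-1 l]. *)
pose S n : set R := if insub n is Some l
  then xsection (C (p^-1%g l)) (lab n t) else setT.
have SE (l : 'I_k) : S l = xsection (C (p^-1%g l)) (lab l t) by rewrite /S valK.
have mS n : measurable (S n).
  by rewrite /S; case: insubP => // l _ _; exact: measurable_xsection.
transitivity (P' (Y @^-1` E `&` [set t' | forall l, (l < k)%N -> S l (J t l t')])).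
  congr (P' _); apply/seteqP; split => t' /=.
    move=> [h Et']; split => // l lk; have := h (p^-1%g (Ordinal lk)).
    rewrite permKV /J' Kk eqxx lk /= => Ch.
    by rewrite -[l]/(val (Ordinal lk)) SE /xsection /=; apply/mem_set.
  move=> [Et' h]; split => // l; have := h _ (ltn_ord (p l)).
  by rewrite SE permK /xsection /= /J' Kk eqxx ltn_ord /= => /set_mem.
rewrite iJ//; congr (_ * _).
rewrite (reindex_perm p) /=; apply: eq_bigr => l _.
by rewrite lJ// SE permK.
Qed.

Lemma measurable_lj_law p U : measurable U ->
  measurable_fun setT ((fun t => lj_law p t U) : TZ -> \bar R).
Proof.
move=> mU; refine (@measurable_measure_gen R _ Z _ TZ (@lj_rects R _ L _ V k) (lj_law p) _ _ _ _ _ U mU) => //.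
- exact: lj_rects_setI.
- exact: lj_rectsT.
- move=> t; rewrite /lj_law; case: ifP => _; last by rewrite /mzero ltry.
  by change (P' setT < +oo); rewrite probability_setT ltry.
move=> _ [C [E [mC sE ->]]].
have mKk : measurable_fun setT ((fun t => K t == k) : TZ -> bool).
  apply: (measurable_fun_bool true); rewrite setTI.
  rewrite (_ : _ @^-1` _ = K @^-1` [set k]); first exact: GGK.
  by apply/seteqP; split => t /= /eqP.
rewrite (_ : (fun t => _) = (fun t => if K t == k then
  P' [set t' | E (Y t')] *
  \prod_(l < k) kappa (lab (p l) t) (xsection (C l) (lab (p l) t)) else 0)); last first.
  apply/funext => t; case: eqP => [Kk|nKk]; first exact: lj_law_rect.
  by rewrite /lj_law; case: eqP.
apply: measurable_fun_ifT => //; apply: measurable_funeM.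
apply: emeasurable_prod => l.
apply: (@measurableT_comp _ _ _ _ _ _ (fun x => kappa x (xsection (C l) x))).
  by apply: (measurable_fun_xsection_finite_kernel kappa); rewrite inE.
by move=> _ B mB; rewrite setTI; exact: GGlab.
Qed.

Let mlaw p U : measurable U -> measurable_fun setT ((lj_law p) ^~ U).
Proof. by move=> mU; apply: measurable_fun_GG; exact: measurable_lj_law. Qed.

Definition lj_data es t : Z :=
  ((fun l : 'I_k => y es t l), Phi (atoms_unlisted R alive pts es t)).

Lemma measurable_Phi (mu : T -> {measure set X -> \bar R}) D : measurable D ->
  (forall C, measurable C -> measurable_fun setT (mu ^~ C)) ->
  measurable_fun setT (fun t => Phi (mu t) D).
Proof.
move=> mD mmu _ C mC; rewrite setTI.
have [E' sE' E'P] := PhiE (eval_sigma_eval mD mC).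
rewrite (_ : _ @^-1` C = [set t | E' (mu t : set X -> \bar R)]).
  exact: (measurable_eval_sigma (Y := fun t => mu t : set X -> \bar R) mmu).
by apply/seteqP; split => t /E'P.
Qed.

Lemma measurable_lj_data es : measurable_fun setT (lj_data es).
Proof.
apply: measurable_to_lj => [l|D mD]; first exact: my.
apply: measurable_Phi => // C mC.
exact: (measurable_atoms_unlisted MP es mC).
Qed.

(** Each realization with [K t = k] is counted once per ordering, here by permutations and in
    [observed_law] by index lists. Both measures thus have mass [k!] times that of the event. *)
Definition expected_law : {measure set Z -> \bar R} :=
  count_sum (fun p : {perm 'I_k} => bind_measure (mrestr P (mK k)) (mlaw p)).

Definition observed_law : {measure set Z -> \bar R} :=
  count_sum (fun es => push (mrestr P (measurable_listing mDD MP DD0 k es))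
    (measurable_lj_data es)).

Lemma expected_lawE U : measurable U -> expected_law U =
  \sum_(p : {perm 'I_k}) \int[P]_(t in K @^-1` [set k]) lj_law p t U.
Proof.
move=> mU; rewrite /expected_law count_sumE esum_fin//; apply: eq_bigr => p _.
rewrite -(integral_mrestr P (mK k))//; exact: mlaw.
Qed.

Lemma observed_lawE U : observed_law U =
  \esum_(es in [set: seq nat]) P (lj_data es @^-1` U `&` listing k es).
Proof. by rewrite /observed_law count_sumE. Qed.

Let fE (C : 'I_k -> set (L * R)) l z : \bar R := (\1_(C l) (Theta z))%:E.

(** Both sides equal the product of the [m]-masses of the sets [C l], taken over marked atoms, times
    the mass of the void event with [Phi (N t)] in [E]. For the expected law this is
    [symmetric_product], with the kernel integrated by [kappaE]; for the observed law it is the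
    iterated Mecke formula. *)
Lemma rect_laws_eq U : @lj_rects R _ L _ V k U -> expected_law U = observed_law U.
Proof.
move=> rU; rewrite expected_lawE ?observed_lawE; last exact: sub_sigma_algebra.
case: rU => C [E [mC sE UE]].
have mCl l : measurable [set z | C l (Theta z) /\ ~ D0 z.2].
  apply: measurableI; first exact: (measurable_preimage mTheta (mC l)).
  rewrite (_ : (fun z => _) = setT `*` ~` D0); last by apply/seteqP; split => -[? ?] // [].
  by apply: measurableX => //; exact: measurableC.
have iC l : \int[m]_z off (fE C l) z = m [set z | C l (Theta z) /\ ~ D0 z.2].
  rewrite -[X in m X]setIT -integral_indic//; apply: eq_integral => z _.
  rewrite /off /fE !indicE; have [Dz|nDz] := pselect (D0 z.2).
    by rewrite mem_set// memNset// => -[].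
  rewrite (memNset nDz) !mem_asbool; case: asboolP => h; case: asboolP => h' //.
    by case: h'.
  by case: h; case: h'.
have mE' : measurable [set t' | E (Y t')] by exact: measurable_eval_sigma.
have pE : P' [set t' | E (Y t')] \is a fin_num by exact: fin_num_measure.
pose kf l x := kappa x (xsection (C l) x).
have mkf l : measurable_fun setT (kf l).
  by apply: (measurable_fun_xsection_finite_kernel kappa); rewrite inE.
have kfE l : \int[m]_z off (fun z => kf l (Theta z).1) z =
    m [set z | C l (Theta z) /\ ~ D0 z.2] by rewrite kappaE.
have Coo l : m [set z | C l (Theta z) /\ ~ D0 z.2] < +oo.
  apply: le_lt_trans mfin; apply: le_measure; rewrite ?inE//.
    by apply: measurableX => //; exact: measurableC.
  by move=> [x w] [].
transitivity (P' [set t' | E (Y t')] * \sum_(p : {perm 'I_k})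
   \int[P]_(t in K @^-1` [set k]) \prod_(l < k) kf l (lab (p l) t)).
  rewrite ge0_sume_distrr; last first.
    by move=> p _; apply: integral_ge0 => t _; apply: prode_ge0.
  apply: eq_bigr => p _; rewrite -ge0_integralZl//; last 2 first.
  - apply: measurable_funTS; apply: emeasurable_prod => l.
    exact: (measurableT_comp (mkf l)).
  - by move=> t _; apply: prode_ge0.
  by apply: eq_integral => t /set_mem Kk; rewrite UE lj_law_rect.
rewrite symmetric_product//; last by move=> l; rewrite kfE.
under eq_bigr do rewrite kfE.
have [E' sE' E'P] := PhiE sE.
transitivity ((\prod_(l < k) m [set z | C l (Theta z) /\ ~ D0 z.2]) *
    P (void `&` [set t | E' (N t : set X -> \bar R)])).
  rewrite (_ : [set t | E' _] = [set t | E (Phi (N t))]); last first.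
    by apply/seteqP; split => t /E'P.
  by rewrite YE// [LHS]muleC -[LHS]muleA.
under eq_bigr do rewrite -iC.
rewrite -(multivariate_mecke_listing mDD DDT DDI DDgen exF mE MP DD0 sE'); last first.
- by move=> l; rewrite iC.
- by move=> l x w Dw; rewrite /off mem_set.
- move=> l; apply: measurable_off; apply/measurable_EFinP.
  by apply: measurableT_comp => //; exact: measurable_indic.
- by move=> l z; apply: off_ge0 => z'; rewrite lee_fin.
apply: eq_esum => es _.
rewrite -[X in _ = P X]setIT -integral_indic//; last first.
  apply: measurableI; last exact: (measurable_listing mDD MP).
  apply: (measurable_preimage (measurable_lj_data es)).
  by apply: sub_sigma_algebra; exists C, E.
apply: eq_integral => t _; rewrite indicE mem_asbool UE.
case: asboolP => [[lt Et]|nl]; last first.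
  case: asboolP => //= -[[h1 h2] h3]; case: nl; split => //.
  exact/E'P.
have eqf (l : 'I_k) : off (fE C l) (pts (nth 0%N es l) t, A (nth 0%N es l) t) =
    (`[< C l (y es t l) >])%:R%:E.
  rewrite /off /= mem_asbool; case: asboolP => [Dl|_].
    have [sz [_ /(_ (nth 0%N es l))[_]]] := lt.
    by case; rewrite ?mem_nth ?sz.
  by rewrite /fE indicE mem_asbool.
under eq_bigr do rewrite eqf.
case: asboolP => [[[h _] _]|nh].
  by rewrite big1// => l _; rewrite asboolT//; exact: h.
have [l nl] : exists l : 'I_k, ~ C l (y es t l).
  apply: contrapT => h; apply: nh; split => //; split; last exact/E'P.
  by move=> l /=; apply: contrapT => nl; apply: h; exists l.
by rewrite (bigD1 l)//= asboolF// mul0e.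
Qed.

Lemma laws_eq U : measurable U -> expected_law U = observed_law U.
Proof.
have rT := @lj_rectsT R _ L _ V k.
move=> mU; refine (@finite_law_unique _ _ Z _ Z expected_law observed_law Z id id (@lj_rects R _ L _ V k) _ _ _ _ U mU).
- exact: lj_rects_setI.
- rewrite expected_lawE//; apply: lte_sum_pinfty => p _.
  apply: le_lt_trans (mp_fin MP); rewrite -[leRHS]mul1e -integral_cst//.
  rewrite integral_mkcond; apply: ge0_le_integral => //.
  + by move=> t _; rewrite patchE; case: ifP.
  + by apply/(measurable_restrictT _ (mK k)).1; apply: measurable_funTS; exact: mlaw.
  + move=> t _; rewrite patchE; case: ifP => // _; rewrite /lj_law; case: ifP => // _; last exact: lee01.
    by change (P' setT <= 1); rewrite probability_setT.
- exact: (rect_laws_eq rT).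
- move=> U' rU'; have mU' : measurable (U' : set Z) by exact: sub_sigma_algebra.
  by rewrite preimage_id; split => //; exact: rect_laws_eq.
Qed.

End fixed_number.

Variable c : L * R -> set V -> \bar R.
Hypothesis mc : forall D, measurable D -> measurable_fun setT (c ^~ D).
Hypothesis PhiD : {ae P, forall t k es D, listing k es t -> measurable D ->
  Phi (N t) D = Phi (atoms_unlisted R alive pts es t) D + \sum_(l < k) c (y es t l) D}.
Hypothesis GGU : forall S k, <<s GG >> S -> exists2 U, <<s @label_rects _ L k >> U &
  forall t es, listing k es t -> S t <-> U (fun l : 'I_k => (y es t l).1).

Definition posterior_law t (E : set (set V -> \bar R)) : \bar R :=
  P' [set t' | E (fun D => Y t' D + \sum_(l < K t) c (lab l t, J t l t') D)].

(** The sum over the slots does not depend on their order; only the condition [U] on the labels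
    does. *)
Lemma posterior_law_perm k (p : {perm 'I_k}) t U E : eval_sigma E -> K t = k ->
  lj_law p t ([set z | U (fun l => (z.1 l).1)] `&` [set z | E (lj_add c z)]) =
  if `[< U (fun l : 'I_k => lab (p l) t) >] then posterior_law t E else 0.
Proof.
move=> sE Kk; subst k; rewrite /lj_law eqxx pushE.
case: asboolP => [Ut|nU]; last first.
  by rewrite -[RHS](measure0 P'); congr (P' _); rewrite -subset0 => t' [].
congr (P' _); apply/seteqP; split => t' /=.
  case=> _; rewrite (_ : lj_add _ _ = (fun D => Y t' D + \sum_(l < K t) c (lab l t, J t l t') D))//.
  apply/funext => D; rewrite /lj_add /=; congr (_ + _).
  by rewrite [RHS](reindex_perm p) /=; apply: eq_bigr => l _; rewrite eqxx ltn_ord.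
move=> h; split => //.
rewrite (_ : lj_add _ _ = (fun D => Y t' D + \sum_(l < K t) c (lab l t, J t l t') D))//.
apply/funext => D; rewrite /lj_add /=; congr (_ + _).
by rewrite [RHS](reindex_perm p) /=; apply: eq_bigr => l _; rewrite eqxx ltn_ord.
Qed.

Lemma measurable_posterior_law E : eval_sigma E ->
  measurable_fun setT ((posterior_law ^~ E) : TZ -> \bar R).
Proof.
move=> sE _ C mC; rewrite setTI.
pose q k t := @lj_law k 1%g t ([set z | [set: 'I_k -> L] (fun l => (z.1 l).1)] `&`
  [set z | E (lj_add c z)]).
have qE k t : K t = k -> q k t = posterior_law t E.
  move=> Kk; have := @posterior_law_perm k 1%g t setT E sE Kk.
  by rewrite asboolT.
rewrite (_ : _ @^-1` C = \bigcup_k (K @^-1` [set k] `&` q k @^-1` C)).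
  apply: bigcupT_measurable => k; apply: measurableI; first exact: GGK.
  rewrite -[X in measurable X]setTI; apply: measurable_lj_law => //.
  apply: measurableI; last exact: measurable_lj_add.
  exact: measurableT.
apply/seteqP; split => t.
  by move=> Ct; exists (K t) => //; split => //; rewrite /preimage/= qE.
by move=> [k _ [Kk]]; rewrite /preimage/= qE.
Qed.

Let lab_perm k (p : {perm 'I_k}) : {ae P, forall t, K t = k ->
  exists2 es, listing k es t & forall l : 'I_k, lab (p l) t = (y es t l).1}.
Proof.
apply: filterS aeK => t [e [en labE]] Kk; subst k.
exists [seq e (p l) | l <- enum 'I_(K t)].
  split; first by rewrite size_map size_enum_ord.
  apply: enum_fun_seq; case: en => ei en; split; first by move=> i j /ei/perm_inj.
  move=> n; rewrite en; split => -[l <-]; last by exists (p l).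
  by exists (p^-1%g l); rewrite permKV.
move=> l; rewrite labE /y (nth_map l) ?size_enum_ord//.
by rewrite nth_ord_enum.
Qed.

(** On every listing, in whatever order, [S] is the condition [U] on the labels. So [Gset] has
    observed mass [k!] times the left side and expected mass [k!] times the right side, and
    [laws_eq] applies. *)
Lemma posterior_law_fixed k S E : <<s GG >> S -> eval_sigma E ->
  P (K @^-1` [set k] `&` S `&` [set t | E (Phi (N t))]) =
  \int[P]_(t in K @^-1` [set k] `&` S) posterior_law t E.
Proof.
move=> sS sE; have mS := measurable_GG sS.
have mpost : measurable_fun setT (posterior_law ^~ E).
  by apply: measurable_fun_GG; exact: measurable_posterior_law.
have mPhi : measurable [set t | E (Phi (N t))].
  apply: (measurable_eval_sigma (Y := fun t => Phi (N t)) _ sE) => D mD.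
  by apply: measurable_Phi => // C mC; exact: measurable_atoms.
have [U sU SU] := GGU k sS.
pose Gset : set (('I_k -> L * R) * (set V -> \bar R)) :=
  [set z | U (fun l => (z.1 l).1)] `&` [set z | E (lj_add c z)].
have mG : measurable (Gset : set (g_sigma_algebraType (@lj_rects R _ L _ V k))).
  by apply: measurableI; [exact: measurable_lj_label|exact: measurable_lj_add].
have kf0 : (0 < #|{perm 'I_k}|%:R%:E :> \bar R).
  by rewrite lte_fin ltr0n; apply/card_gt0P; exists 1%g.
suff kE : #|{perm 'I_k}|%:R%:E * P (K @^-1` [set k] `&` S `&` [set t | E (Phi (N t))]) =
    #|{perm 'I_k}|%:R%:E * \int[P]_(t in K @^-1` [set k] `&` S) posterior_law t E.
  have lm := lee_pmul2l (isT : #|{perm 'I_k}|%:R%:E \is a fin_num) kf0.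
  by apply/eqP; rewrite eq_le -[X in X && _]lm -[X in _ && X]lm kE lexx.
transitivity (observed_law k Gset); last first.
  rewrite -laws_eq// expected_lawE//.
  rewrite -sume_const; last by apply: integral_ge0.
  apply: eq_bigr => p _.
  rewrite integral_mkcond [RHS]integral_mkcond; apply: ge0_ae_eq_integral => //.
  - apply/(measurable_restrictT _ (mK k)).1; apply: measurable_funTS; apply: measurable_fun_GG.
    exact: measurable_lj_law.
  - by apply/(measurable_restrictT _ _).1; [exact: measurableI|exact: measurable_funTS].
  - by move=> t _; rewrite patchE; case: ifP.
  - by move=> t _; rewrite patchE; case: ifP.
  apply: filterS (lab_perm p) => t h _; rewrite !patchE !mem_asbool.
  case: asboolP => [Kk|nKk]; last by case: asboolP => // -[].
  have [es les labE] := h Kk; rewrite posterior_law_perm//.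
  have -> : (fun l => lab (p l) t) = (fun l : 'I_k => (y es t l).1).
    by apply/funext => l; rewrite labE.
  case: asboolP => [/(SU _ _ les) St|nU]; case: asboolP => // h'.
    by case: h'.
  by case: nU; apply/(SU _ _ les); case: h'.
rewrite observed_lawE -sume_const//.
have mI : measurable (S `&` [set t | E (Phi (N t))]) by exact: measurableI.
transitivity (\sum_(p : {perm 'I_k}) \int[P]_(t in K @^-1` [set k])
    (\1_(S `&` [set t | E (Phi (N t))]) t)%:E).
  by apply: eq_bigr => p _; rewrite integral_indic// [in RHS]setIC setIA.
rewrite -(esum_listing mDD MP DD0 mK aeK0
  (H := fun es t => (\1_(S `&` [set t | E (Phi (N t))]) t)%:E)); last 5 first.
- by move=> es t; rewrite lee_fin.
- by move=> p t; rewrite lee_fin.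
- by move=> es; apply/measurable_EFinP; exact: measurable_indic.
- by move=> es; apply/measurable_EFinP; exact: measurable_indic.
- apply: filterS aeK => t [e [en labE]] Kk; subst k; exists e; split => //.
apply: eq_esum => es _; have ml := measurable_listing mDD MP DD0 k es.
rewrite integral_indic//; apply: eq_measure_ae.
- exact: measurableI.
- by apply: measurableI => //; exact: (measurable_preimage (measurable_lj_data es)).
apply: filterS PhiD => t h.
have EE : listing k es t -> E (Phi (N t)) <-> E (lj_add c (lj_data k es t)).
  move=> lt; rewrite (eval_sigma_ext sE (m' := Phi (N t)))//.
  by move=> D mD; rewrite (h k es).
split => [[[St Et] lt]|[[Ut Et] lt]]; split => //.
  by split; [exact/(SU _ _ lt)|exact/EE].
by split; [exact/(SU _ _ lt)|exact/EE].
Qed.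

Lemma posterior_law_correct S E : <<s GG >> S -> eval_sigma E ->
  P (S `&` [set t | E (Phi (N t))]) = \int[P]_(t in S) posterior_law t E.
Proof.
move=> sS sE; have mS := measurable_GG sS.
have mpost : measurable_fun setT (posterior_law ^~ E).
  by apply: measurable_fun_GG; exact: measurable_posterior_law.
have mPhi : measurable [set t | E (Phi (N t))].
  apply: (measurable_eval_sigma (Y := fun t => Phi (N t)) _ sE) => D mD.
  by apply: measurable_Phi => // C mC; exact: measurable_atoms.
have SE : S = \bigcup_k (K @^-1` [set k] `&` S).
  by apply/seteqP; split => [t St|t [k _ []]//]; exists (K t).
have mKS k : measurable (K @^-1` [set k] `&` S) by exact: measurableI.
have tKS : trivIset setT (fun k => K @^-1` [set k] `&` S).
  by move=> i j _ _ [t [[/= <- _] [<- _]]].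
rewrite [in RHS]SE ge0_integral_bigcup//; last exact: measurable_funTS.
rewrite [in LHS]SE setI_bigcupl measure_bigcup//.
- transitivity (\sum_(k <oo) P (K @^-1` [set k] `&` S `&` [set t | E (Phi (N t))])).
    by apply: eq_eseriesl => k; rewrite mem_setT.
  by apply: eq_eseriesr => k _; exact: posterior_law_fixed.
- by move=> k _; exact: measurableI.
- by move=> i j _ _ [t [[[/= <- _] _] [[<- _] _]]].
Qed.

End compound.
End posterior.

(** * Finiteness of the intensity of the marked atoms *)

Section marked_mass.
Context (R : realType) d (X : measurableType d) dW (W : measurableType dW).
Variables (g : R.-pker X ~> W) (DD : set (set W)).
Hypotheses (mDD : DD `<=` measurable) (DDT : DD setT) (DDI : setI_closed DD)
  (DDgen : measurable = <<s DD >>).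
Variables (nu : {measure set X -> \bar R}) (F : nat -> set X).
Hypothesis exF : exhausts nu F.
Variable m : {measure set (X * W) -> \bar R}.
Hypothesis mE : forall C D, measurable C -> DD D ->
  m (C `*` D) = \int[nu]_(x in C) g x D.
Context d' (T : measurableType d') (P : {measure set T -> \bar R}).
Variables (alive : nat -> T -> bool) (pts : nat -> T -> X) (A : nat -> T -> W).
Hypothesis MP : marked_poisson g DD nu P alive pts A.
Variable D0 : set W.
Hypothesis DD0 : DD D0.

(* Otherwise no atom outside [D0] is ever found with probability zero, and then
   by Mecke's formula neither are [k] of them in a set of finite intensity. *)
Lemma marked_mass_fin : 0 < P setT ->
  {ae P, forall t, exists k (e : 'I_k -> nat), enum_fun D0 (alive ^~ t) (A ^~ t) e} ->
  m (setT `*` ~` D0) < +oo.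
Proof.
move=> P0 aeK; rewrite ltNge leye_eq; apply/negP => /eqP moo.
have [mF ndF FT Foo] := exF.
have mnD0 : measurable (~` D0) by apply: measurableC; exact: mDD.
have [mpts mA] := (mp_pts MP, mp_marks MP).
have void0 : P (void_marks D0 alive A) = 0.
  by rewrite (void_mass mDD DDT DDI DDgen exF mE MP DD0) moo /= mule0.
pose B es p := [set t | listing alive A D0 (size es) es t /\
  forall l : 'I_(size es), F p (pts (nth 0%N es l) t)].
pose f p z : \bar R := (\1_(F p `*` ~` D0) z)%:E.
have mB es p : measurable (B es p).
  apply: measurableI; first exact: (measurable_listing mDD MP DD0).
  rewrite (_ : (fun t => _) = \bigcap_(l in [set: 'I_(size es)])
      (pts (nth 0%N es l) @^-1` F p)); last first.
    by apply/seteqP; split => t /= h l; [move=> _|]; exact: h.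
  apply: fin_bigcap_measurable => // l _; exact: measurable_preimage.
(* The restriction to [F p] keeps the test functions integrable while the full marked mass is
   supposed infinite. *)
have B0 es p : P (B es p) = 0.
  have := multivariate_mecke_listing mDD DDT DDI DDgen exF mE MP DD0
    (f := fun _ : 'I_(size es) => f p) (@eval_sigmaT R _ X).
  rewrite setIT void0 mule0 => h.
  apply/eqP; rewrite eq_le measure_ge0 andbT -[leRHS]h.
  - apply: esum_ge; exists [set es]; first by split => //; exact: finite_set1.
    rewrite fsbig_set1 -[X in P X]setIT -integral_indic//.
    apply: ge0_le_integral => //.
    + by apply/measurable_EFinP; exact: measurable_indic.
    + apply: measurable_fun_ifT => //.
        apply: (measurable_fun_bool true); rewrite setTI.
        rewrite (_ : _ @^-1` _ = listing alive A D0 (size es) es).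
          exact: (measurable_listing mDD MP DD0).
        by apply/seteqP; split => t /= => [/asboolP[]|lt] //; apply/asboolP; split.
      apply: emeasurable_prod => l; apply: measurableT_comp.
        by apply/measurable_EFinP; apply: measurable_indic; exact: measurableX.
      exact: measurable_fun_pair.
    move=> t _; rewrite indicE mem_asbool; case: asboolP => [[lt Ft]|_]; last first.
      by case: ifP => // _; apply: prode_ge0 => l _; rewrite lee_fin.
    rewrite asboolT// big1// => l _; rewrite /f indicE mem_set//; split; first exact: Ft.
    by have [_ [_ /(_ (nth 0%N es l))[_]]] := lt; case; rewrite ?mem_nth.
  - by move=> l z; rewrite lee_fin.
  - by move=> l; apply/measurable_EFinP; apply: measurable_indic; exact: measurableX.
  - by move=> l x w Dw; rewrite /f indicE memNset// => -[].
  - move=> l; rewrite integral_indic ?setIT//; last exact: measurableX.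
    rewrite (le_lt_trans _ (Foo p))// -(marked_setT DDT mE (mF p)).
    by apply: le_measure; rewrite ?inE; [exact: measurableX|exact: measurableX|move=> [x w] []].
(* The countably many null events [B es p] cover almost every realization, since a finite listing
   has its atoms in some [F p]. *)
have : P.-negligible [set: T].
  have nB : P.-negligible (\bigcup_n \bigcup_p
      (if @pickle_inv (seq nat) n is Some es then B es p else set0)).
    apply: negligible_bigcup => n; apply: negligible_bigcup => p.
    case: pickle_inv => [es|]; last exact: negligible_set0.
    by exists (B es p); split.
  have [M [mM M0 nM]] := aeK.
  have nM' : P.-negligible M by exists M; split.
  apply: (negligibleS _ (negligibleU nB nM')).
  move=> t _; have [Mt|nMt] := pselect (M t); first by right.
  left; have [k [e en]] : exists k (e : 'I_k -> nat), enum_fun D0 (alive ^~ t) (A ^~ t) e.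
    by apply: contrapT => h; apply: nMt; exact: nM.
  pose es := [seq e l | l <- enum 'I_k].
  have [p Fp] : exists p, forall n, n \in es -> F p (pts n t).
    elim: es => [|n es [p Fp]]; first by exists 0%N.
    have : (\bigcup_p F p) (pts n t) by rewrite FT.
    move=> [q _ Fq]; exists (maxn p q) => n'; rewrite in_cons => /orP[/eqP->|/Fp].
      by move/subsetPset : (ndF _ _ (leq_maxr p q)); exact.
    by move/subsetPset : (ndF _ _ (leq_maxl p q)); exact.
  exists (pickle es) => //; exists p => //; rewrite pickleK_inv; split.
    by split => //; exact: enum_fun_seq.
  by move=> l; apply: Fp; rewrite mem_nth.
move/negligibleP => /(_ measurableT) PT.
by rewrite PT ltxx in P0.
Qed.
End marked_mass.

(** * Product marks over a Levy intensity *)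

Section pullback_kernel.
Context (R : realType) d (X : measurableType d) d' (Y : measurableType d')
  d'' (Z : measurableType d'').
Variables (k : R.-pker Y ~> Z) (s : X -> Y).
Hypothesis ms : measurable_fun setT s.

Definition kpull_fun (x : X) : {measure set Z -> \bar R} := k (s x).

Let measurable_kpull U : measurable U -> measurable_fun setT (kpull_fun ^~ U).
Proof.
move=> mU; apply: (@measurableT_comp _ _ _ _ _ _ (k ^~ U)) => //.
exact: measurable_kernel.
Qed.

HB.instance Definition _ := isKernel.Build _ _ _ _ _ kpull_fun measurable_kpull.

Let kpull_prob x : kpull_fun x setT = 1.
Proof. exact: prob_kernel. Qed.

HB.instance Definition _ := Kernel_isProbability.Build _ _ _ _ _ kpull_fun kpull_prob.

Definition kpull : R.-pker X ~> Z := kpull_fun.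

End pullback_kernel.

(** * Powers of a kernel as iterated integrals *)

Section tuple_integral.
Context (R : realType) (q : nat).
Local Notation V := (q.-tuple R).
Implicit Types (n : nat).

Lemma tuple_integral_ge0 n (mu : {measure set V -> \bar R}) (f : n.-tuple V -> \bar R) :
  (forall u, 0 <= f u) -> 0 <= tuple_integral mu f.
Proof.
elim: n f => [|n IH] f f0 /=; first exact: f0.
by apply: integral_ge0 => v _; exact: IH.
Qed.

Lemma measurable_cons_tuple n (v : V) :
  measurable_fun setT (fun u : n.-tuple V => cons_tuple v u).
Proof. by apply: measurable_cons => //; exact: measurable_cst. Qed.

Lemma tuple_integral0 n (mu : {measure set V -> \bar R}) :
  tuple_integral mu (fun _ : n.-tuple V => 0) = 0.
Proof. by elim: n => [//|n IH] /=; under eq_integral do rewrite IH; exact: integral0. Qed.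

Variable G : R.-pker R ~> V.

(** The parameter space is arbitrary because, in the induction, the outer coordinate becomes part of
    the parameter. *)
Lemma measurable_tuple_integral n d (Z : measurableType d) (s : Z -> R)
    (f : Z * n.-tuple V -> \bar R) :
  measurable_fun setT s -> (forall y, 0 <= f y) -> measurable_fun setT f ->
  measurable_fun setT (fun z => tuple_integral (G (s z)) (fun u => f (z, u))).
Proof.
elim: n d Z s f => [|n IH] d Z s f ms f0 mf /=.
  by apply: (measurableT_comp mf); exact: measurable_fun_pair.
pose F (zv : Z * V) := tuple_integral (G (s zv.1)) (fun u => f (zv.1, cons_tuple zv.2 u)).
have mF : measurable_fun setT F.
  apply: (IH _ _ (s \o fst) (fun y : (Z * V) * n.-tuple V => f (y.1.1, cons_tuple y.1.2 y.2))) => //.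
    exact: measurableT_comp.
  apply: (measurableT_comp mf); apply: measurable_fun_pair.
    exact: measurableT_comp.
  by apply: measurable_cons => //; exact: measurableT_comp.
apply: (@measurable_fun_integral_finite_kernel _ _ _ _ _ F (kpull G ms)) => //.
by move=> z; exact: tuple_integral_ge0.
Qed.

Lemma measurable_tuple_integral1 n s (f : n.+1.-tuple V -> \bar R) :
  (forall y, 0 <= f y) -> measurable_fun setT f ->
  measurable_fun setT (fun v => tuple_integral (G s) (fun u => f (cons_tuple v u))).
Proof.
move=> f0 mf; apply: (measurable_tuple_integral (s := cst s)
  (f := fun y => f (cons_tuple y.1 y.2))) => //.
by apply: (measurableT_comp mf); exact: measurable_cons.
Qed.

Lemma tuple_integral_nneseries n s (f : nat -> n.-tuple V -> \bar R) :
  (forall k u, 0 <= f k u) -> (forall k, measurable_fun setT (f k)) ->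
  tuple_integral (G s) (fun u => \sum_(k <oo) f k u) =
  \sum_(k <oo) tuple_integral (G s) (f k).
Proof.
elim: n f => [//|n IH] f f0 mf /=.
rewrite -integral_nneseries//; last 2 first.
- by move=> k; exact: measurable_tuple_integral1.
- by move=> k v _; exact: tuple_integral_ge0.
apply: eq_integral => v _; rewrite -IH// => k.
by apply: (measurableT_comp (mf k)); exact: measurable_cons_tuple.
Qed.

Lemma eq_tuple_integral n (mu : {measure set V -> \bar R}) (f f' : n.-tuple V -> \bar R) :
  f =1 f' -> tuple_integral mu f = tuple_integral mu f'.
Proof. by move=> /funext ->. Qed.

Lemma tuple_integral_cst n s (c : \bar R) :
  tuple_integral (G s) (fun _ : n.-tuple V => c) = c.
Proof.
elim: n => [//|n IH] /=; under eq_integral do rewrite IH.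
by rewrite integral_cst// prob_kernel mule1.
Qed.

Lemma tuple_integralD n s (f g : n.-tuple V -> \bar R) :
  (forall u, 0 <= f u) -> (forall u, 0 <= g u) ->
  measurable_fun setT f -> measurable_fun setT g ->
  tuple_integral (G s) (fun u => f u + g u) =
  tuple_integral (G s) f + tuple_integral (G s) g.
Proof.
elim: n f g => [//|n IH] f g f0 g0 mf mg /=.
rewrite -ge0_integralD//; first last.
- exact: measurable_tuple_integral1.
- by move=> v _; exact: tuple_integral_ge0.
- exact: measurable_tuple_integral1.
- by move=> v _; exact: tuple_integral_ge0.
apply: eq_integral => v _; rewrite IH//.
- by apply: (measurableT_comp mf); exact: measurable_cons_tuple.
- by apply: (measurableT_comp mg); exact: measurable_cons_tuple.
Qed.

Lemma tuple_integralZ n s (c : \bar R) (f : n.-tuple V -> \bar R) : 0 <= c ->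
  (forall u, 0 <= f u) -> measurable_fun setT f ->
  tuple_integral (G s) (fun u => c * f u) = c * tuple_integral (G s) f.
Proof.
elim: n f => [//|n IH] f c0 f0 mf /=.
rewrite -ge0_integralZl//; first last.
- by move=> v _; exact: tuple_integral_ge0.
- exact: measurable_tuple_integral1.
apply: eq_integral => v _; rewrite IH//.
by apply: (measurableT_comp mf); exact: measurable_cons_tuple.
Qed.

Lemma le_tuple_integral n s (f g : n.-tuple V -> \bar R) :
  (forall u, 0 <= f u) -> measurable_fun setT f -> measurable_fun setT g ->
  (forall u, f u <= g u) -> tuple_integral (G s) f <= tuple_integral (G s) g.
Proof.
elim: n f g => [|n IH] f g f0 mf mg fg /=; first exact: fg.
have g0 u : 0 <= g u := le_trans (f0 u) (fg u).
apply: ge0_le_integral => //.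
- by move=> v _; exact: tuple_integral_ge0.
- exact: measurable_tuple_integral1.
- exact: measurable_tuple_integral1.
move=> v _; apply: IH => //.
- by apply: (measurableT_comp mf); exact: measurable_cons_tuple.
- by apply: (measurableT_comp mg); exact: measurable_cons_tuple.
Qed.

Lemma tuple_integral_limn n s (f : nat -> n.-tuple V -> \bar R) :
  (forall k u, 0 <= f k u) -> (forall k, measurable_fun setT (f k)) ->
  (forall u, nondecreasing_seq (f ^~ u)) ->
  tuple_integral (G s) (fun u => limn (f ^~ u)) =
  limn (fun k => tuple_integral (G s) (f k)).
Proof.
elim: n f => [//|n IH] f f0 mf ndf /=.
have mfc k v : measurable_fun setT (fun u => f k (cons_tuple v u)).
  by apply: (measurableT_comp (mf k)); exact: measurable_cons_tuple.
rewrite -monotone_convergence//.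
- by apply: eq_integral => v _; rewrite IH.
- by move=> k; exact: measurable_tuple_integral1.
- by move=> k v _; exact: tuple_integral_ge0.
- by move=> v _ j k jk; apply: le_tuple_integral => // u; exact: ndf.
Qed.

Section tuple_kernel.
Variable n : nat.

(** The [n]-fold product of [G s], defined so that integrals against it are iterated integrals
    ([integral_tuple_kernel]). *)
Definition tpow s (U : set (n.-tuple V)) : \bar R :=
  tuple_integral (G s) (fun u => (\1_U u)%:E).

Let tpow0 s : tpow s set0 = 0.
Proof.
by rewrite /tpow -[RHS](tuple_integral_cst n s 0); apply: eq_tuple_integral => u; rewrite indic0.
Qed.

Let tpow_ge0 s U : 0 <= tpow s U.
Proof. by apply: tuple_integral_ge0 => u; rewrite lee_fin. Qed.

Let tpow_sigma_additive s : semi_sigma_additive (tpow s).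
Proof.
move=> U mU tU mUU.
have <- : \sum_(k <oo) tpow s (U k) = tpow s (\bigcup_k U k).
  rewrite /tpow -tuple_integral_nneseries.
  - apply: eq_tuple_integral => u.
    have := @measure_semi_bigcup _ _ _ (\d_u : {measure set (n.-tuple V) -> \bar R}) U mU tU mUU.
    by rewrite /= /dirac => ->.
  - by move=> k u; rewrite lee_fin.
  - by move=> k; apply/measurable_EFinP; exact: measurable_indic.
by apply: is_cvg_ereal_nneg_natsum => k _.
Qed.

HB.instance Definition _ s := isMeasure.Build _ _ _ (tpow s)
  (tpow0 s) (tpow_ge0 s) (@tpow_sigma_additive s).

Definition tpow_measure s : {measure set (n.-tuple V) -> \bar R} := tpow s.

Let measurable_tpow U : measurable U -> measurable_fun setT (tpow_measure ^~ U).
Proof.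
move=> mU; apply: (measurable_tuple_integral (s := id) (f := fun y => (\1_U y.2)%:E)) => //.
apply/measurable_EFinP; apply: (measurableT_comp (measurable_indic mU)) => //.
Qed.

HB.instance Definition _ := isKernel.Build _ _ _ _ _ tpow_measure measurable_tpow.

Let tpow_prob s : tpow_measure s setT = 1.
Proof.
rewrite /tpow_measure /= /tpow -[RHS](tuple_integral_cst n s).
by apply: eq_tuple_integral => u; rewrite indicE in_setT.
Qed.

HB.instance Definition _ := Kernel_isProbability.Build _ _ _ _ _ tpow_measure tpow_prob.

Definition tuple_kernel : R.-pker R ~> n.-tuple V := tpow_measure.

Lemma integral_tuple_kernel s f : (forall u, 0 <= f u) -> measurable_fun setT f ->
  \int[tuple_kernel s]_u f u = tuple_integral (G s) f.
Proof.
move=> f0 mf; symmetry.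
apply: (ge0_integral_functional (L := fun f => tuple_integral (G s) f)) => //.
- by move=> c h c0 h0 mh; apply: tuple_integralZ.
- by move=> g h g0 h0 mg mh; exact: tuple_integralD.
- by move=> u u0 mu ndu; exact: tuple_integral_limn.
Qed.

End tuple_kernel.

Lemma tuple_integral_prod n (mu : {measure set V -> \bar R}) (D : 'I_n -> set V) :
  (forall i, measurable (D i)) ->
  tuple_integral mu (fun u : n.-tuple V => \prod_(i < n) (\1_(D i) (tnth u i))%:E) =
  \prod_(i < n) mu (D i).
Proof.
elim: n D => [|n IH] D mD /=; first by rewrite !big_ord0.
rewrite big_ord_recl -(IH (fun i => D (lift ord0 i)))//.
set X := (X in _ = _ * X).
have X0 : 0 <= X by apply: tuple_integral_ge0 => u; apply: prode_ge0 => i _; rewrite lee_fin.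
transitivity (\int[mu]_v (X * (\1_(D ord0) v)%:E)).
  apply: eq_integral => v _; rewrite /X indicE mem_asbool; case: asboolP => Dv.
    rewrite mule1; apply: eq_tuple_integral => u.
    rewrite big_ord_recl tnth0 indicE mem_set// mul1e; apply: eq_bigr => i _.
    by rewrite tnthS.
  rewrite mule0 -[RHS](tuple_integral0 n mu); apply: eq_tuple_integral => u.
  by rewrite big_ord_recl tnth0 indicE memNset// mul0e.
rewrite ge0_integralZl//.
- by rewrite integral_indic// setIT muleC.
- by apply/measurable_EFinP; exact: measurable_indic.
Qed.

Section posterior_density.
Variable s : R.
Hypothesis c0 : (0 < 1 - pi_A G s)%R.
Let c := (1 - pi_A G s)%R.

Lemma measurable_zeroV : measurable [set zeroV R q].
Proof. by rewrite -[X in measurable X]setCK; apply: measurableC; exact: measurable_nonzero. Qed.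

Lemma kernel_nonzero : G s (~` [set zeroV R q]) = (pi_A G s)%:E.
Proof.
rewrite /pi_A fineK// ge0_fin_numE//; apply: (@le_lt_trans _ _ (G s setT)).
  by apply: le_measure; rewrite ?inE//; exact: measurable_nonzero.
by rewrite prob_kernel ltry.
Qed.

Lemma kernel_zero : G s [set zeroV R q] = c%:E.
Proof.
have /= := @measureU _ _ _ (G s) _ _ measurable_zeroV (@measurable_nonzero R q).
rewrite setUCr prob_kernel kernel_nonzero => /(_ (setICr _)) e.
have fz : G s [set zeroV R q] \is a fin_num.
  rewrite ge0_fin_numE//; apply: (@le_lt_trans _ _ (G s setT)).
    by apply: le_measure; rewrite ?inE//; exact: measurable_zeroV.
  by rewrite prob_kernel ltry.
move: e; rewrite -(fineK fz) -EFinD => -[e]; congr (_%:E); rewrite /c e; ring.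
Qed.

(** [G s] has mass exactly [1 - pi_A G s] at zero, so the unit mass of [h_A] there is also [G s]
    divided by [1 - pi_A G s]. As a whole, [h_A] is a multiple of [G s]. *)
Lemma h_AE U : measurable U -> h_A G s U = (c^-1)%:E * G s U.
Proof.
move=> mU; have -> : h_A G s U = \d_(zeroV R q) U +
    (`|c|^-1)%:E * G s (U `&` ~` [set zeroV R q]).
  exact: measure_addE.
rewrite gtr0_norm// diracE.
have GU : G s U = G s (U `&` [set zeroV R q]) + G s (U `&` ~` [set zeroV R q]).
  rewrite -measureU.
  - by rewrite -setIUr setUCr setIT.
  - by apply: measurableI => //; exact: measurable_zeroV.
  - by apply: measurableI => //; exact: measurable_nonzero.
  - by rewrite -subset0 => v [[_ z] [_ nz]].
rewrite GU ge0_muleDr// mem_asbool; congr (_ + _); case: asboolP => U0.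
  rewrite (_ : U `&` _ = [set zeroV R q]); last first.
    by apply/seteqP; split => v //= [// ->]; split.
  by rewrite kernel_zero -EFinM mulVf// gt_eqF.
rewrite (_ : U `&` _ = set0) ?measure0 ?mule0//.
by rewrite -subset0 => v [Uv /= vz]; rewrite vz in Uv.
Qed.

Lemma integral_h_A f : (forall v, 0 <= f v) -> measurable_fun setT f ->
  \int[h_A G s]_v f v = (c^-1)%:E * \int[G s]_v f v.
Proof.
move=> f0 mf; have ci : (0 <= c^-1)%R by rewrite invr_ge0 ltW.
rewrite -(@ge0_integral_mscale _ _ _ (G s) setT measurableT (NngNum ci))//.
by apply: eq_measure_integral => U mU _; rewrite h_AE.
Qed.

Lemma tuple_integral_h_AV n (f : n.-tuple V -> \bar R) : (forall u, 0 <= f u) ->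
  measurable_fun setT f ->
  tuple_integral (h_A G s) f = (c^-1 ^+ n)%:E * tuple_integral (G s) f.
Proof.
elim: n f => [|n IH] f f0 mf /=; first by rewrite expr0 mul1e.
under eq_integral => v _.
  rewrite IH//; last by apply: (measurableT_comp mf); exact: measurable_cons_tuple.
  over.
have ci : (0 <= c^-1 ^+ n)%R by rewrite exprn_ge0// invr_ge0 ltW.
have mF : measurable_fun setT (fun v => tuple_integral (G s) (fun u => f (cons_tuple v u))).
  exact: measurable_tuple_integral1.
rewrite integral_h_A; last 2 first.
- by move=> v; rewrite mule_ge0// ?lee_fin//; exact: tuple_integral_ge0.
- exact: measurable_funeM.
rewrite ge0_integralZl//; last by move=> v _; exact: tuple_integral_ge0.
by rewrite muleA -EFinM -exprS.
Qed.

(** The normalizations of the [n] measures cancel the power of [c]. This is the passage between the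
    intensity of the marked process and the formulas with [rho_post] and [h_A]. *)
Lemma tuple_integral_h_A n (f : n.-tuple V -> \bar R) : (forall u, 0 <= f u) ->
  measurable_fun setT f ->
  (c ^+ n)%:E * tuple_integral (h_A G s) f = tuple_integral (G s) f.
Proof.
move=> f0 mf; rewrite tuple_integral_h_AV// muleA -EFinM -exprMn mulfV ?gt_eqF//.
by rewrite expr1n mul1e.
Qed.

End posterior_density.
End tuple_integral.

Lemma measure_integral_indic (R : realType) d (T : measurableType d)
    (mu : {measure set T -> \bar R}) U : measurable U ->
  mu U = \int[mu]_z (\1_U z)%:E.
Proof. by move=> mU; rewrite integral_indic// setIT. Qed.

Section tuple_rectangles.
Context d (V : measurableType d) (M : nat).

(** The pi-system [DD] of the model: [iid_IBP_marks] gives the law of the values on product sets. *)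
Definition tuple_rects : set (set (M.-tuple V)) :=
  [set U | exists2 D : 'I_M -> set V, forall i, measurable (D i) &
     U = [set u | forall i, D i (tnth u i)]].

Lemma tuple_rects_measurable : tuple_rects `<=` measurable.
Proof.
move=> _ [D mD ->].
rewrite (_ : [set u | _] = \bigcap_(i in [set: 'I_M]) ((@tnth M V)^~ i @^-1` D i)).
  apply: fin_bigcap_measurable => // i _.
  by apply: measurable_preimage => //; exact: measurable_tnth.
by apply/seteqP; split => u h i; [move=> _|]; exact: h.
Qed.

Lemma tuple_rectsT : tuple_rects setT.
Proof. by exists (fun=> setT) => //; apply/seteqP; split. Qed.

Lemma tuple_rects_setI : setI_closed tuple_rects.
Proof.
move=> _ _ [D mD ->] [D' mD' ->]; exists (fun i => D i `&` D' i).
  by move=> i; exact: measurableI.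
apply/seteqP; split => u /=; first by move=> [h h'] i; split.
by move=> h; split => i; case: (h i).
Qed.

Lemma measurable_tuple_rects : @measurable _ (M.-tuple V) = <<s tuple_rects >>.
Proof.
apply/seteqP; split; last first.
  by apply: smallest_sub; [exact: sigma_algebra_measurable|exact: tuple_rects_measurable].
suff : measurable_fun setT (id : g_sigma_algebraType tuple_rects -> M.-tuple V).
  by move=> h U mU; have := h measurableT U mU; rewrite setTI preimage_id.
apply/measurable_fun_tnthP => i _ C mC; rewrite setTI.
apply: sub_sigma_algebra; exists (fun j => if j == i then C else setT).
  by move=> j; case: ifP.
apply/seteqP; split => u /=; last by move=> /(_ i); rewrite eqxx.
by move=> Cu j; case: eqP => // ->.
Qed.

End tuple_rectangles.

(** * The Levy intensity as a sigma-finite measure *)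

Section instance.
Context (R : realType) (Omega : ptopologicalType).
Variables (B0 : probability (borel Omega) R) (rho : R -> Omega -> R).
Local Notation X := (R * borel Omega)%type.
Hypothesis mrho : measurable_fun setT (fun x : X => rho x.1 x.2).
Hypothesis rho0 : forall s w, (0 < s)%R -> (0 <= rho s w)%R.

Definition pos_density (x : X) : \bar R := if (0 < x.1)%R then (rho x.1 x.2)%:E else 0.

Lemma pos_density_ge0 x : 0 <= pos_density x.
Proof. by rewrite /pos_density; case: ifP => // s0; rewrite lee_fin rho0. Qed.

Lemma measurable_pos_density : measurable_fun setT pos_density.
Proof.
apply: measurable_fun_ifT; [|exact/measurable_EFinP|exact: measurable_cst].
by apply: measurable_fun_ltr => //; exact: measurable_fst.
Qed.

Let gw0 w s : 0 <= pos_density (s, w).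
Proof. exact: pos_density_ge0. Qed.

Let mgw w : measurable_fun setT (fun s : R => pos_density (s, w)).
Proof. by apply: (measurableT_comp measurable_pos_density); exact: measurable_pair2. Qed.

Let mpair (w : borel Omega) : measurable_fun setT (fun s : R => (s, w)).
Proof. exact: measurable_pair2. Qed.

Definition levy_section w : {measure set X -> \bar R} :=
  push (density (@lebesgue_measure R) (gw0 w) (mgw w)) (mpair w).

Lemma levy_sectionE w U : measurable U -> levy_section w U =
  \int[lebesgue_measure]_s ((\1_U (s, w))%:E * pos_density (s, w)).
Proof.
move=> mU; rewrite (measure_integral_indic (levy_section w) mU) integral_push; last 2 first.
- by move=> z; rewrite lee_fin.
- by apply/measurable_EFinP; exact: measurable_indic.
rewrite integral_density//.
by apply/measurable_EFinP; apply: (measurableT_comp (measurable_indic mU)); exact: measurable_pair2.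
Qed.

Let mnu U : measurable U -> measurable_fun setT (levy_section ^~ U).
Proof.
move=> mU; under eq_fun do rewrite levy_sectionE//.
apply: (@measurable_fun_fubini_tonelli_G _ _ _ _ _ (@lebesgue_measure R)
  (fun x => (\1_U x)%:E * pos_density x)).
- apply: emeasurable_funM; last exact: measurable_pos_density.
  by apply/measurable_EFinP; exact: measurable_indic.
- by move=> x; apply: mule_ge0; [rewrite lee_fin|exact: pos_density_ge0].
Qed.

(** [intensity] is a bare set function; this measure agrees with it on measurable sets. *)
Definition levy_intensity : {measure set X -> \bar R} := bind_measure B0 mnu.

Lemma integral_levy_intensity f : (forall x, 0 <= f x) -> measurable_fun setT f ->
  \int[levy_intensity]_x f x =
  \int[B0]_w \int[lebesgue_measure]_s (f (s, w) * pos_density (s, w)).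
Proof.
move=> f0 mf; rewrite integral_bind_measure//; apply: eq_integral => w _.
rewrite /levy_section integral_push// integral_density//.
by apply: (measurableT_comp mf); exact: measurable_pair2.
Qed.

Lemma integral_positive (P : R -> Prop) (f : R -> \bar R) :
  \int[@lebesgue_measure R]_(s in [set s | (0 < s)%R /\ P s]) f s =
  \int[@lebesgue_measure R]_s (if (0 < s)%R && `[< P s >] then f s else 0).
Proof.
rewrite integral_mkcond; apply: eq_integral => s _; rewrite patchE mem_asbool.
congr (if _ then _ else _).
by apply/asboolP/andP => -[s0 /asboolP Ps].
Qed.

Lemma integral_positiveT (f : R -> \bar R) :
  \int[@lebesgue_measure R]_(s in [set s | (0 < s)%R]) f s =
  \int[@lebesgue_measure R]_s (if (0 < s)%R then f s else 0).
Proof.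
rewrite integral_mkcond; apply: eq_integral => s _; rewrite patchE mem_asbool.
by congr (if _ then _ else _); apply/asboolP/idP.
Qed.

Lemma levy_intensityE U : measurable U -> levy_intensity U = intensity rho B0 U.
Proof.
move=> mU; rewrite (measure_integral_indic levy_intensity mU) integral_levy_intensity; last 2 first.
- by move=> z; rewrite lee_fin.
- by apply/measurable_EFinP; exact: measurable_indic.
apply: eq_integral => w _.
rewrite (integral_positive (fun s => U (s, w))); apply: eq_integral => s _.
rewrite /pos_density indicE mem_asbool /=; case: ifP => s0; rewrite ?mule0//=.
by case: asboolP; rewrite ?mul1e ?mul0e.
Qed.

(** Bounds on the density and on the jump make the mass finite; as the density takes finite values,
    these sets cover the space. *)
Definition levy_exhaust (p : nat) : set X :=
  [set x | pos_density x <= p%:R%:E /\ (`|x.1| <= p%:R)%R].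

Lemma exhausts_levy_intensity : exhausts levy_intensity levy_exhaust.
Proof.
have mF p : measurable (levy_exhaust p).
  apply: measurableI.
    rewrite -[X in measurable X]setTI; apply: emeasurable_fun_infty_c => //.
    exact: measurable_pos_density.
  rewrite -[X in measurable X]setTI; apply: measurable_fun_le => //.
  by apply: measurableT_comp; [exact: normr_measurable|exact: measurable_fst].
split => //.
- move=> p p' pp'; apply/subsetPset => x [h1 h2]; split.
    by apply: le_trans h1 _; rewrite lee_fin ler_nat.
  by apply: le_trans h2 _; rewrite ler_nat.
- apply/seteqP; split => // x _.
  pose r := fine (pos_density x).
  have rE : pos_density x = r%:E by rewrite fineK// /pos_density; case: ifP.
  have r0 : (0 <= r)%R by rewrite fine_ge0// pos_density_ge0.
  exists (maxn (Num.bound r) (Num.bound `|x.1|)) => //; split.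
    rewrite rE lee_fin ltW// (lt_le_trans (archi_boundP r0))// ler_nat.
    exact: leq_maxl.
  rewrite ltW// (lt_le_trans (archi_boundP (normr_ge0 _)))// ler_nat.
  exact: leq_maxr.
(* The density bound [p] times the length of the segment from [- p] to [p]. *)
move=> p; apply: (@le_lt_trans _ _ (p%:R%:E * (p%:R + p%:R)%:E)); last by rewrite -EFinM ltry.
rewrite (measure_integral_indic levy_intensity (mF p)) integral_levy_intensity; last 2 first.
- by move=> z; rewrite lee_fin.
- by apply/measurable_EFinP; exact: measurable_indic.
rewrite -[leRHS]mule1 -(@probability_setT _ _ _ B0) -integral_cst//.
have ab0 w s : 0 <= (\1_(levy_exhaust p) (s, w))%:E * pos_density (s, w).
  by apply: mule_ge0; [rewrite lee_fin|exact: pos_density_ge0].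
have mab : measurable_fun setT (fun x => (\1_(levy_exhaust p) x)%:E * pos_density x).
  apply: emeasurable_funM; last exact: measurable_pos_density.
  by apply/measurable_EFinP; exact: measurable_indic.
apply: ge0_le_integral => //.
- by move=> w _; apply: integral_ge0.
- by apply: (@measurable_fun_fubini_tonelli_G _ _ _ _ _ (@lebesgue_measure R) _ mab) => -[].
move=> w _; apply: (@le_trans _ _ (\int[lebesgue_measure]_s
    (p%:R%:E * (\1_`[(- p%:R)%R, p%:R] s)%:E))).
  apply: ge0_le_integral => //.
  - by apply: (measurableT_comp mab); exact: measurable_pair2.
  - apply: measurable_funeM; apply/measurable_EFinP; exact: measurable_indic.
  move=> s _; rewrite indicE mem_asbool; case: asboolP => [[h1 h2]|_]; last first.
    by rewrite mul0e mule_ge0.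
  rewrite mul1e indicE mem_set ?mule1//=.
  by rewrite in_itv/= -ler_norml.
rewrite ge0_integralZl//.
  rewrite integral_indic// setIT; apply: lee_wpmul2l => //.
  change (lebesgue_measure `[(- p%:R)%R, p%:R : R] <= (p%:R + p%:R)%:E).
  rewrite lebesgue_measure_itv/= lte_fin; case: ifP => _.
    by rewrite -EFinB opprK.
  by rewrite lee_fin addr_ge0.
by apply/measurable_EFinP; exact: measurable_indic.
Qed.

End instance.

Section marks_measure.
Context (R : realType) (Omega : ptopologicalType).
Variables (B0 : probability (borel Omega) R) (rho : R -> Omega -> R).
Local Notation X := (R * borel Omega)%type.
Hypothesis mrho : measurable_fun setT (fun x : X => rho x.1 x.2).
Hypothesis rho0 : forall s w, (0 < s)%R -> (0 <= rho s w)%R.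
Variables (q M : nat) (G : R.-pker R ~> q.-tuple R).
Hypothesis G_zero : forall s : R, (0 < s)%R -> (0 < 1 - pi_A G s)%R.
Local Notation V := (q.-tuple R).
Local Notation W := (M.-tuple V).
Local Notation nu := (levy_intensity B0 mrho rho0).

Definition mark_kernel : R.-pker X ~> W :=
  kpull (tuple_kernel G M) (@measurable_fst _ _ R (borel Omega)).

Lemma mark_kernelE x D : (forall i, measurable (D i)) ->
  mark_kernel x [set u | forall i, D i (tnth u i)] = \prod_(i < M) G x.1 (D i).
Proof.
move=> mD; rewrite -tuple_integral_prod//.
apply: eq_tuple_integral => u; rewrite indicE mem_asbool.
case: asboolP => [h|nh].
  by rewrite big1// => i _; rewrite indicE mem_set//; exact: h.
have [i ni] : exists i, ~ D i (tnth u i).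
  by apply: contrapT => h; apply: nh => i; apply: contrapT => nD; apply: h; exists i.
by rewrite (bigD1 i)//= indicE memNset// mul0e.
Qed.

Lemma integral_mark_kernel x f : (forall u, 0 <= f u) -> measurable_fun setT f ->
  \int[mark_kernel x]_u f u = tuple_integral (G x.1) f.
Proof. by move=> f0 mf; rewrite -(integral_tuple_kernel G x.1). Qed.

Let mpair (x : X) : measurable_fun setT (fun a : W => (x, a)).
Proof. exact: measurable_pair1. Qed.

Definition marked_section x : {measure set (X * W) -> \bar R} :=
  push (mark_kernel x) (mpair x).

Let msection U : measurable U -> measurable_fun setT (marked_section ^~ U).
Proof.
move=> mU.
apply: (eq_measurable_fun (fun x => mark_kernel x (xsection U x))).
  by move=> x _; rewrite xsectionE.
by apply: (measurable_fun_xsection_finite_kernel mark_kernel); rewrite inE.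
Qed.

Definition marked_measure : {measure set (X * W) -> \bar R} := bind_measure nu msection.

Lemma marked_measureE C D : measurable C -> measurable D ->
  marked_measure (C `*` D) = \int[nu]_(x in C) mark_kernel x D.
Proof.
move=> mC mD; rewrite integral_mkcond; apply: eq_integral => x _.
rewrite patchE mem_asbool; case: asboolP => Cx.
  by congr (mark_kernel x _); apply/seteqP; split => a //= [].
rewrite -[RHS](measure0 (mark_kernel x)); congr (mark_kernel x _).
by rewrite -subset0 => a [/= /Cx].
Qed.

Lemma integral_marked_measure f : (forall y, 0 <= f y) -> measurable_fun setT f ->
  \int[marked_measure]_y f y =
  \int[B0]_w \int[lebesgue_measure]_s
    (tuple_integral (G s) (fun a => f ((s, w), a)) * pos_density rho (s, w)).
Proof.
move=> f0 mf; rewrite integral_bind_measure//.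
have mfx (x : X) : measurable_fun setT (fun a => f (x, a)) by exact: (measurableT_comp mf).
under eq_integral => x _.
  rewrite integral_push// integral_mark_kernel//.
  over.
rewrite integral_levy_intensity//.
- by move=> x; exact: tuple_integral_ge0.
- exact: (measurable_tuple_integral G (s := fst)).
Qed.

Lemma integral_marked_measure_post f : (forall y, 0 <= f y) -> measurable_fun setT f ->
  \int[marked_measure]_y f y =
  \int[B0]_w \int[lebesgue_measure]_(s in [set s | (0 < s)%R])
    ((rho_post M G rho s w)%:E * tuple_integral (h_A G s) (fun a => f ((s, w), a))).
Proof.
move=> f0 mf; rewrite (integral_marked_measure f0 mf); apply: eq_integral => w _.
rewrite integral_positiveT; apply: eq_integral => s _; rewrite /pos_density /=.
case: ifP => [s0|_]; last by rewrite mule0.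
have mfx : measurable_fun setT (fun a => f ((s, w), a)) by exact: (measurableT_comp mf).
by rewrite -(tuple_integral_h_A (G_zero s0))// /rho_post EFinM [LHS]muleAC.
Qed.

End marks_measure.

(** * Disintegration by the jump kernel *)

Section label_jump_sets.
Context d1 (O : measurableType d1) d2 (V : measurableType d2) d3 (S : measurableType d3).
Variable M : nat.
Local Notation LS := ((O * M.-tuple V) * S)%type.

Definition label_jump_rects : set (set LS) :=
  [set U | exists B (D : 'I_M -> set V) C, [/\ measurable B,
     forall i, measurable (D i), measurable C &
     U = [set z | [/\ B z.1.1, forall i, D i (tnth z.1.2 i) & C z.2]]]].

Lemma label_jump_rects_setI : setI_closed label_jump_rects.
Proof.
move=> _ _ [B [D [C [mB mD mC ->]]]] [B' [D' [C' [mB' mD' mC' ->]]]].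
exists (B `&` B'), (fun i => D i `&` D' i), (C `&` C'); split.
- exact: measurableI.
- by move=> i; exact: measurableI.
- exact: measurableI.
apply/seteqP; split => z /=.
  by move=> [[Bz Dz Cz] [Bz' Dz' Cz']]; split => // i; split.
by move=> [[Bz Bz'] Dz [Cz Cz']]; split; split => // i; case: (Dz i).
Qed.

Lemma label_jump_rectsT : label_jump_rects setT.
Proof.
exists setT, (fun=> setT), setT; split => //.
by apply/seteqP; split => z.
Qed.

Lemma measurable_label_jump_rects (U : set LS) : measurable U -> <<s label_jump_rects >> U.
Proof.
suff : measurable_fun setT (id : g_sigma_algebraType label_jump_rects -> LS).
  by move=> h mU; have := h measurableT U mU; rewrite setTI preimage_id.
have m1 : measurable_fun setT (fun z : g_sigma_algebraType label_jump_rects => z.1.1).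
  move=> _ B mB; rewrite setTI; apply: sub_sigma_algebra.
  exists B, (fun=> setT), setT; split => //.
  by apply/seteqP; split => z //= [].
have m2 : measurable_fun setT (fun z : g_sigma_algebraType label_jump_rects => z.1.2).
  apply/measurable_fun_tnthP => i _ C mC; rewrite setTI.
  apply: sub_sigma_algebra.
  exists setT, (fun j => if j == i then C else setT), setT; split => //.
    by move=> j; case: ifP.
  apply/seteqP; split => z /=; last by case=> _ /(_ i); rewrite eqxx.
  by move=> Cu; split => // j; case: eqP => // ->.
have m3 : measurable_fun setT (fun z : g_sigma_algebraType label_jump_rects => z.2).
  move=> _ C mC; rewrite setTI; apply: sub_sigma_algebra.
  exists setT, (fun=> setT), C; split => //.
  by apply/seteqP; split => z //= [].
rewrite (_ : id = (fun z : g_sigma_algebraType label_jump_rects => ((z.1.1, z.1.2), z.2))).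
  by apply: measurable_fun_pair => //; exact: measurable_fun_pair.
by apply/funext => -[[? ?] ?].
Qed.

Lemma label_jump_rects_measurable U : label_jump_rects U -> measurable U.
Proof.
move=> [B [D [C [mB mD mC ->]]]].
rewrite (_ : [set z | _] = (fst \o fst) @^-1` B `&`
    (snd \o fst) @^-1` [set u | forall i, D i (tnth u i)] `&` snd @^-1` C).
  apply: measurableI; last exact: measurable_preimage.
  apply: measurableI; apply: measurable_preimage => //.
  - exact: measurableT_comp.
  - exact: measurableT_comp.
  by apply: tuple_rects_measurable; exists D.
by apply/seteqP; split => z /=; [move=> []|move=> [[]]].
Qed.

Lemma label_jump_measure_unique (R : realType) (m1 m2 : {measure set LS -> \bar R}) :
  m1 setT < +oo -> (forall U, label_jump_rects U -> m1 U = m2 U) ->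
  forall U, measurable U -> m1 U = m2 U.
Proof.
move=> m1oo eqr U mU.
have sub := label_jump_rects_measurable.
refine (@finite_law_unique _ _ LS _ LS m1 m2 LS id id label_jump_rects _ m1oo _ _ U _).
- exact: label_jump_rects_setI.
- exact/eqr/label_jump_rectsT.
- by move=> E rE; rewrite preimage_id; split; [exact: sub|exact: sub|exact: eqr].
- exact: measurable_label_jump_rects.
Qed.

End label_jump_sets.

Section jumps.
Context (R : realType) (Omega : ptopologicalType).
Variables (B0 : probability (borel Omega) R) (rho : R -> Omega -> R).
Local Notation X := (R * borel Omega)%type.
Hypothesis mrho : measurable_fun setT (fun x : X => rho x.1 x.2).
Hypothesis rho0 : forall s w, (0 < s)%R -> (0 <= rho s w)%R.
Variables (q M : nat) (G : R.-pker R ~> q.-tuple R).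
Hypothesis G_zero : forall s : R, (0 < s)%R -> (0 < 1 - pi_A G s)%R.
Local Notation V := (q.-tuple R).
Local Notation W := (M.-tuple V).
Local Notation L := (borel Omega * W)%type.
Local Notation m := (marked_measure B0 mrho rho0 M G).

Definition label_jump (y : X * W) : L * R := ((y.1.2, y.2), y.1.1).

Lemma measurable_label_jump : measurable_fun setT label_jump.
Proof.
apply: measurable_fun_pair.
  by apply: measurable_fun_pair => //; exact: measurableT_comp.
exact: measurableT_comp.
Qed.

(** The set [D0] of the general theory: all [M] values vanish. *)
Definition unmarked : set W := [set a | forall i, [set zeroV R q] (tnth a i)].

Lemma unmarked_rect : tuple_rects unmarked.
Proof. by exists (fun=> [set zeroV R q]) => // i; exact: measurable_zeroV. Qed.

Definition post_inner (f : X * W -> \bar R) (w : Omega) : \bar R :=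
  \int[lebesgue_measure]_(s in [set s : R | (0 < s)%R])
    ((rho_post M G rho s w)%:E * tuple_integral (h_A G s) (fun a => f ((s, w), a))).

Lemma rho_post_ge0 s w : (0 < s)%R -> (0 <= rho_post M G rho s w)%R.
Proof. by move=> s0; rewrite mulr_ge0 ?rho0// exprn_ge0// ltW// G_zero. Qed.

Lemma post_inner_ge0 f w : (forall y, 0 <= f y) -> 0 <= post_inner f w.
Proof.
move=> f0; apply: integral_ge0 => s s0; rewrite mule_ge0 ?lee_fin ?rho_post_ge0//.
exact: tuple_integral_ge0.
Qed.

Lemma measurable_post_inner f : (forall y, 0 <= f y) -> measurable_fun setT f ->
  measurable_fun setT (post_inner f : borel Omega -> \bar R).
Proof.
move=> f0 mf.
pose F (x : X) := tuple_integral (G x.1) (fun a => f (x, a)) * pos_density rho x.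
have mF : measurable_fun setT F.
  apply: emeasurable_funM; last exact: measurable_pos_density.
  exact: (measurable_tuple_integral G (s := fst)).
apply: (eq_measurable_fun (fun w => \int[lebesgue_measure]_s F (s, w))); last first.
  apply: (@measurable_fun_fubini_tonelli_G _ _ _ _ _ (@lebesgue_measure R) _ mF) => x.
  by apply: mule_ge0; [exact: tuple_integral_ge0|exact: pos_density_ge0].
move=> w _; rewrite /post_inner integral_positiveT; apply: eq_integral => s _.
rewrite /F /pos_density /=.
case: ifP => [s0|_]; last by rewrite mule0.
have mfx : measurable_fun setT (fun a => f ((s, w), a)) by exact: (measurableT_comp mf).
by rewrite -(tuple_integral_h_A (G_zero s0))// /rho_post EFinM [LHS]muleAC.
Qed.

Lemma integral_post_inner f : (forall y, 0 <= f y) -> measurable_fun setT f ->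
  \int[m]_y f y = \int[B0]_w post_inner f w.
Proof. by move=> f0 mf; rewrite integral_marked_measure_post. Qed.

Lemma post_inner_rect (B : set (borel Omega)) (S : set R) (D : 'I_M -> set V) w :
  (forall i, measurable (D i)) ->
  post_inner (fun y => (\1_B y.1.2)%:E * ((\1_S y.1.1)%:E *
     \prod_(i < M) (\1_(D i) (tnth y.2 i))%:E)) w =
  if w \in B then
  \int[lebesgue_measure]_(s in [set s | (0 < s)%R /\ S s])
      ((rho_post M G rho s w)%:E * \prod_(i < M) h_A G s (D i)) else 0.
Proof.
move=> mD; rewrite /post_inner /=; case: ifPn => wB; last first.
  rewrite integral0_eq// => s s0; rewrite indicE (negPf wB).
  by under eq_tuple_integral do rewrite mul0e; rewrite tuple_integral0 mule0.
rewrite integral_positiveT integral_positive; apply: eq_integral => s _.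
case: ifPn => s0 //=; rewrite -mem_asbool; case: ifPn => sS; last first.
  under eq_tuple_integral do rewrite !indicE (negPf sS) mul0e mule0.
  by rewrite tuple_integral0 mule0.
rewrite -tuple_integral_prod//; congr (_ * _); apply: eq_tuple_integral => a.
by rewrite !indicE wB sS !mul1e.
Qed.

Variable kappa : R.-pker L ~> R.
Hypothesis kappaP : jump_kernel G rho B0 kappa.

Lemma jump_kernel_rect (B : set (borel Omega)) (S : set R) (D : 'I_M -> set V) :
  measurable B -> measurable S -> (forall i, measurable (D i)) ->
  (exists i, ~ D i (zeroV R q)) ->
  \int[m]_y ((\1_B y.1.2)%:E * (kappa (y.1.2, y.2) S *
     \prod_(i < M) (\1_(D i) (tnth y.2 i))%:E)) =
  \int[m]_y ((\1_B y.1.2)%:E * ((\1_S y.1.1)%:E *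
     \prod_(i < M) (\1_(D i) (tnth y.2 i))%:E)).
Proof.
move=> mB mS mD D0.
have mP : measurable_fun setT (fun y : X * W => \prod_(i < M) (\1_(D i) (tnth y.2 i))%:E : \bar R).
  apply: emeasurable_prod => i; apply/measurable_EFinP.
  apply: (measurableT_comp (measurable_indic (mD i))).
  by apply: (measurableT_comp (@measurable_tnth _ V M i)).
have mBB : measurable_fun setT (fun y : X * W => (\1_B y.1.2)%:E : \bar R).
  apply/measurable_EFinP; apply: (measurableT_comp (measurable_indic mB)).
  exact: measurableT_comp.
have mSS : measurable_fun setT (fun y : X * W => (\1_S y.1.1)%:E : \bar R).
  apply/measurable_EFinP; apply: (measurableT_comp (measurable_indic mS)).
  exact: measurableT_comp.
have mk : measurable_fun setT (fun y : X * W => kappa (y.1.2, y.2) S).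
  apply: (@measurableT_comp _ _ _ _ _ _ (kappa ^~ S)); first exact: measurable_kernel.
  by apply: measurable_fun_pair => //; exact: measurableT_comp.
have p0 y : 0 <= \prod_(i < M) (\1_(D i) (tnth y i))%:E :> \bar R.
  by apply: prode_ge0 => i _; rewrite lee_fin.
rewrite integral_post_inner; last 2 first.
- by move=> y; rewrite !mule_ge0// lee_fin.
- by apply: emeasurable_funM => //; exact: emeasurable_funM.
rewrite integral_post_inner; last 2 first.
- by move=> y; rewrite !mule_ge0// lee_fin.
- by apply: emeasurable_funM => //; exact: emeasurable_funM.
apply: ge0_ae_eq_integral => //.
- apply: measurable_post_inner.
  + by move=> y; rewrite !mule_ge0// lee_fin.
  + by apply: emeasurable_funM => //; exact: emeasurable_funM.
- apply: measurable_post_inner.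
  + by move=> y; rewrite !mule_ge0// lee_fin.
  + by apply: emeasurable_funM => //; exact: emeasurable_funM.
- by move=> w _; apply: post_inner_ge0 => y; rewrite !mule_ge0// lee_fin.
- by move=> w _; apply: post_inner_ge0 => y; rewrite !mule_ge0// lee_fin.
apply: filterS kappaP => w h _; rewrite post_inner_rect//.
rewrite h// /post_inner /=; case: ifPn => wB; last first.
  rewrite integral0_eq// => s s0; rewrite indicE (negPf wB).
  by under eq_tuple_integral do rewrite mul0e; rewrite tuple_integral0 mule0.
apply: eq_integral => s _; congr (_ * _); apply: eq_tuple_integral => a.
by rewrite indicE wB mul1e.
Qed.

(* The nonzero vectors whose first nonzero coordinate is the [i]-th one: each
   of these cylinders keeps rectangles away from [0]. *)
Definition leading (D : 'I_M -> set V) (i j : 'I_M) : set V :=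
  if (j < i)%N then D j `&` [set zeroV R q] else
  if j == i then D j `&` ~` [set zeroV R q] else D j.

Lemma measurable_leading D i j : (forall j, measurable (D j)) -> measurable (leading D i j).
Proof.
move=> mD; rewrite /leading; case: ifP => _.
  by apply: measurableI => //; exact: measurable_zeroV.
by case: ifP => _ //; apply: measurableI => //; exact: measurable_nonzero.
Qed.

Definition led (i : 'I_M) (a : W) := forall j, leading (fun=> setT) i j (tnth a j).

Lemma leadingE D i a :
  (forall j, leading D i j (tnth a j)) <-> (forall j, D j (tnth a j)) /\ led i a.
Proof.
split => [h|[h1 h2] j].
  split => j; have := h j; rewrite /leading.
    by case: ifP => _; [case|case: ifP => _ //; case].
  by case: ifP => _; [case|case: ifP => _ //; case].
have := h2 j; rewrite /leading; case: ifP => _; first by case.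
by case: ifP => _ //; case.
Qed.

Lemma led_self i a : led i a -> ~ [set zeroV R q] (tnth a i).
Proof. by move=> /(_ i); rewrite /leading (ltnn i) (eqxx i) => -[]. Qed.

Lemma led_lt (i j : 'I_M) a : led i a -> (j < i)%N -> [set zeroV R q] (tnth a j).
Proof. by move=> /(_ j) + ji; rewrite /leading ji => -[]. Qed.

Lemma led_unmarked i a : led i a -> ~ unmarked a.
Proof. by move=> /led_self + /(_ i). Qed.

Lemma led_inj i j a : led i a -> led j a -> i = j.
Proof.
move=> li lj; have [h|h|/ord_inj//] := ltngtP i j.
  by case: (led_self li (led_lt lj h)).
by case: (led_self lj (led_lt li h)).
Qed.

Lemma led_ex a : ~ unmarked a -> exists i, led i a.
Proof.
move=> nu.
have ex : exists i, tnth a i != zeroV R q.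
  apply: contrapT => h; apply: nu => i; apply/eqP; apply: contrapT => ni.
  by apply: h; exists i; apply/negP.
have [i0 hi0] := ex.
case: (@arg_minnP _ i0 (fun i => tnth a i != zeroV R q) (fun i : 'I_M => (i : nat)) hi0) => i hi imin.
exists i => j; rewrite /leading; case: ltnP => ji.
  split => //=; apply/eqP; apply: contraT => /imin; by rewrite leqNgt ji.
by case: eqVneq => // ->; split => //= /eqP; rewrite (negPf hi).
Qed.

Lemma measurable_led i : measurable [set y : X * W | led i y.2].
Proof.
rewrite (_ : [set y | _] = setT `*` [set a | led i a]); last first.
  by apply/seteqP; split => -[x a] //= [].
apply: measurableX => //; apply: tuple_rects_measurable.
by exists (leading (fun=> setT) i) => // j; exact: measurable_leading.
Qed.

Lemma integral_off f : (forall y, 0 <= f y) -> measurable_fun setT f ->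
  \int[m]_y off unmarked f y =
  \sum_(i < M) \int[m]_(y in [set y : X * W | led i y.2]) f y.
Proof.
move=> f0 mf; under [RHS]eq_bigr do rewrite integral_mkcond.
rewrite -ge0_integral_sum//; last 2 first.
- move=> i; exact: ((measurable_restrictT f (measurable_led i)).1 (measurable_funTS mf)).
- by move=> i y _; rewrite patchE; case: ifP.
apply: eq_integral => y _; rewrite /off mem_asbool; case: asboolP => uy.
  rewrite big1// => i _; rewrite patchE memNset// => /led_unmarked; exact.
have [i li] := led_ex uy; rewrite (bigD1 i)//= patchE mem_set// big1 ?adde0// => j ji.
by rewrite patchE memNset// => lj; rewrite (led_inj li lj) eqxx in ji.
Qed.

Let mlabel (y : X * W) : measurable_fun setT (fun s : R => ((label_jump y).1, s)).
Proof. exact: measurable_pair1. Qed.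

Definition jump_section (y : X * W) : {measure set (L * R) -> \bar R} :=
  push (kappa (label_jump y).1) (mlabel y).

Lemma jump_sectionE y U : jump_section y U =
  kappa (label_jump y).1 (xsection U (label_jump y).1).
Proof. by rewrite xsectionE. Qed.

Let mkappa U : measurable U ->
  measurable_fun setT (fun y => kappa (label_jump y).1 (xsection U (label_jump y).1)).
Proof.
move=> mU; apply: (@measurableT_comp _ _ _ _ _ _ (fun x => kappa x (xsection U x))).
  by apply: (measurable_fun_xsection_finite_kernel kappa); rewrite inE.
by apply: (measurableT_comp measurable_fst); exact: measurable_label_jump.
Qed.

Let mjump U : measurable U -> measurable_fun setT (jump_section ^~ U).
Proof.
move=> mU; apply: (eq_measurable_fun (fun y => kappa (label_jump y).1 (xsection U (label_jump y).1))).
  by move=> y _; rewrite jump_sectionE.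
exact: mkappa.
Qed.

(** The defining property of [kappa] covers rectangles away from zero. The nonzero vectors split
    into the cylinders [led i], and a rectangle cut by one of them is again a rectangle away from
    zero. On each cylinder the two sides are therefore finite measures that agree on a pi-system. *)
Lemma jump_kernelE : m (setT `*` ~` unmarked) < +oo -> forall C, measurable C ->
  \int[m]_y off unmarked (fun y => kappa (label_jump y).1 (xsection C (label_jump y).1)) y =
  m [set y | C (label_jump y) /\ ~ unmarked y.2].
Proof.
move=> mfin C mC.
have mC' : measurable (label_jump @^-1` C) by apply: measurable_preimage => //; exact: measurable_label_jump.
have mum : measurable unmarked by apply: tuple_rects_measurable; exact: unmarked_rect.
have mCu : measurable [set y : X * W | C (label_jump y) /\ ~ unmarked y.2].
  apply: measurableI => //.
  rewrite (_ : (fun y => _) = setT `*` ~` unmarked); last by apply/seteqP; split => -[? ?] // [].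
  by apply: measurableX => //; exact: measurableC.
rewrite integral_off//; last exact: mkappa.
transitivity (\int[m]_y off unmarked (fun y => (\1_C (label_jump y))%:E) y); last first.
  rewrite (measure_integral_indic m mCu); apply: eq_integral => y _.
  rewrite /off !indicE; have [uy|nuy] := pselect (unmarked y.2).
    by rewrite mem_set// memNset// => -[].
  rewrite (memNset nuy) !mem_asbool; case: asboolP => h; case: asboolP => h' //.
    by case: h'.
  by case: h; case: h'.
have mfC : measurable_fun setT (fun y : X * W => (\1_C (label_jump y))%:E : \bar R).
  apply/measurable_EFinP; apply: (measurableT_comp (measurable_indic mC)).
  exact: measurable_label_jump.
rewrite integral_off//; apply: eq_bigr => i _.
have mi := measurable_led i.
pose m2 := bind_measure (mrestr m mi) mjump.
pose m1 := push (mrestr m mi) measurable_label_jump.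
transitivity (m2 C).
  rewrite -(integral_mrestr m mi)//; last exact: mkappa.
  by apply: eq_integral => y _; rewrite jump_sectionE.
transitivity (m1 C); last first.
  rewrite -(integral_mrestr m mi)//.
  rewrite (measure_integral_indic m1 mC) integral_push//.
  by apply/measurable_EFinP; exact: measurable_indic.
symmetry; move: C mC {mC' mCu mfC}; apply: label_jump_measure_unique.
  apply: (le_lt_trans _ mfin); change (m (setT `&` [set y | led i y.2]) <= m (setT `*` ~` unmarked)).
  apply: le_measure; rewrite ?inE.
  - exact: measurableI.
  - by apply: measurableX => //; exact: measurableC.
  - by move=> [x a] [_ /= /led_unmarked].
move=> U [B [D [S [mB mD mS UE]]]].
have mU : measurable U.
  apply: (label_jump_rects_measurable (U := U)); by exists B, D, S.
have mlD j : measurable (leading D i j) by exact: measurable_leading.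
have nz : exists j, ~ leading D i j (zeroV R q).
  by exists i; rewrite /leading (ltnn i) (eqxx i) => -[_]; exact.
have prodE a : \prod_(j < M) (\1_(leading D i j) (tnth a j))%:E =
    (`[< (forall j, D j (tnth a j)) /\ led i a >])%:R%:E :> \bar R.
  case: asboolP => [/leadingE h|h].
    by rewrite big1// => j _; rewrite indicE mem_set.
  have [j nj] : exists j, ~ leading D i j (tnth a j).
    by apply: contrapT => h'; apply: h; apply/leadingE => j; apply: contrapT => nD; apply: h'; exists j.
  by rewrite (bigD1 j)//= indicE memNset// mul0e.
have := jump_kernel_rect mB mS mlD nz.
under eq_integral do rewrite prodE.
under [X in _ = X]eq_integral do rewrite prodE.
move=> h; transitivity (\int[m]_y ((\1_B y.1.2)%:E * ((\1_S y.1.1)%:E *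
   (`[< (forall j, D j (tnth y.2 j)) /\ led i y.2 >])%:R%:E))).
  have mUi : measurable (label_jump @^-1` U `&` [set y | led i y.2]).
    by apply: measurableI => //; apply: measurable_preimage => //; exact: measurable_label_jump.
  change (m (label_jump @^-1` U `&` [set y | led i y.2]) = \int[m]_y ((\1_B y.1.2)%:E * ((\1_S y.1.1)%:E *
   (`[< (forall j, D j (tnth y.2 j)) /\ led i y.2 >])%:R%:E))).
  rewrite (measure_integral_indic m mUi); apply: eq_integral => y _.
  rewrite !indicE !mem_asbool UE; case: (asboolP (B y.1.2)) => By; last first.
    by rewrite mul0e asboolF// => -[[]].
  case: (asboolP (S y.1.1)) => Sy; last by rewrite mul1e mul0e asboolF// => -[[]].
  rewrite !mul1e; case: asboolP => h1; case: asboolP => h2 //.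
    by case: h2; case: h1 => -[].
  by case: h1; case: h2.
rewrite -h; transitivity (\int[mrestr m mi]_y kappa (label_jump y).1 (xsection U (label_jump y).1)); last first.
  by apply: eq_integral => y _; rewrite jump_sectionE.
rewrite integral_mrestr//; last exact: mkappa.
rewrite [RHS]integral_mkcond; apply: eq_integral => y _.
rewrite patchE !indicE !mem_asbool; case: (asboolP (led i y.2)) => ly; last first.
  by rewrite [X in _ * (_ * X)](_ : _ = 0) ?mule0// asboolF// => -[].
case: (asboolP (B y.1.2)) => By; last first.
  rewrite mul0e -(measure0 (kappa (label_jump y).1)); congr (kappa _ _); symmetry.
  by rewrite -subset0 => s /set_mem; rewrite UE => -[].
rewrite mul1e; case: asboolP => h'; last first.
  rewrite mule0 -(measure0 (kappa (label_jump y).1)); congr (kappa _ _); symmetry.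
  by rewrite -subset0 => s /set_mem; rewrite UE => -[/= _ Dj _]; apply: h'.
rewrite mule1; congr (kappa _ _); apply/seteqP; split => s.
  by move=> Ss; apply/mem_set; rewrite UE; split => //; case: h'.
by move=> /set_mem; rewrite UE => -[].
Qed.

End jumps.

(** * The sigma-algebra of the observations *)

Section limits.
Context (R : realType) d (T : measurableType d).

Lemma limn_esup_einf_cvg (u : (\bar R)^nat) l :
  limn_einf u = l -> limn_esup u = l -> u @ \oo --> l.
Proof.
move=> il sl; apply: (@squeeze_cvge _ _ _ _ (einfs u) u (esups u)).
- apply: nearW => n; apply/andP; split.
    by apply: ereal_inf_lbound; exists n => /=.
  by apply: ereal_sup_ubound; exists n => /=.
- by rewrite -il limn_einf_lim; exact: is_cvg_einfs.
- by rewrite -sl limn_esup_lim; exact: is_cvg_esups.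
Qed.

(* Includes the sequences without limit, where [limn] is [point]. *)
Lemma measurable_limn (h : nat -> T -> R) :
  (forall n, measurable_fun setT (h n)) ->
  measurable_fun setT (fun t => limn (h ^~ t)).
Proof.
move=> mh.
pose i t := limn_einf (fun n => (h n t)%:E).
pose s t := limn_esup (fun n => (h n t)%:E).
have ms : measurable_fun setT s.
  by apply: measurable_fun_limn_esup => n; exact/measurable_EFinP.
have mi : measurable_fun setT i.
  apply: (measurableT_comp (@oppe_measurable R setT)).
  apply: measurable_fun_limn_esup => n; apply: measurableT_comp => //.
  exact/measurable_EFinP.
(* A real limit exists exactly when the upper limit is finite and equals the lower one. *)
rewrite (_ : (fun t => _) = (fun t =>
    if (s t \is a fin_num) && (s t - i t == 0) then fine (s t) else point)).
  apply: measurable_fun_ifT => //.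
    apply: measurable_and; apply: (measurable_fun_bool true); rewrite setTI.
      by have := emeasurable_fin_num measurableT ms; rewrite setTI.
    have := measurableC (emeasurable_neq measurableT (emeasurable_funB ms mi) 0).
    rewrite setTI; congr measurable; apply/seteqP; split => t /=; first by move/negP/negbNE.
    by move=> /eqP ->; rewrite eqxx.
  by apply: (measurableT_comp _ ms); exact: fine_measurable.
apply/funext => t.
have [/cvg_ex[l hl]|nc] := pselect (cvgn (h ^~ t)).
  rewrite (cvg_lim _ hl)//.
  have hlE : (h n t)%:E @[n --> \oo] --> l%:E by apply/fine_cvgP; split; [exact: nearW|exact: hl].
  have [il sl] := cvg_limn_einf_sup hlE.
  by rewrite /i /s il sl /= subee//= eqxx.
case: ifP => [/andP[sfin /eqP is0]|_].
  case: nc; apply/cvg_ex; exists (fine (s t)).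
  have sE : s t = (fine (s t))%:E by rewrite fineK.
  have iE : i t = (fine (s t))%:E.
    move: is0; rewrite sE; case: (i t) => [r| |]//= [/eqP]; rewrite subr_eq0 => /eqP -> //.
  have := limn_esup_einf_cvg (u := fun n => (h n t)%:E) iE sE.
  by move=> /fine_cvgP[].
exact: dvgP.
Qed.
End limits.

(** The partial sums are constant once they contain all of [es]. *)
Lemma limn_sum_eq (R : realType) (f : nat -> R) (es : seq nat) : uniq es ->
  (forall n, n \notin es -> f n = 0%R) ->
  limn (fun n => (\sum_(m < n) f m)%R) = (\sum_(m <- es) f m)%R.
Proof.
move=> ues f0; apply: lim_near_cst => //.
exists (\max_(m <- es) m.+1)%N => // n /= nN.
rewrite -(big_mkord xpredT f) (bigID (mem es))/= [X in (_ + X)%R]big1 ?addr0; last first.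
  by move=> m mes; exact: f0.
rewrite -big_filter; apply: perm_big; apply: uniq_perm => //.
  by rewrite filter_uniq// iota_uniq.
move=> m; rewrite mem_filter /index_iota subn0 mem_iota add0n /=.
apply: andb_idr => mes; apply: leq_trans nN.
exact: (@leq_bigmax_seq _ es xpredT S m mes isT).
Qed.

Section ibp_sigma.
Context (R : realType) (q : nat) d (T : measurableType d) (Omega : ptopologicalType) (M : nat).
Local Notation V := (q.-tuple R).
Local Notation W := (M.-tuple V).
Local Notation L := (borel Omega * W)%type.
Variables (alive : nat -> T -> bool) (pts : nat -> T -> R * borel Omega)
  (A : 'I_M -> nat -> T -> V).
Hypotheses (malive : forall k, measurable_fun setT (alive k))
  (mpts : forall k, measurable_fun setT (pts k))
  (mA : forall i k, measurable_fun setT (A i k)).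

Definition mark_vector k t : W := [tuple A i k t | i < M].

Lemma measurable_mark_vector k : measurable_fun setT (mark_vector k).
Proof.
apply/measurable_fun_tnthP => i; apply: (eq_measurable_fun (A i k)) => //.
by move=> t _; rewrite /= tnth_mktuple.
Qed.

Definition ibp_gen : set (set T) :=
  [set E | exists i B (C : set V), [/\ measurable B, measurable C &
        E = [set t | C (ibp alive pts A i t B)]]].

Lemma ibp_gen_measurable : ibp_gen `<=` measurable.
Proof.
move=> _ [i [B [C [mB mC ->]]]].
apply: (measurable_preimage (f := fun t => ibp alive pts A i t B)) => //.
apply/measurable_fun_tnthP => j.
apply: (eq_measurable_fun (fun t => limn (fun n => (\sum_(k < n)
     (alive k t)%:R * \1_B (pts k t).2 * tnth (A i k t) j)%R))).
  by move=> t _; rewrite /= tnth_mktuple.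
apply: measurable_limn => n; apply: measurable_sum => k.
apply: measurable_funM; first apply: measurable_funM.
- apply: (eq_measurable_fun (\1_(alive k @^-1` [set true]) : T -> R)).
    move=> t _; rewrite indicE mem_asbool; case: asboolP => /= [->//|].
    by case: (alive k t).
  by apply: measurable_indic; exact: measurable_preimage.
- apply: (measurableT_comp (measurable_indic mB)).
  exact: (measurableT_comp measurable_snd).
- by apply: (measurableT_comp (@measurable_tnth _ R q j)).
Qed.

Local Notation list es t l :=
  (label_jump (pts (nth 0%N es l) t, mark_vector (nth 0%N es l) t)).1.

(** The values at the atoms outside the list are zero, so the series is finite and depends on the
    labels alone. *)
Lemma ibp_listing k es t i B : listing alive mark_vector (@unmarked R q M) k es t ->
  ibp alive pts A i t B = [tuple (\sum_(l < k) \1_B (list es t l).1 *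
    tnth (tnth (list es t l).2 i) j)%R | j < q].
Proof.
move=> [sz [ues h]]; apply/eq_from_tnth => j; rewrite !tnth_mktuple.
pose f m : R := ((alive m t)%:R * \1_B (pts m t).2 * tnth (A i m t) j)%R.
rewrite (@limn_sum_eq _ f es)//; last first.
  move=> n nes; rewrite /f; case: (boolP (alive n t)) => aln; last by rewrite !mul0r.
  have un : @unmarked R q M (mark_vector n t).
    apply: contrapT => nu; move/negP: nes; apply; exact/h.
  by have := un i; rewrite tnth_mktuple => /= ->; rewrite tnth_mktuple mulr0.
rewrite (big_nth 0%N) sz big_mkord; apply: eq_bigr => l _; rewrite /f /=.
have : nth 0%N es l \in es by rewrite mem_nth ?sz.
by move=> /h[-> _]; rewrite mul1r tnth_mktuple.
Qed.

(** By [ibp_listing] every generator is a condition on the labels, the same for all lists of length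
    [k], and this form is kept by complements and countable unions. *)
Lemma sigma_ibp_listing S k : <<s ibp_gen >> S ->
  exists2 U, <<s @label_rects _ L k >> U &
  forall t es, listing alive mark_vector (@unmarked R q M) k es t ->
    S t <-> U (fun l : 'I_k => list es t l).
Proof.
move: S; apply: smallest_sub.
  split.
  - exists set0; first by exact: sigma_algebra0.
    by [].
  - move=> S [U sU SU]; exists (~` U); first exact: sigma_algebraC.
    move=> t es lt; have := SU _ _ lt; rewrite setTD /setC /=; tauto.
  - move=> S hS.
    have /choice[U hU] n : exists U, <<s @label_rects _ L k >> U /\
      forall t es, listing alive mark_vector (@unmarked R q M) k es t ->
      S n t <-> U (fun l : 'I_k => list es t l).
      by have [U sU SU] := hS n; exists U.
    exists (\bigcup_n U n); first by apply: sigma_algebra_bigcup => n; case: (hU n).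
    move=> t es lt; split => -[n _ h]; exists n => //.
      by apply/((hU n).2 _ _ lt).
    by apply/((hU n).2 _ _ lt).
move=> _ [i [B [C [mB mC ->]]]].
pose f (u : g_sigma_algebraType (@label_rects _ L k)) : V :=
  [tuple (\sum_(l < k) \1_B (u l).1 * tnth (tnth (u l).2 i) j)%R | j < q].
exists (f @^-1` C); last by move=> t es lt; rewrite /= (ibp_listing i B lt).
suff mf : measurable_fun setT f by have := mf measurableT C mC; rewrite setTI.
have ml l : measurable_fun setT (fun u : g_sigma_algebraType (@label_rects _ L k) => u l).
  move=> _ D mD; rewrite setTI; apply: sub_sigma_algebra; by exists l, D.
apply/measurable_fun_tnthP => j.
apply: (eq_measurable_fun (fun u : g_sigma_algebraType (@label_rects _ L k) =>
  (\sum_(l < k) \1_B (u l).1 * tnth (tnth (u l).2 i) j)%R)).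
  by move=> u _; rewrite /= tnth_mktuple.
apply: measurable_sum => l; apply: measurable_funM.
  apply: (measurableT_comp (measurable_indic mB)).
  exact: (measurableT_comp measurable_fst).
apply: (measurableT_comp (@measurable_tnth _ R q j)).
apply: (measurableT_comp (@measurable_tnth _ V M i)).
exact: (measurableT_comp measurable_snd).
Qed.

End ibp_sigma.

(** * The posterior of the model *)

Lemma eq_poisson (R : realType) d (X : measurableType d) d' (T : measurableType d')
    (P : {measure set T -> \bar R}) (nu1 nu2 : set X -> \bar R) N :
  (forall C, measurable C -> nu1 C = nu2 C) -> poisson P nu1 N -> poisson P nu2 N.
Proof.
move=> e [mN pN]; split => // I C v mC tC Cfin; rewrite pN//; last by move=> i; rewrite e.
by congr (_ * _%:E); apply: eq_bigr => i _; rewrite e.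
Qed.

Lemma integral_conf_unlisted (R : realType) d (X : measurableType d)
    (al : nat -> bool) (x : nat -> X) (es : seq nat) (f : X -> \bar R) : (forall y, 0 <= f y) -> measurable_fun setT f ->
  uniq es -> (forall n, n \in es -> al n) ->
  \int[conf R al x]_y f y =
  \int[conf R (unlisted al es) x]_y f y + \sum_(n <- es) f (x n).
Proof.
move=> f0 mf; elim: es => [|n es IH] /=.
  move=> _ _; rewrite big_nil adde0; congr (integral (conf R _ x) _ _).
  by apply/funext => k; rewrite /unlisted andbT.
move=> /andP[nes ues] ales; rewrite IH//; last first.
  by move=> k kes; apply: ales; rewrite in_cons kes orbT.
rewrite big_cons addeA; congr (_ + _); rewrite !integral_conf//.
have aln : unlisted al es n by rewrite /unlisted nes ales// mem_head.
have g0 k : 0 <= (if unlisted al es k then f (x k) else 0) by case: ifP.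
rewrite (@nneseriesD1 _ _ n)// aln addeC; congr (_ + _).
rewrite [LHS]eseries_mkcond; apply: eq_eseriesr => k _.
by rewrite /unlisted in_cons negb_or; have [->|kn] := eqVneq k n; rewrite /= ?andbF.
Qed.

Section model.
Context (R : realType) (Omega : ptopologicalType).
Variables (B0 : probability (borel Omega) R) (rho : R -> Omega -> R).
Local Notation X := (R * borel Omega)%type.
Hypothesis mrho : measurable_fun setT (fun x : X => rho x.1 x.2).
Hypothesis rho0 : forall s w, (0 < s)%R -> (0 <= rho s w)%R.
Variables (q M : nat) (G : R.-pker R ~> q.-tuple R).
Hypothesis G_zero : forall s : R, (0 < s)%R -> (0 < 1 - pi_A G s)%R.
Local Notation V := (q.-tuple R).
Local Notation W := (M.-tuple V).
Local Notation L := (borel Omega * W)%type.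
Context d (T : measurableType d) (P : probability T R).
Variables (alive : nat -> T -> bool) (pts : nat -> T -> X).
Hypotheses (malive : forall k, measurable_fun setT (alive k))
  (mpts : forall k, measurable_fun setT (pts k)).
Hypothesis N_PRM : is_PRM P (intensity rho B0) (atoms_measure R alive pts).
Variable A : 'I_M -> nat -> T -> V.
Hypothesis A_IBP : iid_IBP_marks P alive pts G A.
Variables (K : T -> nat) (w : nat -> T -> borel Omega) (a : nat -> T -> W).
Hypothesis Kwa : enumerates_selected P alive pts A K w a.
Local Notation nu := (levy_intensity B0 mrho rho0).
Local Notation m := (marked_measure B0 mrho rho0 M G).
Local Notation A' := (mark_vector A).
Local Notation unmarked := (@unmarked R q M).
Local Notation rects := (@tuple_rects _ V M).
Local Notation rects_measurable := (@tuple_rects_measurable _ V M).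
Local Notation rectsT := (@tuple_rectsT _ V M).
Local Notation rectsI := (@tuple_rects_setI _ V M).
Local Notation rects_gen := (@measurable_tuple_rects _ V M).
Local Notation exF := (exhausts_levy_intensity B0 mrho rho0).

Let mA i k : measurable_fun setT (A i k).
Proof. by case: A_IBP. Qed.

Let mE C D : measurable C -> rects D -> m (C `*` D) = \int[nu]_(x in C) mark_kernel Omega M G x D.
Proof. by move=> mC rD; apply: marked_measureE => //; exact: rects_measurable. Qed.

(** A product set for the vector of values of one atom gives the factors that [iid_IBP_marks]
    expects; the products over values and over atoms are then exchanged. *)
Lemma model_marked : marked (mark_kernel Omega M G) rects P alive pts A'.
Proof.
apply: (markedP rects_measurable malive mpts (measurable_mark_vector mA)) => S sS n D DD DT.
have /choice[D' hD'] k : exists D' : 'I_M -> set V, (forall i, measurable (D' i)) /\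
    D k = [set u | forall i, D' i (tnth u i)].
  by have [D' mD' DE] := DD k; exists D'.
have [_ /(_ S sS n (fun i k => D' k i)) h] := A_IBP.
transitivity (P (S `&` [set t | forall i k, (k < n)%N -> alive k t -> D' k i (A i k t)])).
  congr (P (_ `&` _)); apply/seteqP; split => t /= ht.
    move=> i k kn alk; have := ht k alk; rewrite (hD' k).2 => /(_ i).
    by rewrite tnth_mktuple.
  move=> k alk; have [nk|kn] := leqP n k; first by rewrite DT.
  by rewrite (hD' k).2 => i; rewrite tnth_mktuple; exact: ht.
rewrite h; last by move=> i k; case: (hD' k).
apply: eq_integral => t _; rewrite exchange_big; apply: eq_bigr => k _.
case: (alive k t); last by rewrite big1.
by rewrite (hD' k).2 mark_kernelE//; case: (hD' k).
Qed.

Lemma model_marked_poisson :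
  marked_poisson (mark_kernel Omega M G) rects nu P alive pts A'.
Proof.
split => //.
- by change (P setT < +oo); rewrite probability_setT ltry.
- exact: measurable_mark_vector.
- apply: (eq_poisson (nu1 := intensity rho B0)).
    by move=> C mC; rewrite levy_intensityE.
  exact: is_PRM_poisson N_PRM.
- exact: model_marked.
Qed.

Local Notation MP := model_marked_poisson.

Lemma model_selected n t : selected alive A n t <-> alive n t /\ ~ unmarked (A' n t).
Proof.
split => -[aln h]; split => //.
  by move=> un; case: h => i; apply; have := un i; rewrite tnth_mktuple.
apply: contrapT => h'; apply: h => i; rewrite tnth_mktuple /=.
by apply: contrapT => ni; apply: h'; exists i.
Qed.

Lemma model_enumeration : {ae P, forall t, exists e : 'I_(K t) -> nat,
  enum_fun unmarked (alive ^~ t) (A' ^~ t) e /\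
  forall l : 'I_(K t), (w l t, a l t) = (label_jump (pts (e l) t, A' (e l) t)).1}.
Proof.
have [_ _ _] := Kwa; apply: filterS => t [e [ei en el]]; exists e; split.
  by split => // n; rewrite -model_selected en.
move=> l; have [wE aE] := el l; congr (_, _) => //.
by apply/eq_from_tnth => i; rewrite tnth_mktuple aE.
Qed.

(** Finiteness comes from [Kwa]: almost surely finitely many features are selected. *)
Lemma model_mass_fin : m (setT `*` ~` unmarked) < +oo.
Proof.
apply: (marked_mass_fin rects_measurable rectsT rectsI rects_gen exF mE MP (unmarked_rect _ _ _)).
  by change (0 < P setT); rewrite probability_setT lte01.
by apply: filterS model_enumeration => t [e [en _]]; exists (K t), e.
Qed.

Local Notation rhoM := (rho_post M G rho).

Lemma mark_kernel_unmarked x : (0 < x.1)%R ->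
  mark_kernel Omega M G x unmarked = ((1 - pi_A G x.1) ^+ M)%:E.
Proof.
move=> x0; transitivity (\prod_(i < M) G x.1 [set zeroV R q]).
  by apply: mark_kernelE => i; exact: measurable_zeroV.
rewrite (eq_bigr (fun=> (1 - pi_A G x.1)%:E)); last first.
  by move=> i _; rewrite kernel_zero.
by rewrite prodEFin big_const_ord iter_mulr_1.
Qed.

Lemma measurable_unmarked : measurable unmarked.
Proof. exact: (rects_measurable (unmarked_rect _ _ _)). Qed.

Lemma void_intensity_post C : measurable C ->
  m (C `*` unmarked) = intensity rhoM B0 C.
Proof.
move=> mC; have mU := measurable_unmarked.
have mf : measurable_fun setT (fun x => (\1_C x)%:E * mark_kernel Omega M G x unmarked).
  apply: emeasurable_funM; first by apply/measurable_EFinP; exact: measurable_indic.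
  exact: measurable_kernel.
have f0 x : 0 <= (\1_C x)%:E * mark_kernel Omega M G x unmarked.
  by rewrite mule_ge0// lee_fin.
rewrite mE//; last exact: unmarked_rect.
transitivity (\int[nu]_x ((\1_C x)%:E * mark_kernel Omega M G x unmarked)).
  rewrite integral_mkcond; apply: eq_integral => x _.
  by rewrite patchE indicE; case: ifP; rewrite ?mul1e ?mul0e.
rewrite (integral_levy_intensity B0 mrho rho0 f0 mf); apply: eq_integral => v _.
rewrite (integral_positive (fun s => C (s, v))); apply: eq_integral => s _.
rewrite /pos_density indicE mem_asbool /=; case: ifPn => s0; rewrite ?mule0//=.
case: asboolP => _; last by rewrite !mul0e.
by rewrite mul1e (mark_kernel_unmarked (x := (s, v)))// -EFinM.
Qed.

Lemma marked_mass_Psi : m (setT `*` ~` unmarked) = Psi M G rho B0.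
Proof.
have mU := measurable_unmarked; have mnU := measurableC mU.
have mk := measurable_kernel (mark_kernel Omega M G) _ mnU.
rewrite (marked_measureE B0 mrho rho0 G measurableT mnU).
rewrite (integral_levy_intensity B0 mrho rho0 (fun x => measure_ge0 (mark_kernel Omega M G x) _) mk).
apply: eq_integral => v _; rewrite integral_positiveT; apply: eq_integral => s _.
rewrite /pos_density /=; case: ifPn => s0; last by rewrite mule0.
have mk1 : mark_kernel Omega M G (s, v) setT = 1 by exact: prob_kernel.
have -> : mark_kernel Omega M G (s, v) (~` unmarked) =
    1 - mark_kernel Omega M G (s, v) unmarked.
  by rewrite -mk1; apply: finite_measureC => //; rewrite mk1 ltry.
by rewrite (mark_kernel_unmarked (x := (s, v)))// -EFinB -EFinM.
Qed.

(** On the void event [N] is Poisson with the intensity of [NM]. Once [P'] is scaled by the mass of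
    this event, [poisson_unique] identifies the two laws. *)
Lemma model_void_law d' (T' : measurableType d') (P' : probability T' R)
    (NM : T' -> {measure set X -> \bar R}) E :
  is_PRM P' (intensity rhoM B0) NM -> eval_sigma E ->
  P (void_marks unmarked alive A' `&` [set t | E (atoms R alive pts t : set X -> \bar R)]) =
  P (void_marks unmarked alive A') * P' [set t | E (NM t : set X -> \bar R)].
Proof.
move=> PM sE; have DD0 : rects unmarked := unmarked_rect _ _ _.
have mv := measurable_void rects_measurable MP DD0.
pose nuv := void_intensity rects_measurable m DD0.
have nuvE C : measurable C -> nuv C = intensity rhoM B0 C.
  by move=> mC; rewrite /nuv void_intensityE void_intensity_post.
have exv : exhausts nuv (levy_exhaust rho).
  have [mF ndF FT Foo] := exF; split => // p.
  by apply: le_lt_trans (Foo p); exact: (void_intensity_le rects_measurable rectsT mE DD0).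
have pv := void_poisson rects_measurable rectsT rectsI rects_gen exF mE MP DD0.
have c0 : (0 <= fine (P (void_marks unmarked alive A')))%R by rewrite fine_ge0.
have cE : P (void_marks unmarked alive A') = (NngNum c0)%:num%:E.
  by rewrite /= fineK// fin_num_measure.
pose P2 : {measure set T' -> \bar R} := mscale (NngNum c0) P'.
have P2E U : P2 U = P (void_marks unmarked alive A') * P' U by rewrite cE.
have pM : poisson P2 nuv NM.
  apply: poisson_mscale; apply: (eq_poisson (nu1 := intensity rhoM B0)).
    by move=> C mC; rewrite nuvE.
  exact: is_PRM_poisson PM.
have := poisson_unique exv (P1 := mrestr P mv) (P2 := P2) _ _ pv pM sE.
move=> h; rewrite setIC -P2E; apply: h.
- by rewrite P2E probability_setT mule1 cE ltry.
- rewrite P2E probability_setT mule1.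
  change (P (setT `&` void_marks unmarked alive A') = P (void_marks unmarked alive A')).
  by rewrite setTI.
Qed.

Local Notation lab := (fun l t => (w l t, a l t)).
Local Notation N := (atoms R alive pts).

Lemma sigma_ibp_measurable S : sigma_ibp alive pts A S -> measurable S.
Proof.
move: S; apply: smallest_sub; first exact: sigma_algebra_measurable.
exact: (ibp_gen_measurable malive mpts mA).
Qed.

Lemma sigma_ibp_label l B : measurable B ->
  sigma_ibp alive pts A ((fun t => (w l t, a l t)) @^-1` B).
Proof.
have [_ hw ha _] := Kwa.
have mw : measurable_fun setT (w l : g_sigma_algebraType (ibp_gen alive pts A) -> borel Omega).
  by move=> _ C mC; rewrite setTI; exact: hw.
have ma : measurable_fun setT (a l : g_sigma_algebraType (ibp_gen alive pts A) -> W).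
  by move=> _ C mC; rewrite setTI; exact: ha.
move=> mB; have mp := measurable_fun_pair mw ma.
by have := mp measurableT B mB; rewrite setTI.
Qed.

(** The common part of (i) and (ii), with [Phi] the identity or [crm_of]. *)
Lemma model_posterior (kappa : R.-pker L ~> R) d' (T' : measurableType d')
    (P' : probability T' R) dV' (V' : measurableType dV')
    (Phi : {measure set X -> \bar R} -> set V' -> \bar R)
    (Y : T' -> set V' -> \bar R) (J : T -> nat -> T' -> R)
    (c : L * R -> set V' -> \bar R) :
  jump_kernel G rho B0 kappa ->
  (forall E, @eval_sigma R _ V' E -> exists2 E', @eval_sigma R _ X E' &
    forall mu : {measure set X -> \bar R}, E (Phi mu) <-> E' mu) ->
  (forall D, measurable D -> measurable_fun setT (Y ^~ D)) ->
  (forall E, eval_sigma E ->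
    P (void_marks unmarked alive A' `&` [set t | E (Phi (N t))]) =
    P (void_marks unmarked alive A') * P' [set t | E (Y t)]) ->
  (forall t, posterior_jumps P' kappa (K t) (lab ^~ t) Y (J t)) ->
  (forall D, measurable D -> measurable_fun setT (c ^~ D)) ->
  {ae P, forall t k es D, listing alive A' unmarked k es t -> measurable D ->
    Phi (N t) D = Phi (atoms_unlisted R alive pts es t) D +
    \sum_(l < k) c (label_jump (pts (nth 0%N es l) t, A' (nth 0%N es l) t)) D} ->
  conditional_law P (sigma_ibp alive pts A) (@eval_sigma R _ V')
    (fun t => Phi (N t)) (fun t E => P' [set t' | E (fun D =>
      Y t' D + \sum_(l < K t) c (lab l t, J t l t') D)]).
Proof.
move=> kP PhiE mY YE YJ mc PhiD E sE.
have GGm : ibp_gen alive pts A `<=` measurable := ibp_gen_measurable malive mpts mA.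
have [GGK _ _ _] := Kwa.
have mK k : measurable (K @^-1` [set k]) by apply: sigma_ibp_measurable; exact: GGK.
have mlab l : measurable_fun setT (lab l).
  move=> _ B mB; rewrite setTI; apply: sigma_ibp_measurable; exact: sigma_ibp_label.
split=> [C mC|S sS].
  have mp := measurable_posterior_law mY YJ (GG := ibp_gen alive pts A) GGK sigma_ibp_label mc sE.
  by have := mp measurableT C mC; rewrite setTI.
have DD0 : rects unmarked := unmarked_rect _ _ _.
have := posterior_law_correct rects_measurable rectsT rectsI rects_gen exF mE MP DD0 model_mass_fin
  (@measurable_label_jump R Omega q M) mK mlab model_enumeration PhiE
  (jump_kernelE G_zero kP model_mass_fin) mY YE YJ GGm GGK sigma_ibp_label mc PhiD
  (fun S k sS => sigma_ibp_listing k sS) sS sE.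
by [].
Qed.

Lemma listing_integral k es t f : listing alive A' unmarked k es t ->
  (forall y, 0 <= f y) -> measurable_fun setT f ->
  \int[N t]_y f y = \int[atoms_unlisted R alive pts es t]_y f y +
    \sum_(l < k) f (pts (nth 0%N es l) t).
Proof.
move=> [sz [ues h]] f0 mf; rewrite (integral_conf_unlisted (pts ^~ t) f0 mf ues).
  by rewrite (big_nth 0%N) sz big_mkord.
by move=> n /h[].
Qed.

Lemma posterior_N (kappa : R.-pker L ~> R) d' (T' : measurableType d')
    (P' : probability T' R) (NM : T' -> {measure set X -> \bar R})
    (J : T -> nat -> T' -> R) :
  jump_kernel G rho B0 kappa -> is_PRM P' (intensity rhoM B0) NM ->
  (forall t, posterior_jumps P' kappa (K t) (lab ^~ t)
     (fun t' => NM t' : set X -> \bar R) (J t)) ->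
  conditional_law P (sigma_ibp alive pts A) (@eval_sigma R _ X)
    (fun t => N t : set X -> \bar R) (fun t E => P' [set t' | E (fun D =>
      NM t' D + \sum_(l < K t) \d_(J t l t', w l t) D)]).
Proof.
move=> kP PM YJ; have [mNM _ _ _] := PM.
apply: (model_posterior (Phi := fun mu => mu : set X -> \bar R)
  (c := fun z D => \d_(z.2, z.1.1) D) kP _ mNM _ YJ).
- by move=> E sE; exists E.
- by move=> E sE; exact: model_void_law.
- move=> D mD; apply/measurable_EFinP; apply: (measurableT_comp (measurable_indic mD)).
  by apply: measurable_fun_pair => //; exact: measurableT_comp.
- apply: aeW => t k es D lt mD.
  rewrite (measure_integral_indic (N t) mD) (listing_integral lt)//; last first.
    by apply/measurable_EFinP; exact: measurable_indic.
  rewrite -(measure_integral_indic (atoms_unlisted R alive pts es t) mD).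
  by congr (_ + _); apply: eq_bigr => l _; rewrite /= -surjective_pairing.
Qed.

Definition jump_part (B : set (borel Omega)) (y : X) : \bar R :=
  if (0 < y.1)%R && `[< B y.2 >] then y.1%:E else 0.

Lemma jump_part_ge0 B y : 0 <= jump_part B y.
Proof. by rewrite /jump_part; case: ifP => // /andP[y0 _]; rewrite lee_fin ltW. Qed.

Lemma measurable_jump_part B : measurable B -> measurable_fun setT (jump_part B).
Proof.
move=> mB; apply: measurable_fun_ifT => //; last exact/measurable_EFinP.
apply: measurable_and; first by apply: measurable_fun_ltr => //; exact: measurable_fst.
apply: (measurable_fun_bool true); rewrite setTI.
rewrite (_ : _ @^-1` _ = snd @^-1` B); first exact: measurable_preimage.
by apply/seteqP; split => y /= /asboolP.
Qed.

Lemma crm_ofE (mu : {measure set X -> \bar R}) B :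
  crm_of mu B = \int[mu]_y jump_part B y.
Proof.
rewrite /crm_of integral_mkcond; apply: eq_integral => y _.
rewrite patchE mem_asbool /jump_part; congr (if _ then _ else _).
by apply/asboolP/andP => -[h1 h2]; split => //; apply/asboolP.
Qed.

(** For each measurable [B], [eval_integral] gives a measurable functional of set functions that
    coincides on measures with the value at [B]. These are chosen for all [B] at once, as an event
    of the sigma-algebra may involve countably many sets. *)
Lemma crm_of_eval E : @eval_sigma R _ (borel Omega) E -> exists2 E', @eval_sigma R _ X E' &
  forall mu : {measure set X -> \bar R}, E (crm_of mu) <-> E' mu.
Proof.
move=> sE.
have /choice[I hI] B : exists I : (set X -> \bar R) -> \bar R, measurable B ->
    measurable_fun setT (I : path R X -> \bar R) /\
    forall mu : {measure set X -> \bar R}, I mu = \int[mu]_y jump_part B y.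
  have [mB|nB] := pselect (measurable B); last by exists (fun=> 0).
  have [I [mI IE]] := eval_integral (jump_part_ge0 B) (measurable_jump_part mB).
  by exists I.
exists [set mu | E (fun B => I B mu)].
  apply: (eval_sigma_preimage (Y := fun mu B => I B mu) _ _ sE).
    exact: smallest_sigma_algebra.
  move=> B C mB mC; have [mI _] := hI B mB.
  by have := mI measurableT C mC; rewrite setTI.
move=> mu; rewrite (eval_sigma_ext sE (m' := fun B => I B mu))//.
by move=> B mB; rewrite (hI B mB).2 crm_ofE.
Qed.

(** [crm_of] sees only atoms with positive jump, whereas the sum in (ii) contains every listed atom.
    The intensity does not charge [s <= 0], so almost surely no atom lies there. *)
Lemma model_jumps_pos : {ae P, forall t n, alive n t -> (0 < (pts n t).1)%R}.
Proof.
pose Z : set X := [set x | (x.1 <= 0)%R].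
have mZ : measurable Z.
  rewrite (_ : Z = fst @^-1` `]-oo, 0%R]%classic); last first.
    by apply/seteqP; split => x /=; rewrite in_itv.
  by apply: measurable_preimage => //; exact: measurable_fst.
have Z0 : intensity rho B0 Z = 0.
  rewrite /intensity integral0_eq// => v _.
  rewrite (_ : [set s | _] = set0) ?integral_set0//.
  by rewrite -subset0 => s [/= s0] /(lt_le_trans s0); rewrite ltxx.
have [mN N0 _ _] := N_PRM.
have := N0 _ mZ; rewrite Z0 ltry => /(_ erefl 0%N).
rewrite /= expr0 fact0 divr1 mul1r oppr0 expR0 => PZ.
have mZ0 : measurable [set t | N t Z = 0].
  by apply: (measurable_preimage (f := fun t => N t Z) (C := [set 0])) => //; exact: mN.
exists (~` [set t | N t Z = 0]); split.
- exact: measurableC.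
- have -> : P (~` [set t | N t Z = 0]) = 1 - P [set t | N t Z = 0] by rewrite probability_setC.
  by rewrite (_ : P _ = 1) ?subee.
move=> t nt NtZ; apply: nt => n aln; rewrite ltNge; apply/negP => sn.
have := conf_delete R (pts ^~ t) Z (al := alive ^~ t) aln.
rewrite mem_set// => h.
have : (1 : \bar R) <= N t Z by rewrite /atoms h leeDl.
rewrite [N t Z]NtZ.
by rewrite lee_fin ler10.
Qed.

Lemma posterior_crm (kappa : R.-pker L ~> R) d' (T' : measurableType d')
    (P' : probability T' R) (muM : T' -> set (borel Omega) -> \bar R)
    (J : T -> nat -> T' -> R) :
  jump_kernel G rho B0 kappa -> is_CRM P' rhoM B0 muM ->
  (forall t, posterior_jumps P' kappa (K t) (lab ^~ t) muM (J t)) ->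
  conditional_law P (sigma_ibp alive pts A) (@eval_sigma R _ (borel Omega))
    (fun t => crm_of (N t)) (fun t E => P' [set t' | E (fun D =>
      muM t' D + \sum_(l < K t) (J t l t')%:E * \d_(w l t) D)]).
Proof.
move=> kP [NM PM muE] YJ; have [mNM _ _ _] := PM.
have mcrm D : measurable D -> measurable_fun setT (fun t' => crm_of (NM t') D).
  move=> mD _ C mC; rewrite setTI.
  have [E' sE' E'P] := crm_of_eval (eval_sigma_eval mD mC).
  rewrite (_ : _ @^-1` C = [set t' | E' (NM t' : set X -> \bar R)]).
    exact: (measurable_eval_sigma (Y := fun t' => NM t' : set X -> \bar R) mNM).
  by apply/seteqP; split => t' /E'P.
apply: (model_posterior (Phi := fun mu => crm_of mu)
  (c := fun z D => z.2%:E * \d_(z.1.1) D) kP crm_of_eval _ _ YJ).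
- move=> D mD; apply: (eq_measurable_fun (fun t' => crm_of (NM t') D)); last exact: mcrm.
  by move=> t' _; rewrite muE.
- move=> E sE; have [E' sE' E'P] := crm_of_eval sE.
  rewrite (_ : [set t | E (crm_of _)] = [set t | E' (N t : set X -> \bar R)]); last first.
    by apply/seteqP; split => t /E'P.
  rewrite (model_void_law PM sE'); congr (_ * P' _).
  apply/seteqP; split => t' /=.
    by move=> /E'P; rewrite (eval_sigma_ext sE (m' := muM t'))// => B mB; rewrite muE.
  by move=> Et'; apply/E'P; rewrite (eval_sigma_ext sE (m' := muM t'))// => B mB; rewrite muE.
- move=> D mD; apply: emeasurable_funM; first exact/measurable_EFinP.
  apply/measurable_EFinP; apply: (measurableT_comp (measurable_indic mD)).
  exact: measurableT_comp.
- apply: filterS model_jumps_pos => t pos k es D lt mD.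
  rewrite !crm_ofE (listing_integral lt); last 2 first.
  + exact: jump_part_ge0.
  + exact: measurable_jump_part.
  congr (_ + _); apply: eq_bigr => l _; rewrite /jump_part /=.
  have [sz [_ h]] := lt.
  rewrite pos ?andTb; last by case: (h (nth 0%N es l)) => _ []; rewrite ?mem_nth ?sz.
  rewrite /dirac indicE mem_asbool; case: asboolP => _; by rewrite ?mule1 ?mule0.
Qed.

(** [symmetric_product] for indicators of rectangles; by [void_mass] the factor of the void event is
    [expeR (- Psi M G rho B0)]. *)
Lemma marginal k (B : 'I_k -> set (borel Omega)) (D : 'I_k -> 'I_M -> set V) :
  (forall l, measurable (B l)) -> (forall l i, measurable (D l i)) ->
  (forall l, exists i, ~ D l i (zeroV R q)) ->
  selected_measure P K w a B D =
  expeR (- Psi M G rho B0) *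
  \prod_(l < k) \int[B0]_(v in B l)
    \int[lebesgue_measure]_(s in [set s : R | (0 < s)%R])
      ((rhoM s v)%:E * \prod_(i < M) h_A G s (D l i)).
Proof.
move=> mB mD D0.
have DD0 : rects unmarked := unmarked_rect _ _ _.
have [GGK _ _ _] := Kwa.
have mK j : measurable (K @^-1` [set j]) by apply: sigma_ibp_measurable; exact: GGK.
have mlab l : measurable_fun setT (fun t => (w l t, a l t)).
  by move=> _ C mC; rewrite setTI; apply: sigma_ibp_measurable; exact: sigma_ibp_label.
pose f l (x : L) : \bar R := (\1_(B l) x.1)%:E * \prod_(i < M) (\1_(D l i) (tnth x.2 i))%:E.
have f0 l x : 0 <= f l x.
  by rewrite mule_ge0 ?lee_fin//; apply: prode_ge0 => i _; rewrite lee_fin.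
have mf l : measurable_fun setT (f l).
  apply: emeasurable_funM.
    apply/measurable_EFinP; apply: (measurableT_comp (measurable_indic (mB l))).
    exact: measurable_fst.
  apply: emeasurable_prod => i; apply/measurable_EFinP.
  apply: (measurableT_comp (measurable_indic (mD l i))).
  by apply: (measurableT_comp (@measurable_tnth _ V M i)); exact: measurable_snd.
have mfT l : measurable_fun setT (fun y => f l (label_jump y).1).
  apply: (measurableT_comp (mf l)); apply: (measurableT_comp measurable_fst).
  exact: measurable_label_jump.
have fE l x : f l x = (`[< B l x.1 /\ forall i, D l i (tnth x.2 i) >])%:R%:E.
  rewrite /f indicE mem_asbool; case: asboolP => Bx; last by rewrite mul0e asboolF// => -[].
  rewrite mul1e; case: asboolP => [[_ h]|h].
    by rewrite big1// => i _; rewrite indicE mem_set.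
  have [i ni] : exists i, ~ D l i (tnth x.2 i).
    by apply: contrapT => h'; apply: h; split => // i; apply: contrapT => nD; apply: h'; exists i.
  by rewrite (bigD1 i)//= indicE memNset// mul0e.
have f1 l x : f l x <= 1.
  by rewrite fE lee_fin; case: asboolP; rewrite ?ler01.
have foo l : \int[m]_y off unmarked (fun y => f l (label_jump y).1) y < +oo.
  exact: (off_le1 rects_measurable DD0 model_mass_fin).
have fint l : \int[m]_y off unmarked (fun y => f l (label_jump y).1) y =
  \int[B0]_(v in B l) \int[lebesgue_measure]_(s in [set s : R | (0 < s)%R])
      ((rhoM s v)%:E * \prod_(i < M) h_A G s (D l i)).
  (* [D l] keeps away from zero, so [f l] already vanishes on unmarked atoms. *)
  transitivity (\int[m]_y f l (label_jump y).1).
    apply: eq_integral => y _; rewrite /off mem_asbool; case: asboolP => // uy.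
    rewrite fE asboolF// => -[_ h]; have [i] := D0 l; apply.
    by have := h i; rewrite /= (uy i).
  rewrite (integral_marked_measure_post B0 mrho rho0 G_zero (fun y => f0 l _) (mfT l)).
  rewrite [RHS]integral_mkcond; apply: eq_integral => v _.
  rewrite patchE; case: ifPn => vB; last first.
    rewrite integral0_eq// => s _.
    rewrite (_ : tuple_integral _ _ = 0) ?mule0// -(tuple_integral0 M (h_A G s)).
    by apply: eq_tuple_integral => u; rewrite /f /= indicE (negPf vB) mul0e.
  apply: eq_integral => s _; rewrite -tuple_integral_prod//; congr (_ * _).
  by apply: eq_tuple_integral => u; rewrite /f /= indicE vB mul1e.
have voidE : P (void_marks unmarked alive A') = expeR (- Psi M G rho B0).
  transitivity (P setT * expeR (- m (setT `*` ~` unmarked))).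
    exact: (void_mass rects_measurable rectsT rectsI rects_gen exF mE MP DD0).
  by rewrite probability_setT mul1e marked_mass_Psi.
have := symmetric_product rects_measurable rectsT rectsI rects_gen exF mE MP DD0
  (@measurable_label_jump R Omega q M) mK mlab model_enumeration f0 mf foo.
under [X in _ = X * _ -> _]eq_bigr do rewrite fint.
move=> e; rewrite muleC -voidE; refine (etrans _ e).
rewrite /selected_measure -ge0_integral_sum//.
- apply: eq_integral => t _; rewrite -sumEFin; apply: eq_bigr => p _.
  rewrite -prodEFin; apply: eq_bigr => l _.
  by rewrite /f EFinM -prodEFin.
- move=> p; apply: measurable_funTS; apply: emeasurable_prod => l.
  exact: (measurableT_comp (mf l)).
- by move=> p t _; apply: prode_ge0 => l _.
Qed.

End model.

Theorem theorem2p1 (R : realType)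
  (Omega : ptopologicalType) (Omega_polish : polish R Omega)
  (B0 : probability (borel Omega) R)
  (rho : R -> Omega -> R) (rho_levy : levy_density rho)
  (q M : nat) (G : R.-pker R ~> q.-tuple R)
  (G_zero : forall s : R, (0 < s)%R -> (0 < 1 - pi_A G s)%R)
  (d : measure_display) (T : measurableType d) (P : probability T R)
  (alive : nat -> T -> bool) (pts : nat -> T -> R * borel Omega)
  (malive : forall k, measurable_fun setT (alive k))
  (mpts : forall k, measurable_fun setT (pts k))
  (N_PRM : is_PRM P (intensity rho B0) (atoms_measure R alive pts))
  (A : 'I_M -> nat -> T -> q.-tuple R)
  (A_IBP : iid_IBP_marks P alive pts G A)
  (K : T -> nat) (w : nat -> T -> borel Omega)
  (a : nat -> T -> M.-tuple (q.-tuple R))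
  (Kwa : enumerates_selected P alive pts A K w a) :
  let N := atoms_measure R alive pts in
  let mu := fun t => crm_of (N t) in
  let sigmaZ := sigma_ibp alive pts A in
  let rhoM := rho_post M G rho in
  [/\ (* (i) *)
      forall kappa : R.-pker (borel Omega * M.-tuple (q.-tuple R)) ~> R,
      jump_kernel G rho B0 kappa ->
      forall (d' : measure_display) (T' : measurableType d')
        (P' : probability T' R)
        (NM : T' -> {measure set (R * borel Omega) -> \bar R})
        (J : T -> nat -> T' -> R),
      is_PRM P' (intensity rhoM B0) NM ->
      (forall t, posterior_jumps P' kappa (K t) (fun l => (w l t, a l t))
                   (fun t' => NM t' : set (R * borel Omega) -> \bar R) (J t)) ->
      conditional_law P sigmaZ (@eval_sigma R _ (R * borel Omega)%type)
        (fun t => N t : set (R * borel Omega) -> \bar R)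
        (fun t E => P' [set t' | E (fun D =>
           NM t' D + \sum_(l < K t) \d_(J t l t', w l t) D)]),
      (* (ii) *)
      forall kappa : R.-pker (borel Omega * M.-tuple (q.-tuple R)) ~> R,
      jump_kernel G rho B0 kappa ->
      forall (d' : measure_display) (T' : measurableType d')
        (P' : probability T' R)
        (muM : T' -> set (borel Omega) -> \bar R)
        (J : T -> nat -> T' -> R),
      is_CRM P' rhoM B0 muM ->
      (forall t, posterior_jumps P' kappa (K t) (fun l => (w l t, a l t))
                   muM (J t)) ->
      conditional_law P sigmaZ (@eval_sigma R _ (borel Omega))
        mu
        (fun t E => P' [set t' | E (fun D =>
           muM t' D + \sum_(l < K t) (J t l t')%:E * \d_(w l t) D)]) &
      (* (iii) *)
      forall (k : nat) (B : 'I_k -> set (borel Omega))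
        (D : 'I_k -> 'I_M -> set (q.-tuple R)),
      (forall l, measurable (B l)) -> (forall l i, measurable (D l i)) ->
      (forall l, exists i, ~ D l i (zeroV R q)) ->
      selected_measure P K w a B D =
      expeR (- Psi M G rho B0) *
      \prod_(l < k) \int[B0]_(v in B l)
        \int[lebesgue_measure]_(s in [set s : R | (0 < s)%R])
          ((rhoM s v)%:E * \prod_(i < M) h_A G s (D l i))].
Proof.
have [mrho rho0 _] := rho_levy.
split.
- move=> kappa kP d' T' P' NM J PM YJ.
  exact: (posterior_N mrho rho0 G_zero malive mpts N_PRM A_IBP Kwa kP PM YJ).
- move=> kappa kP d' T' P' muM J PM YJ.
  exact: (posterior_crm mrho rho0 G_zero malive mpts N_PRM A_IBP Kwa kP PM YJ).
- move=> k B D mB mD D0.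
  exact: (marginal mrho rho0 G_zero malive mpts N_PRM A_IBP Kwa mB mD D0).
Qed.
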